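(* Let $T>0$, let $k,d,m$ be positive integers and $\mathcal J=\{1,\dots,m\}$. Let $b:[0,T]\times\mathbb R^k\to\mathbb R^k$ and $\sigma:[0,T]\times\mathbb R^k\to\mathbb R^{k\times d}$ be jointly continuous with $|b(t,x)|+|\sigma(t,x)|\le C(1+|x|)$ and $|b(t,x)-b(t,x')|+|\sigma(t,x)-\sigma(t,x')|\le C|x-x'|$ for some constant $C\ge 0$ and all $t\in[0,T]$, $x,x'\in\mathbb R^k$. Assume that for every $i\in\mathcal J$ the function $f_i:[0,T]\times\mathbb R^k\times\mathbb R\times\mathbb R^d\to\mathbb R$, $(t,x,y,z)\mapsto f_i(t,x,y,z)$, is such that $(t,x)\mapsto f_i(t,x,y,z)$ is continuous uniformly with respect to $(y,z)$, and $|f_i(t,x,y,z)-f_i(t,x,\bar y,\bar z)|\le C(|y-\bar y|+|z-\bar z|)$ for some $C\ge0$ and all arguments. Assume that for all $i\ne j$ in $\mathcal J$ the function $g_{ij}:[0,T]\times\mathbb R^k\to\mathbb R$ is continuous, non-negative and of polynomial growth, and that for every $(t,x)\in[0,T]\times\mathbb R^k$ and every finite sequence $i_1,\dots,i_N\in\mathcal J$ with $N\ge3$, $i_1=i_N$ and $\mathrm{card}\{i_1,\dots,i_N\}=N-1$ one has $g_{i_1i_2}(t,x)+\dots+g_{i_{N-1}i_N}(t,x)>0$. Assume that every $h_i:\mathbb R^k\to\mathbb R$ is continuous, of polynomial growth, and $h_i(x)\ge\max_{j\in\mathcal J\setminus\{i\}}(h_j(x)-g_{ij}(T,x))$ for all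 $x\in\mathbb R^k$. Let $(u_i)_{i\in\mathcal J}$ be a viscosity subsolution and $(v_i)_{i\in\mathcal J}$ a viscosity supersolution, all $u_i,v_i$ being of polynomial growth, of the system: for all $i\in\mathcal J$, $$\min\Big\{v_i(t,x)-\max_{j\in\mathcal J\setminus\{i\}}(v_j(t,x)-g_{ij}(t,x));\ -\partial_tv_i(t,x)-\mathcal Lv_i(t,x)-f_i(t,x,v_i(t,x),\sigma^\top(t,x)D_xv_i(t,x))\Big\}=0,\qquad v_i(T,x)=h_i(x).$$ Then for every $i\in\mathcal J$, $u_i(t,x)\le v_i(t,x)$ for all $(t,x)\in[0,T]\times\mathbb R^k$.
   Context: $\mathcal L\varphi(t,x)=\frac12\mathrm{Tr}[(\sigma\sigma^\top)(t,x)D^2_{xx}\varphi(t,x)]+b(t,x)^\top D_x\varphi(t,x)$. A function $\phi$ is of polynomial growth if $|\phi(t,x)|\le C(1+|x|^\gamma)$ (resp. $|\phi(x)|\le C(1+|x|^\gamma)$) for some constants $C,\gamma\ge0$. A maximum over the empty set is read as $-\infty$. Jets. For $u:[0,T]\times\mathbb R^k\to\mathbb R$ lower (resp. upper) semicontinuous, the parabolic subjet $J^-u(t,x)$ (resp. superjet $J^+u(t,x)$) is the set of triples $(p,q,M)\in\mathbb R\times\mathbb R^k\times\mathbb S^k$ ($\mathbb S^k$ = symmetric real $k\times k$ matrices) with $u(t',x')\ge$ (resp. $\le$) $u(t,x)+p(t'-t)+\langle q,x'-x\rangle+\frac12\langle x'-x,M(x'-x)\rangle+o(|t'-t|+|x'-x|^2)$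 as $(t',x')\to(t,x)$ in $[0,T]\times\mathbb R^k$. The limiting subjet $\bar J^-u(t,x)$ (resp. limiting superjet $\bar J^+u(t,x)$) is the set of limits $(p,q,M)=\lim_n(p_n,q_n,M_n)$ with $(p_n,q_n,M_n)\in J^-u(t_n,x_n)$ (resp. $J^+u(t_n,x_n)$), $(t_n,x_n)\to(t,x)$ and $u(t_n,x_n)\to u(t,x)$. Viscosity sub/supersolutions. $(v_i)_{i\in\mathcal J}$ with every $v_i:[0,T]\times\mathbb R^k\to\mathbb R$ lower (resp. upper) semicontinuous is a viscosity supersolution (resp. subsolution) of the system if for every $i\in\mathcal J$, every $(t,x)\in[0,T)\times\mathbb R^k$ and every $(p,q,M)\in\bar J^-v_i(t,x)$ (resp. $\bar J^+v_i(t,x)$), $$\min\Big\{v_i(t,x)-\max_{j\in\mathcal J\setminus\{i\}}(v_j(t,x)-g_{ij}(t,x));\ -p-b(t,x)^\top q-\tfrac12\mathrm{Tr}[(\sigma\sigma^\top)(t,x)M]-f_i(t,x,v_i(t,x),\sigma(t,x)^\top q)\Big\}\ge0\ (\text{resp. }\le0),$$ and $v_i(T,x)\ge h_i(x)$ (resp. $\le h_i(x)$) for all $x\in\mathbb R^k$. *)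

(* Defs.v *)
From HB Require Import structures.
From mathcomp Require Import all_boot all_order all_algebra.
From mathcomp Require Import all_classical all_reals all_analysis.

Set Implicit Arguments.
Unset Strict Implicit.
Unset Printing Implicit Defensive.

Import Order.TTheory GRing.Theory Num.Theory.
Import numFieldNormedType.Exports.

Local Open Scope classical_set_scope.
Local Open Scope ring_scope.

(* Functions on [0, T] x R^k are total functions on R * 'cV[R]_k. Only their
   values on [domain k T] enter the definitions below. *)
Definition domain (R : realType) (k : nat) (T : R) : set (R * 'cV[R]_k) :=
  [set` `[0, T]] `*` setT.
Arguments domain {R} k T _.

(* Euclidean norm of a vector, Frobenius norm of a matrix; the norm [`| A |]
   of the library is the max norm. *)
Definition enorm (R : realType) (p q : nat) (A : 'M[R]_(p, q)) : R :=
  Num.sqrt (\sum_(i < p) \sum_(j < q) A i j ^+ 2).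

Definition dotp (R : realType) (k : nat) (x y : 'cV[R]_k) : R :=
  (x^T *m y) 0 0.

Definition poly_growth (R : realType) (k : nat) (phi : 'cV[R]_k -> R) : Prop :=
  exists C gamma : R, 0 <= C /\ 0 <= gamma /\
    forall x, `|phi x| <= C * (1 + enorm x `^ gamma).

Definition poly_growth_on (R : realType) (k : nat) (T : R)
    (phi : R * 'cV[R]_k -> R) : Prop :=
  exists C gamma : R, 0 <= C /\ 0 <= gamma /\
    forall (t : R) x, 0 <= t <= T -> `|phi (t, x)| <= C * (1 + enorm x `^ gamma).

(* The topology of [subspace A] makes these semicontinuity on A for the
   relative topology; nothing is required of u outside A. *)
Definition lsc_on (R : realType) (X : topologicalType) (A : set X)
    (u : X -> R) : Prop :=
  lower_semicontinuous (fun z : subspace A => (u z)%:E).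

Definition usc_on (R : realType) (X : topologicalType) (A : set X)
    (u : X -> R) : Prop :=
  lsc_on A (fun z => - u z).

(* Value at (t', x') of the polynomial with jet (p, q, M) and constant term c
   at (t, x). *)
Definition jet_poly (R : realType) (k : nat) (c : R) (z : R * 'cV[R]_k)
    (p : R) (q : 'cV[R]_k) (M : 'M[R]_k) (z' : R * 'cV[R]_k) : R :=
  c + p * (z'.1 - z.1) + dotp q (z'.2 - z.2)
    + 2^-1 * dotp (z'.2 - z.2) (M *m (z'.2 - z.2)).

Definition parabolic_littleo (R : realType) (k : nat) (T : R)
    (z : R * 'cV[R]_k) (r : R * 'cV[R]_k -> R) : Prop :=
  let F := within (domain k T) (nbhs z) in
  r =o_F (fun z' : R * 'cV[R]_k => `|z'.1 - z.1| + enorm (z'.2 - z.2) ^+ 2).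

Definition subjet (R : realType) (k : nat) (T : R) (u : R * 'cV[R]_k -> R)
    (z : R * 'cV[R]_k) (p : R) (q : 'cV[R]_k) (M : 'M[R]_k) : Prop :=
  M^T = M /\
  exists r : R * 'cV[R]_k -> R, parabolic_littleo T z r /\
    forall z', domain k T z' -> u z' >= jet_poly (u z) z p q M z' + r z'.

Definition superjet (R : realType) (k : nat) (T : R) (u : R * 'cV[R]_k -> R)
    (z : R * 'cV[R]_k) (p : R) (q : 'cV[R]_k) (M : 'M[R]_k) : Prop :=
  M^T = M /\
  exists r : R * 'cV[R]_k -> R, parabolic_littleo T z r /\
    forall z', domain k T z' -> u z' <= jet_poly (u z) z p q M z' + r z'.

(* Limits of jets, for J either [subjet] or [superjet]. *)
Definition limiting_jet (R : realType) (k : nat) (T : R)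
    (J : (R * 'cV[R]_k -> R) -> R * 'cV[R]_k -> R -> 'cV[R]_k -> 'M[R]_k -> Prop)
    (u : R * 'cV[R]_k -> R)
    (z : R * 'cV[R]_k) (p : R) (q : 'cV[R]_k) (M : 'M[R]_k) : Prop :=
  exists (zn : nat -> R * 'cV[R]_k) (pn : nat -> R) (qn : nat -> 'cV[R]_k)
      (Mn : nat -> 'M[R]_k),
    (forall n, domain k T (zn n) /\ J u (zn n) (pn n) (qn n) (Mn n)) /\
    zn n @[n --> \oo] --> z /\
    u (zn n) @[n --> \oo] --> u z /\
    pn n @[n --> \oo] --> p /\
    qn n @[n --> \oo] --> q /\
    Mn n @[n --> \oo] --> M.

Definition limiting_subjet (R : realType) (k : nat) (T : R) :=
  limiting_jet T (@subjet R k T).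

Definition limiting_superjet (R : realType) (k : nat) (T : R) :=
  limiting_jet T (@superjet R k T).

(* max_{j <> i} (w_j - c_ij), in the extended reals: it is -oo when there is
   no j <> i. *)
Definition obstacle (R : realType) (m : nat) (w : 'I_m -> R)
    (c : 'I_m -> 'I_m -> R) (i : 'I_m) : \bar R :=
  \big[maxe/-oo%E]_(j < m | j != i) (w j - c i j)%:E.

(* Left-hand side of the i-th equation at z = (t, x), with (p, q, M) in place
   of (d_t v_i, D_x v_i, D^2_xx v_i). *)
Definition system_op (R : realType) (k d m : nat)
    (b : R * 'cV[R]_k -> 'cV[R]_k) (sigma : R * 'cV[R]_k -> 'M[R]_(k, d))
    (f : 'I_m -> R * 'cV[R]_k -> R -> 'cV[R]_d -> R)
    (g : 'I_m -> 'I_m -> R * 'cV[R]_k -> R)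
    (v : 'I_m -> R * 'cV[R]_k -> R) (i : 'I_m)
    (z : R * 'cV[R]_k) (p : R) (q : 'cV[R]_k) (M : 'M[R]_k) : \bar R :=
  mine ((v i z)%:E - obstacle (fun j => v j z) (fun j l => g j l z) i)%E
    (- p - dotp (b z) q - 2^-1 * \tr (sigma z *m (sigma z)^T *m M)
       - f i z (v i z) ((sigma z)^T *m q))%:E.

Definition viscosity_supersolution (R : realType) (k d m : nat) (T : R)
    (b : R * 'cV[R]_k -> 'cV[R]_k) (sigma : R * 'cV[R]_k -> 'M[R]_(k, d))
    (f : 'I_m -> R * 'cV[R]_k -> R -> 'cV[R]_d -> R)
    (g : 'I_m -> 'I_m -> R * 'cV[R]_k -> R) (h : 'I_m -> 'cV[R]_k -> R)
    (v : 'I_m -> R * 'cV[R]_k -> R) : Prop :=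
  (forall i, lsc_on (domain k T) (v i)) /\
  (forall i (t : R) x p q M, 0 <= t < T ->
     limiting_subjet T (v i) (t, x) p q M ->
     (0 <= system_op b sigma f g v i (t, x) p q M)%E) /\
  (forall i x, h i x <= v i (T, x)).

Definition viscosity_subsolution (R : realType) (k d m : nat) (T : R)
    (b : R * 'cV[R]_k -> 'cV[R]_k) (sigma : R * 'cV[R]_k -> 'M[R]_(k, d))
    (f : 'I_m -> R * 'cV[R]_k -> R -> 'cV[R]_d -> R)
    (g : 'I_m -> 'I_m -> R * 'cV[R]_k -> R) (h : 'I_m -> 'cV[R]_k -> R)
    (u : 'I_m -> R * 'cV[R]_k -> R) : Prop :=
  (forall i, usc_on (domain k T) (u i)) /\
  (forall i (t : R) x p q M, 0 <= t < T ->
     limiting_superjet T (u i) (t, x) p q M ->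
     (system_op b sigma f g u i (t, x) p q M <= 0)%E) /\
  (forall i x, u i (T, x) <= h i x).

(* Main.v *)
Require Import Defs.
From HB Require Import structures.
From mathcomp Require Import all_boot all_order all_algebra.
From mathcomp Require Import all_classical all_reals all_analysis.
From mathcomp Require Import ring lra.

(** Let z be a maximum point over (i, t, x) of
    (u_i - v_i) / (1 - t / (2T))^l - theta (1 + |x|^2)^(n+1), assumed positive.
    Following the indices j for which u_j - g_ij >= u_i at z would produce a loop of
    switching costs with sum zero, so some maximizing i is not blocked by the
    obstacle, and doubling the variables at z for this i gives a contradiction
    for l large. The time variables are penalized much more strongly than the
    space variables, since sigma and b are only continuous in time.

    The theorem on sums and Alexandrov's theorem are not needed: after a parabolic
    blow-up the diffusion is frozen, the two semicontinuous functions become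
    sup-envelopes, mollified by averages over boxes, and their resolvents along two
    random walks run with the same random choices are C^2 functions that can be
    compared with the blown-up functions by the maximum principle. The coupling
    produces the term al * |sigma(z1) - sigma(z2)|^2. *)

Set Implicit Arguments.
Unset Strict Implicit.
Unset Printing Implicit Defensive.

Import Order.TTheory GRing.Theory Num.Theory.
Import numFieldNormedType.Exports.

Local Open Scope classical_set_scope.
Local Open Scope ring_scope.

(** * Averages over intervals *)

(** The functions compared are only semicontinuous: they have no modulus of continuity and no lower
    bound. The blow-up at scale mu subtracts the linear part mu q.x and divides by mu^2, so drift
    and nonlinearity become a constant kappa and only - p - tr / 2 <= kappa with frozen sigma is
    left. Every bound on the box of size K must be fixed before mu, hence independently of the
    functions; all of them come from U1(z) + U2(z') <= Q(z, z') + eta and U1(0) = U2(0) = 0.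

    The resolvent W of some P >= U - eta satisfies gen W = W - P up to eta. Where U - W exceeds
    kappa by a few eta, W would thus touch U from above with - gen W > kappa; hence U(0) <= W(0) +
    kappa + O(eta). On the other hand Q is a quadratic polynomial, which coupled walks raise by the
    same constant at every step, so W1(0) + W2(0) is at most p1 + p2 plus the trace term, up to
    O(eta). Together these bounds give the sum of the two viscosity inequalities. *)

Section Increments.
Variable R : realType.
Implicit Types (x y A C : R) (f : R -> R).

Lemma ler_addinvP x y C : (forall n : nat, x <= y + C / n.+1%:R) -> x <= y.
Proof.
move=> H; rewrite leNgt; apply/negP => yx.
have C0 : 0 < C.
  by rewrite ltNge; apply/negP => C0; have := H 0%N; rewrite divr1; lra.
have : 0 < (x - y) / C by rewrite divr_gt0 ?subr_gt0.
move=> /ltr_add_invr[n]; rewrite add0r => Hn; have := H n.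
apply/negP; rewrite -ltNge -ltrBrDl mulrC -ltr_pdivlMr //.
Qed.

(** Cutting [a, b] into n + 1 equal pieces leaves a total quadratic error C (b - a)^2 / (n + 1).
    This serves as mean value theorem for functions whose derivative is known only through
    first-order expansions. *)
Lemma increment_le f A C (a b : R) : a <= b ->
  (forall x y, a <= x -> x <= y -> y <= b ->
     f y - f x <= A * (y - x) + C * (y - x) ^+ 2) ->
  f b - f a <= A * (b - a).
Proof.
move=> ab H; apply: (@ler_addinvP _ _ (C * (b - a) ^+ 2)) => n.
set m : R := n.+1%:R; have m0 : 0 < m by rewrite ltr0n.
pose t i : R := a + (b - a) * (i%:R / m).
have t0 : t 0%N = a by rewrite /t mul0r mulr0 addr0.
have tm : t n.+1 = b by rewrite /t divff ?lt0r_neq0// mulr1; lra.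
rewrite -{1}tm -{1}t0 -(telescope_sumr (fun i => f (t i)))//.
have -> : A * (b - a) + C * (b - a) ^+ 2 / m =
   \sum_(0 <= i < n.+1) (A * ((b - a) / m) + C * ((b - a) / m) ^+ 2).
  rewrite big_const_nat subn0 iter_addr_0 -mulr_natl -/m.
  by field; exact: lt0r_neq0.
apply: ler_sum_nat => i /andP[_ i_le].
have dt : t i.+1 - t i = (b - a) / m.
  by rewrite /t -natr1; field; exact: lt0r_neq0.
have q01 j : (j <= n.+1)%N -> 0 <= j%:R / m <= 1.
  by move=> jn; rewrite divr_ge0 ?ler0n ?(ltW m0)//= ler_pdivrMr// mul1r ler_nat.
have dm0 : 0 <= (b - a) / m by rewrite divr_ge0 ?subr_ge0// ltW.
rewrite -dt; apply: H.
- by rewrite /t lerDl mulr_ge0 ?subr_ge0//; have /andP[] := q01 i (ltnW i_le).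
- by rewrite -subr_ge0 dt.
- have /andP[_ q1] := q01 i.+1 i_le.
  by rewrite /t addrC -lerBrDr ler_piMr ?subr_ge0.
Qed.

Lemma increment_const f C : (forall x t, `|f (x + t) - f x| <= C * t ^+ 2) ->
  forall x y, f x = f y.
Proof.
move=> H.
have le x y : x <= y -> f x = f y.
  move=> xy; apply/eqP; rewrite -subr_eq0 -oppr_eq0 opprB -normr_le0 ler_norml.
  rewrite oppr0; apply/andP; split.
    rewrite -oppr_le0 opprB.
    have := @increment_le (fun z => - f z) 0 C x y xy.
    rewrite mul0r opprK addrC; apply => a b _ ab _; rewrite mul0r add0r.
    have := H a (b - a); rewrite subrKC ler_norml => /andP[+ _].
    by lra.
  have := @increment_le f 0 C x y xy.
  rewrite mul0r; apply => a b _ ab _; rewrite mul0r add0r.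
  by have := H a (b - a); rewrite subrKC ler_norml => /andP[_].
by move=> x y; case: (lerP x y) => [/le//|/ltW/le].
Qed.

Definition lipschitz1 (L : R) f := forall x y, `|f x - f y| <= L * `|x - y|.

(** A primitive is characterized by its first-order expansion, with the Lipschitz constant of f in
    the remainder. For f that is not Lipschitz the condition is vacuous. *)
Definition primitive f (F : R -> R) :=
  forall L, lipschitz1 L f ->
    forall x t, `|F (x + t) - F x - t * f x| <= L * t ^+ 2.

Lemma lipschitz1_continuous L f : lipschitz1 L f -> continuous f.
Proof.
move=> Lf x; apply/cvgrPdist_le => e e0.
pose M := `|L| + 1; have M0 : 0 < M by rewrite ltr_wpDl.
near=> y; apply: le_trans (Lf x y) _.
have : `|x - y| <= e / M by near: y; apply: cvgr_dist_le => //; exact: divr_gt0.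
rewrite ler_pdivlMr// => /(le_trans _); apply; rewrite mulrC ler_wpM2l//.
by rewrite /M ler_wpDr// ler_norm.
Unshelve. all: by end_near. Qed.

Lemma lipschitz1_integral L f : lipschitz1 L f -> forall x y c, x <= c <= y ->
  `|\int[lebesgue_measure]_(s in `[x, y]) f s - (y - x) * f c| <= L * (y - x) ^+ 2.
Proof.
move=> Lf x y c /andP[xc cy]; have xy := le_trans xc cy.
have mD : measurable `[x, y]%classic by [].
have intc g : continuous g ->
    lebesgue_measure.-integrable `[x, y] (EFin \o (g : R -> R)).
  move=> cg; apply: continuous_compact_integrable; first exact: segment_compact.
  exact: continuous_subspaceT.
have intf := intc _ (lipschitz1_continuous Lf).
have cstE (a : R) : \int[lebesgue_measure]_(s in `[x, y]) (cst a) s = a * (y - x).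
  transitivity (a * fine (@lebesgue_measure R `[x, y]%classic)).
    exact: Rintegral_cst.
  rewrite lebesgue_measure_itv/= lte_fin.
  move: xy; rewrite le_eqVlt => /predU1P[->|xy].
    by rewrite ltxx subrr.
  by rewrite xy.
have fb s : s \in `[x, y] -> `|f s - f c| <= L * (y - x).
  rewrite in_itv/= => /andP[xs sy]; apply: le_trans (Lf _ _) _.
  have := Lf y x; rewrite (ger0_norm (_ : 0 <= y - x)) ?subr_ge0// => H.
  have [yx|nxy] := eqVneq x y.
    have -> : s = x by apply/eqP; rewrite eq_le; lra.
    have -> : c = x by apply/eqP; rewrite eq_le; lra.
    by rewrite subrr normr0 yx subrr.
  have L0 : 0 <= L.
    have := le_trans (normr_ge0 _) H; rewrite pmulr_lge0// subr_gt0 lt_neqAle.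
    by rewrite nxy.
  by rewrite ler_wpM2l// ler_norml; lra.
have -> : \int[lebesgue_measure]_(s in `[x, y]) f s - (y - x) * f c =
   \int[lebesgue_measure]_(s in `[x, y]) (f s - f c).
  by rewrite RintegralB// ?cstE 1?mulrC//; apply: intc; exact: cst_continuous.
have cfx : continuous (fun s => f s - f c).
  by move=> s; apply: cvgB; [exact: (lipschitz1_continuous Lf)|exact: cvg_cst].
apply: le_trans (le_normr_Rintegral _ _) _ => //; first exact: intc.
rewrite (_ : L * _ = (L * (y - x)) * (y - x)); last by rewrite expr2 mulrA.
rewrite -cstE; apply: le_Rintegral => //.
- apply: intc => s; apply: cvg_norm; exact: cfx.
- apply: intc; exact: cst_continuous.
Qed.

Lemma primitive_exists L f : lipschitz1 L f -> exists F, primitive f F.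
Proof.
move=> Lf.
pose I x y : R := \int[lebesgue_measure]_(s in `[x, y]) f s.
have intf x y : lebesgue_measure.-integrable `[x, y] (EFin \o f).
  apply: continuous_compact_integrable; first exact: segment_compact.
  exact/continuous_subspaceT/(lipschitz1_continuous Lf).
have Iadd x y z : x <= y -> y <= z -> I x y + I y z = I x z.
  move=> xy yz; rewrite /I.
  have := @Rintegral_itvB R f (BLeft x) (BRight z) y (intf x z).
  rewrite !bnd_simp => /(_ xy yz).
  rewrite Rintegral_itv_obnd_cbnd; last first.
    by apply: integrableS (intf y z) => //; exact: subset_itv_oc_cc.
  by move=> /eqP; rewrite subr_eq addrC => /eqP ->.
pose F x := if 0 <= x then I 0 x else - I x 0.
have FI x y : x <= y -> F y - F x = I x y.
  move=> xy; rewrite /F; case: (lerP 0 x) => [x0|x0].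
    by rewrite (le_trans x0 xy) -(Iadd 0 x y)//; ring.
  case: (lerP 0 y) => [y0|y0].
    by rewrite -(Iadd x 0 y)// ?(ltW x0)//; ring.
  by rewrite -(Iadd x y 0)// ?(ltW y0)//; ring.
exists F => M Mf x t; case: (lerP 0 t) => [t0|/ltW t0].
  rewrite FI ?lerDl//.
  have := @lipschitz1_integral M f Mf x (x + t) x.
  by rewrite lexx lerDl t0 (addrC x) addrK => /(_ isT).
have := @lipschitz1_integral M f Mf (x + t) x x.
rewrite gerDl t0 lexx => /(_ isT); rewrite -/(I _ _) -FI ?gerDl//.
have -> : x - (x + t) = - t by ring.
by rewrite sqrrN -normrN; congr (`|_| <= _); ring.
Qed.

End Increments.

Section Average.
Variable R : realType.
Implicit Types (f g F : R -> R) (L rho c x t : R).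

Lemma lipschitz1D L1 L2 f g : lipschitz1 L1 f -> lipschitz1 L2 g ->
  lipschitz1 (L1 + L2) (fun s => f s + g s).
Proof.
move=> Lf Lg x y; rewrite opprD addrACA mulrDl.
by apply: le_trans (ler_normD _ _) _; rewrite lerD.
Qed.

Lemma lipschitz1Z L f c : lipschitz1 L f -> lipschitz1 (`|c| * L) (fun s => c * f s).
Proof. by move=> Lf x y; rewrite -mulrBr normrM -mulrA ler_wpM2l. Qed.

Lemma lipschitz1_cst c : lipschitz1 0 (fun=> c).
Proof. by move=> x y; rewrite subrr normr0 mul0r. Qed.

Definition prim f : R -> R := xget (fun=> 0) (primitive f).

Lemma primP L f : lipschitz1 L f -> primitive f (prim f).
Proof. by move=> /primitive_exists[F PF]; exact: (xgetI _ PF). Qed.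

Definition avg rho f := (prim f rho - prim f (- rho)) / (2 * rho).

(** Two functions with the same first-order expansion differ by a constant, by [increment_const].
    Averages can thus be computed from any convenient primitive, such as a sum or a translate. *)
Lemma avg_unique L f F C rho : lipschitz1 L f ->
  (forall x t, `|F (x + t) - F x - t * f x| <= C * t ^+ 2) ->
  avg rho f = (F rho - F (- rho)) / (2 * rho).
Proof.
move=> Lf HF; rewrite /avg; congr (_ / _).
have := @increment_const R (fun x => F x - prim f x) (C + L) _ rho (- rho).
move=> H; apply/eqP; rewrite subr_eq addrAC eq_sym -subr_eq0.
rewrite (_ : _ - _ = (F rho - prim f rho) - (F (- rho) - prim f (- rho))); last by ring.
rewrite subr_eq0; apply/eqP/H => x t.
have -> : F (x + t) - prim f (x + t) - (F x - prim f x) =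
  (F (x + t) - F x - t * f x) - (prim f (x + t) - prim f x - t * f x) by ring.
apply: le_trans (ler_normB _ _) _; rewrite mulrDl lerD//.
exact: (primP Lf).
Qed.

Lemma avg_lin L1 L2 f g c rho : lipschitz1 L1 f -> lipschitz1 L2 g ->
  avg rho (fun s => f s + c * g s) = avg rho f + c * avg rho g.
Proof.
move=> Lf Lg.
rewrite (@avg_unique (L1 + `|c| * L2) _ (fun x => prim f x + c * prim g x)
  (L1 + `|c| * L2)); first by rewrite /avg; ring.
  exact/lipschitz1D/lipschitz1Z.
move=> x t.
have -> : prim f (x + t) + c * prim g (x + t) - (prim f x + c * prim g x) -
    t * (f x + c * g x) = (prim f (x + t) - prim f x - t * f x) +
     c * (prim g (x + t) - prim g x - t * g x) by ring.
apply: le_trans (ler_normD _ _) _; rewrite mulrDl lerD//; first exact: (primP Lf).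
by rewrite normrM -mulrA ler_wpM2l//; exact: (primP Lg).
Qed.

Lemma avg_cst c rho : 0 < rho -> avg rho (fun=> c) = c.
Proof.
move=> rho0; rewrite (@avg_unique 0 _ (fun x => c * x) 0).
- by field; exact: lt0r_neq0.
- exact: lipschitz1_cst.
- by move=> x t; rewrite mul0r (_ : _ - _ = 0) ?normr0//; ring.
Qed.

(* The odd part [l * s] of the bound has average zero on the symmetric interval. *)
Lemma avg_le L f c l rho : 0 < rho -> lipschitz1 L f ->
  (forall s, `|s| <= rho -> f s <= c + l * s) -> avg rho f <= c.
Proof.
move=> rho0 Lf H; rewrite /avg ler_pdivrMr ?mulr_gt0//.
have := @increment_le R (fun x => prim f x - c * x - l / 2 * x ^+ 2) 0 (L + `|l|)
  (- rho) rho; rewrite mul0r => H'.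
have : prim f rho - c * rho - l / 2 * rho ^+ 2 -
  (prim f (- rho) - c * - rho - l / 2 * (- rho) ^+ 2) <= 0.
  apply: H' => [|x y x0 xy y0]; first by lra.
  rewrite mul0r add0r.
  have := primP Lf Lf x (y - x); rewrite subrKC ler_norml => /andP[_ Pf].
  have : (y - x) * f x <= (y - x) * (c + l * x).
    by rewrite ler_wpM2l ?subr_ge0//; apply: H; rewrite ler_norml; lra.
  have : - (l / 2) * (y - x) ^+ 2 <= `|l| * (y - x) ^+ 2.
    rewrite ler_wpM2r ?sqr_ge0//; apply: le_trans (ler_norm _) _.
    by rewrite normrN normrM ler_piMr// ger0_norm ?invr_ge0// invf_le1// ler1n.
  rewrite (mulrDl L).
  have -> : prim f y - c * y - l / 2 * y ^+ 2 - (prim f x - c * x - l / 2 * x ^+ 2)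
    = (prim f y - prim f x) - (y - x) * (c + l * x) - l / 2 * (y - x) ^+ 2 by field.
  move: Pf; move: (y - x) (prim f y - prim f x) (f x) => d a e.
  rewrite mulNr.
  move: (d * e) (d * (c + l * x)) (l / 2 * d ^+ 2) (L * _) (`|l| * _) => *.
  by lra.
rewrite sqrrN; lra.
Qed.

Lemma lipschitz1N L f : lipschitz1 L f -> lipschitz1 L (fun s => - f s).
Proof. by move=> Lf x y; rewrite -opprD normrN. Qed.

Lemma avgN L f rho : lipschitz1 L f -> avg rho (fun s => - f s) = - avg rho f.
Proof.
move=> Lf; rewrite (@avg_unique L _ (fun x => - prim f x) L).
- by rewrite /avg; ring.
- exact: lipschitz1N.
- move=> x t; have -> : - prim f (x + t) - - prim f x - t * - f x =
    - (prim f (x + t) - prim f x - t * f x) by ring.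
  by rewrite normrN; exact: (primP Lf).
Qed.

Lemma avg_norm_le L f c rho : 0 < rho -> lipschitz1 L f ->
  (forall s, `|s| <= rho -> `|f s| <= c) -> `|avg rho f| <= c.
Proof.
move=> rho0 Lf H; rewrite ler_norml lerNl -(avgN _ Lf); apply/andP; split.
  by apply: (@avg_le L _ _ 0) => // [|s /H]; [exact: lipschitz1N|rewrite ler_norml; lra].
by apply: (@avg_le L _ _ 0) => // s /H; rewrite ler_norml; lra.
Qed.

End Average.

(** * Mollification by box averages *)

Section L1.
Variables (R : realType) (n : nat).
Implicit Types v w : 'cV[R]_n.

Definition l1 v : R := \sum_i `|v i 0|.
Definition basis i : 'cV[R]_n := delta_mx i 0.

Lemma l1_ge0 v : 0 <= l1 v.
Proof. by apply: sumr_ge0 => i _. Qed.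

Lemma l1D v w : l1 (v + w) <= l1 v + l1 w.
Proof. by rewrite /l1 -big_split; apply: ler_sum => i _; rewrite mxE ler_normD. Qed.

Lemma l1Z c v : l1 (c *: v) = `|c| * l1 v.
Proof. by rewrite /l1 mulr_sumr; apply: eq_bigr => i _; rewrite mxE normrM. Qed.

Lemma l1N v : l1 (- v) = l1 v.
Proof. by rewrite -scaleN1r l1Z normrN1 mul1r. Qed.

Lemma l10 : l1 0 = 0.
Proof. by rewrite /l1 big1// => i _; rewrite mxE normr0. Qed.

Lemma coord_le_l1 v i : `|v i 0| <= l1 v.
Proof. by rewrite /l1 (bigD1 i)//= lerDl sumr_ge0. Qed.

Lemma l1_basis c i : l1 (c *: basis i) = `|c|.
Proof.
rewrite l1Z /l1 (bigD1 i)//= big1 => [|j ji]; rewrite !mxE ?eqxx ?normr1 ?addr0 ?mulr1//.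
by rewrite (negbTE ji) normr0.
Qed.

Lemma basis_sum v : v = \sum_i v i 0 *: basis i.
Proof.
apply/matrixP => j k; rewrite (ord1 k) summxE (bigD1 j)//= big1 => [|i ij].
  by rewrite !mxE !eqxx mulr1 addr0.
by rewrite !mxE eq_sym (negbTE ij) mulr0.
Qed.

Lemma l1_le v c : (forall i, `|v i 0| <= c) -> l1 v <= n%:R * c.
Proof.
move=> H; apply: (@le_trans _ _ (\sum_(i < n) c)); first exact: ler_sum.
by rewrite sumr_const card_ord mulr_natl.
Qed.

End L1.

Section Regularity.
Variables (R : realType) (n : nat).
Local Notation V := 'cV[R]_n.
Implicit Types (L rho : R) (G : V -> R).

Definition lip L G := forall z v : V, `|G (z + v) - G z| <= L * l1 v.

(* [reg m L G]: G is of class C^{m,1}, with all constants bounded by L. *)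
Fixpoint reg (m : nat) L G : Prop := lip L G /\
  if m is m'.+1 then exists D : 'I_n -> V -> R,
    [/\ forall i, reg m' L (D i), forall i z, `|D i z| <= L &
        forall z v, `|G (z + v) - G z - \sum_i v i 0 * D i z| <= L * l1 v ^+ 2]
  else True.

Lemma reg_lip m L G : reg m L G -> lip L G.
Proof. by case: m => [|m] []. Qed.

Lemma reg_le m L L' G : L <= L' -> reg m L G -> reg m L' G.
Proof.
elim: m G => [|m IH] G LL [lG].
  by move=> _; split=> // z v; apply: le_trans (lG z v) _; rewrite ler_wpM2r ?l1_ge0.
move=> [D [rD bD HD]]; split.
  by move=> z v; apply: le_trans (lG z v) _; rewrite ler_wpM2r ?l1_ge0.
exists D; split => [i|i z|z v]; first exact: IH _ LL (rD i).
  exact: le_trans (bD i z) LL.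
by apply: le_trans (HD z v) _; rewrite ler_wpM2r ?sqr_ge0.
Qed.

Lemma reg_add m L1 L2 G1 G2 : reg m L1 G1 -> reg m L2 G2 ->
  reg m (L1 + L2) (fun z => G1 z + G2 z).
Proof.
elim: m G1 G2 => [|m IH] G1 G2 [l1G H1] [l2G H2].
  split=> // z v; rewrite opprD addrACA mulrDl.
  by apply: le_trans (ler_normD _ _) _; rewrite lerD.
split.
  move=> z v; rewrite opprD addrACA mulrDl.
  by apply: le_trans (ler_normD _ _) _; rewrite lerD.
have [D1 [rD1 bD1 HD1]] := H1; have [D2 [rD2 bD2 HD2]] := H2.
exists (fun i z => D1 i z + D2 i z); split => [i|i z|z v]; first exact: IH (rD1 i) (rD2 i).
  by apply: le_trans (ler_normD _ _) _; rewrite lerD.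
rewrite (eq_bigr (fun i => v i 0 * D1 i z + v i 0 * D2 i z)); last first.
  by move=> i _; rewrite mulrDr.
rewrite big_split/= mulrDl.
apply: le_trans (lerD (HD1 z v) (HD2 z v)).
rewrite (_ : G1 (z + v) + _ - _ - _ = (G1 (z + v) - G1 z - \sum_i v i 0 * D1 i z) +
  (G2 (z + v) - G2 z - \sum_i v i 0 * D2 i z)); last by ring.
exact: ler_normD.
Qed.

Lemma reg_scale m L G c : reg m L G -> reg m (`|c| * L) (fun z => c * G z).
Proof.
elim: m G => [|m IH] G [lG H].
  by split=> // z v; rewrite -mulrBr normrM -mulrA ler_wpM2l.
split; first by move=> z v; rewrite -mulrBr normrM -mulrA ler_wpM2l.
have [D [rD bD HD]] := H.
exists (fun i z => c * D i z); split => [i|i z|z v]; first exact: IH (rD i).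
  by rewrite normrM ler_wpM2l.
rewrite (eq_bigr (fun i => c * (v i 0 * D i z))); last by move=> i _; rewrite mulrCA.
by rewrite -mulr_sumr -!mulrBr normrM -mulrA ler_wpM2l.
Qed.

Lemma reg_shift m L G a : reg m L G -> reg m L (fun z => G (z + a)).
Proof.
elim: m G => [|m IH] G [lG H].
  by split=> // z v; rewrite (addrAC z v).
split; first by move=> z v; rewrite (addrAC z v).
have [D [rD bD HD]] := H.
exists (fun i z => D i (z + a)); split => [i|i z|z v] //; first exact: IH (rD i).
by rewrite (addrAC z v).
Qed.

Lemma reg_cst0 m : reg m 0 (fun=> 0 : R).
Proof.
elim: m => [|m IH]; split => //; first by move=> z v; rewrite subrr normr0 mul0r.
  by move=> z v; rewrite subrr normr0 mul0r.
exists (fun _ _ => 0); split => // [i z|z v]; first by rewrite normr0.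
by rewrite big1 ?subrr ?normr0 ?mul0r// => i _; rewrite mulr0.
Qed.

Lemma reg_sum (I : Type) (s : seq I) m (L : I -> R) (G : I -> V -> R) :
  (forall i, reg m (L i) (G i)) ->
  reg m (\sum_(i <- s) L i) (fun z => \sum_(i <- s) G i z).
Proof.
move=> H; elim: s => [|i s IH].
  rewrite big_nil; have := reg_cst0 m; congr (reg m 0 _).
  by apply/funext => z; rewrite big_nil.
rewrite big_cons; have := reg_add (H i) IH; congr (reg m _ _).
by apply/funext => z; rewrite big_cons.
Qed.

Definition bavg rho i G : V -> R := fun z => avg rho (fun s => G (z + s *: basis R i)).

(** The exact derivative of [bavg rho i G] in direction i: averaging over a segment of half-length
    rho gains one derivative and costs a factor 1 / rho. The form [a + - 1 * b] fits [reg_add] and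
    [reg_scale]. *)
Definition dquot rho i G : V -> R :=
  fun z => (2 * rho)^-1 * (G (z + rho *: basis R i) + - 1 * G (z + - rho *: basis R i)).

Lemma lip_slice L G z v : lip L G -> lipschitz1 (L * l1 v) (fun s => G (z + s *: v)).
Proof.
move=> lG x y; have := lG (z + y *: v) ((x - y) *: v).
rewrite -addrA -scalerDl [y + _]addrC subrK l1Z => /le_trans; apply.
by rewrite [`|_| * _]mulrC mulrA.
Qed.

Lemma lip_slice1 L G z i : lip L G -> lipschitz1 L (fun s => G (z + s *: basis R i)).
Proof. by move=> /(@lip_slice _ _ z (basis R i)); rewrite -[basis _ _]scale1r l1_basis normr1 mulr1 scale1r. Qed.

Lemma lipschitz1_sum (I : Type) (s : seq I) L (f : I -> R -> R) :
  (forall i, lipschitz1 L (f i)) ->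
  lipschitz1 ((size s)%:R * L) (fun x => \sum_(i <- s) f i x).
Proof.
move=> H x y; elim: s => [|i s IH]; first by rewrite !big_nil subrr normr0 !mul0r.
rewrite !big_cons opprD addrACA.
rewrite (_ : _ * `|_| = L * `|x - y| + (size s)%:R * L * `|x - y|); last first.
  by rewrite /= -natr1; ring.
by apply: le_trans (ler_normD _ _) _; rewrite lerD//; exact: H.
Qed.

Lemma avg_sum (I : Type) (s : seq I) L (c : I -> R) (f : I -> R -> R) rho :
  0 < rho -> (forall i, lipschitz1 L (f i)) ->
  avg rho (fun x => \sum_(i <- s) c i * f i x) = \sum_(i <- s) c i * avg rho (f i).
Proof.
move=> rho0 H; elim: s => [|i s IH].
  rewrite big_nil -[RHS](avg_cst 0 rho0); congr avg.
  by apply/funext => x; rewrite big_nil.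
rewrite big_cons -IH addrC.
have Hs : exists L', lipschitz1 L' (fun x => \sum_(j <- s) c j * f j x).
  elim: s {IH} => [|j s [L' IH]].
    exists 0 => x y; by rewrite !big_nil subrr normr0 mul0r.
  exists (L' + `|c j| * L).
  rewrite (_ : (fun _ => _) = (fun x => \sum_(j <- s) c j * f j x + c j * f j x)).
    exact/lipschitz1D/lipschitz1Z.
  by apply/funext => x; rewrite big_cons addrC.
have [L' HL'] := Hs.
rewrite -(avg_lin _ _ HL' (H i)); congr avg.
by apply/funext => x; rewrite big_cons addrC.
Qed.

Lemma bavg_lip rho i L G : 0 < rho -> lip L G -> lip L (bavg rho i G).
Proof.
move=> rho0 lG z v.
have lz w := @lip_slice1 L G w i lG.
rewrite /bavg (_ : _ - _ = avg rho (fun s => G (z + v + s *: basis R i) +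
   - 1 * G (z + s *: basis R i))); last by rewrite (avg_lin _ _ (lz _) (lz _)) mulN1r.
apply: (avg_norm_le rho0 (lipschitz1D (lz _) (lipschitz1Z _ (lz _)))) => s _.
by rewrite mulN1r (addrAC z v); apply: lG.
Qed.

Lemma bavg_reg rho i m L G : 0 < rho -> reg m L G -> reg m L (bavg rho i G).
Proof.
move=> rho0; elim: m G => [|m IH] G [lG H].
  by split => //; exact: bavg_lip.
split; first exact: bavg_lip.
have [D [rD bD HD]] := H.
exists (fun j => bavg rho i (D j)); split => [j|j z|z v]; first exact: IH (rD j).
  by apply: (avg_norm_le rho0 (lip_slice1 _ _ (reg_lip (rD j)))) => s _.
have lz w := @lip_slice1 L G w i lG.
have lD j w := @lip_slice1 L (D j) w i (reg_lip (rD j)).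
have l2 := lipschitz1D (lz (z + v)) (lipschitz1Z (- 1) (lz z)).
have ls j : lipschitz1 (l1 v * L) (fun s => v j 0 * D j (z + s *: basis R i)).
  move=> x y; apply: le_trans (lipschitz1Z _ (lD j z) _ _) _.
  by rewrite ler_wpM2r// ler_wpM2r ?coord_le_l1//; exact: le_trans (bD j z).
have l3 := lipschitz1_sum (index_enum 'I_n) ls.
rewrite /bavg.
have -> : avg rho (fun s => G (z + v + s *: basis R i)) -
    avg rho (fun s => G (z + s *: basis R i)) -
    \sum_j v j 0 * avg rho (fun s => D j (z + s *: basis R i)) =
  avg rho (fun s => (G (z + v + s *: basis R i) + - 1 * G (z + s *: basis R i)) +
     -1 * \sum_j v j 0 * D j (z + s *: basis R i)).
  rewrite (avg_lin _ _ l2 l3) (avg_lin _ _ (lz _) (lz _)) !mulN1r.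
  by rewrite (@avg_sum _ _ L).
apply: (avg_norm_le rho0 (lipschitz1D l2 (lipschitz1Z _ l3))) => s _.
by rewrite !mulN1r (addrAC z v); apply: HD.
Qed.

Lemma dquot_reg rho i m L G : 0 < rho -> reg m L G -> reg m (L / rho) (dquot rho i G).
Proof.
move=> rho0 rG.
have := reg_scale (2 * rho)^-1 (reg_add (reg_shift (rho *: basis R i) rG)
  (reg_scale (- 1) (reg_shift (- rho *: basis R i) rG))).
rewrite normrN1 mul1r normfV ger0_norm ?mulr_ge0 ?(ltW rho0)//.
by congr (reg m _ _); field; exact: lt0r_neq0.
Qed.

Lemma dquot_le rho i L G z : 0 < rho -> lip L G -> `|dquot rho i G z| <= L.
Proof.
move=> rho0 lG; rewrite /dquot normrM normfV (@ger0_norm _ (2 * rho)) ?mulr_ge0 ?(ltW rho0)//.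
rewrite [_^-1 * _]mulrC ler_pdivrMr ?mulr_gt0// mulN1r.
have := lG (z + - rho *: basis R i) ((2 * rho) *: basis R i).
rewrite -addrA -scalerDl (_ : - rho + 2 * rho = rho); last by ring.
by rewrite l1_basis (@ger0_norm _ (2 * rho))// pmulr_rge0// ltW.
Qed.

Lemma bavg_diff rho i L G z t : 0 < rho -> lip L G ->
  `|bavg rho i G (z + t *: basis R i) - bavg rho i G z - t * dquot rho i G z|
    <= L / rho * t ^+ 2.
Proof.
move=> rho0 lG; have lz w := @lip_slice1 L G w i lG.
set f := fun s => G (z + s *: basis R i); have Pf := primP (lz z) (lz z).
(* The slice through z + t e_i is the one through z translated by t, so both averages use [prim f],
   and their difference involves only its increments at rho and - rho. *)
rewrite {1}/bavg (@avg_unique _ L _ (fun s => prim f (t + s)) L rho (lz _)); last first.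
  move=> x s; rewrite addrA (_ : G _ = f (t + x)); first exact: Pf.
  by rewrite /f scalerDl addrA.
rewrite /bavg -/f /avg /dquot -/(f rho) -/(f (- rho)).
have -> : (prim f (t + rho) - prim f (t - rho)) / (2 * rho) -
   (prim f rho - prim f (- rho)) / (2 * rho) -
   t * ((2 * rho)^-1 * (f rho + -1 * f (- rho))) =
   (2 * rho)^-1 * ((prim f (rho + t) - prim f rho - t * f rho) -
     (prim f (- rho + t) - prim f (- rho) - t * f (- rho))).
  by rewrite [t + _]addrC [t - _]addrC; ring.
rewrite normrM normfV (@ger0_norm _ (2 * rho)) ?mulr_ge0 ?(ltW rho0)//.
have -> : L / rho * t ^+ 2 = (2 * rho)^-1 * (L * t ^+ 2 + L * t ^+ 2).
  by field; exact: lt0r_neq0.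
rewrite ler_wpM2l ?invr_ge0 ?mulr_ge0 ?(ltW rho0)//.
by apply: le_trans (ler_normB _ _) _; rewrite lerD.
Qed.

Lemma bavg_close rho i L G z : 0 < rho -> lip L G -> `|bavg rho i G z - G z| <= L * rho.
Proof.
move=> rho0 lG; have lz := @lip_slice1 L G z i lG.
have lc := @lipschitz1_cst R (G z).
rewrite (_ : _ - _ = avg rho (fun s => G (z + s *: basis R i) + - 1 * (G z))); last first.
  by rewrite (avg_lin _ _ lz lc) avg_cst// mulN1r.
apply: (avg_norm_le rho0 (lipschitz1D lz (lipschitz1Z _ lc))) => s srho.
rewrite mulN1r; apply: le_trans (lG _ _) _; rewrite l1_basis ler_wpM2l//.
have := lG z (1 *: basis R i); rewrite l1_basis normr1 mulr1.
exact: le_trans.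
Qed.

Definition bsmooth rho (s : seq 'I_n) G := foldr (bavg rho) G s.

Lemma bsmooth_reg rho s m L G : 0 < rho -> reg m L G -> reg m L (bsmooth rho s G).
Proof. by move=> rho0; elim: s => //= i s IH rG; apply: bavg_reg => //; exact: IH. Qed.

Lemma bsmooth_close rho s L G z : 0 < rho -> lip L G ->
  `|bsmooth rho s G z - G z| <= (size s)%:R * (L * rho).
Proof.
move=> rho0 lG; elim: s => [|i s IH] /=; first by rewrite subrr normr0 mul0r.
have ls : lip L (bsmooth rho s G).
  by apply: (@reg_lip 0); apply: bsmooth_reg => //; split.
rewrite -[X in X * _]natr1 mulrDl mul1r -[X in `|X|](subrKA (bsmooth rho s G z)).
by apply: le_trans (ler_normD _ _) _; rewrite addrC lerD// bavg_close.
Qed.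

(* Smoothing in the direction i yields a derivative in that direction and
   keeps those obtained from the directions already treated. *)
Lemma bsmooth_dir rho s m L G : 0 < rho <= 1 -> reg m L G ->
  exists D : 'I_n -> V -> R, forall i, i \in s ->
    [/\ reg m (L / rho) (D i), forall z, `|D i z| <= L / rho &
      forall z t, `|bsmooth rho s G (z + t *: basis R i) - bsmooth rho s G z - t * D i z|
        <= L / rho * t ^+ 2].
Proof.
case/andP=> rho0 rho1 rG; elim: s => [|j s [D IH]]; first by exists (fun _ _ => 0).
have rs := bsmooth_reg s rho0 rG.
exists (fun i => if i == j then dquot rho j (bsmooth rho s G) else bavg rho j (D i)).
move=> i; rewrite inE; case: eqVneq => [-> _|ij /= /IH [rD bD HD]].
  have L0 : 0 <= L.
    by have := (reg_lip rG) 0 (1 *: basis R i); rewrite l1_basis normr1 mulr1; exact: le_trans.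
  split; first exact: dquot_reg.
    move=> z; apply: le_trans (dquot_le _ _ rho0 (reg_lip rs)) _.
    by rewrite ler_pdivlMr// ler_piMr.
  by move=> z t; apply: bavg_diff => //; exact: reg_lip rs.
split; first exact: bavg_reg.
  by move=> z; apply: (avg_norm_le rho0 (lip_slice1 _ _ (reg_lip rD))).
move=> z t /=; set H := bsmooth rho s G.
have lz w := @lip_slice1 L H w j (reg_lip rs).
have lD w := @lip_slice1 _ (D i) w j (reg_lip rD).
have l2 := lipschitz1D (lz (z + t *: basis R i)) (lipschitz1Z (- 1) (lz z)).
rewrite (_ : _ - _ - _ = avg rho (fun x => (H (z + t *: basis R i + x *: basis R j) +
   - 1 * H (z + x *: basis R j)) + - t * D i (z + x *: basis R j))); last first.
  by rewrite (avg_lin _ _ l2 (lD z)) (avg_lin _ _ (lz _) (lz _)) mulN1r mulNr.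
apply: (avg_norm_le rho0 (lipschitz1D l2 (lipschitz1Z _ (lD z)))) => x _.
by rewrite mulN1r mulNr (addrAC z); exact: HD.
Qed.

(** The coordinates are added one at a time. With a = |v_i| and b the l1 norm of the coordinates
    already present, the Lipschitz bound on the partial derivative costs a L b, and a^2 + a b + b^2
    <= (a + b)^2 closes the induction with the same L. *)
Lemma directional_joint (H : V -> R) (D : 'I_n -> V -> R) L :
  (forall i, lip L (D i)) ->
  (forall i z t, `|H (z + t *: basis R i) - H z - t * D i z| <= L * t ^+ 2) ->
  forall z v, `|H (z + v) - H z - \sum_i v i 0 * D i z| <= L * l1 v ^+ 2.
Proof.
move=> lD HD z v; rewrite {1}(basis_sum v) /l1.
elim: (index_enum 'I_n) => [|i s IH].
  by rewrite !big_nil addr0 subrr subr0 normr0 expr0n mulr0.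
rewrite !big_cons; set w := \sum_(j <- s) v j 0 *: basis R j.
have -> : H (z + (v i 0 *: basis R i + w)) - H z -
   (v i 0 * D i z + \sum_(j <- s) v j 0 * D j z) =
   (H (z + w + v i 0 *: basis R i) - H (z + w) - v i 0 * D i (z + w)) +
   v i 0 * (D i (z + w) - D i z) +
   (H (z + w) - H z - \sum_(j <- s) v j 0 * D j z).
  by rewrite [_ + w]addrC addrA; ring.
have lw : l1 w <= \sum_(j <- s) `|v j 0|.
  rewrite /w; elim: s {IH w} => [|j s IH]; first by rewrite !big_nil l10.
  by rewrite !big_cons; apply: le_trans (l1D _ _) _; rewrite l1_basis lerD2l.
have L0 : 0 <= L.
  by have := HD i 0 1; rewrite expr1n mulr1; exact: le_trans.
set a := `|v i 0|; set b := \sum_(j <- s) _ in lw IH *.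
apply: (@le_trans _ _ (L * a ^+ 2 + a * (L * b) + L * b ^+ 2)).
  apply: le_trans (ler_normD _ _) _; rewrite lerD//.
  apply: le_trans (ler_normD _ _) _; rewrite lerD//.
    by rewrite /a real_normK ?num_real.
  rewrite normrM ler_wpM2l//; apply: le_trans (lD _ _ _) _.
  by rewrite ler_wpM2l.
have a0 : 0 <= a by rewrite /a. have b0 : 0 <= b by apply: le_trans lw; exact: l1_ge0.
have := mulr_ge0 L0 (mulr_ge0 a0 b0).
rewrite (_ : L * (a + b) ^+ 2 = L * a ^+ 2 + a * (L * b) + L * b ^+ 2 + L * (a * b)).
  by rewrite lerDl.
by ring.
Qed.

Definition smooth rho G := bsmooth rho (enum 'I_n) G.

(** One average in every direction raises the order by one and divides the constant by rho; two
    rounds turn a Lipschitz envelope into a function with Lipschitz second derivatives. *)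
Lemma smooth_reg rho m L G : 0 < rho <= 1 -> 0 <= L -> reg m L G ->
  reg m.+1 (L / rho) (smooth rho G).
Proof.
move=> rho01 L0 rG; have /andP[rho0 rho1] := rho01.
have [D HD] := bsmooth_dir (enum 'I_n) rho01 rG.
have LL : L <= L / rho by rewrite ler_pdivlMr// ler_piMr.
have rs := reg_le LL (bsmooth_reg (enum 'I_n) rho0 rG).
split; first exact: reg_lip rs.
have {}HD i := HD i (mem_enum _ i).
exists D; split => [i|i z|]; [by case: (HD i)|by case: (HD i)|].
apply: directional_joint => i; last by case: (HD i).
by case: (HD i) => rD _ _; exact: reg_lip rD.
Qed.

End Regularity.

Section Taylor.
Variables (R : realType) (n : nat).
Local Notation V := 'cV[R]_n.
Implicit Types (L rho : R) (G : V -> R).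

Definition lin (a : 'I_n -> R) (v : V) : R := \sum_i v i 0 * a i.
Definition quad (H : 'I_n -> 'I_n -> R) (v : V) : R :=
  \sum_i v i 0 * \sum_j v j 0 * H i j.

Lemma linZ a c v : lin a (c *: v) = c * lin a v.
Proof. by rewrite /lin mulr_sumr; apply: eq_bigr => i _; rewrite mxE mulrA. Qed.

Lemma quadZ H c v : quad H (c *: v) = c ^+ 2 * quad H v.
Proof.
rewrite /quad mulr_sumr; apply: eq_bigr => i _; rewrite mxE.
rewrite (eq_bigr (fun j => c * (v j 0 * H i j))); last first.
  by move=> j _; rewrite mxE mulrA.
by rewrite -mulr_sumr; ring.
Qed.

(** On the segment from z to z + v, G minus its second-order polynomial has increments at most L
    l1(v)^3 (y - x) up to a quadratic error, and [increment_le] sums them. [H z] is not claimed to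
    be symmetric; [spatial_sym] symmetrizes it when a jet is formed. *)
Lemma reg2_taylor L G : reg 2 L G ->
  exists a : V -> 'I_n -> R, exists H : V -> 'I_n -> 'I_n -> R,
    [/\ forall z i, `|a z i| <= L, forall z i j, `|H z i j| <= L &
      forall z v, `|G (z + v) - G z - lin (a z) v - 2^-1 * quad (H z) v| <= L * l1 v ^+ 3].
Proof.
case=> lG [D [rD bD HD]].
have /choice[E HE] : forall i, exists Ei : 'I_n -> V -> R,
    (forall j z, `|Ei j z| <= L) /\
    forall z v, `|D i (z + v) - D i z - \sum_j v j 0 * Ei j z| <= L * l1 v ^+ 2.
  by move=> i; case: (rD i) => _ [Ei [_ bE HE]]; exists Ei.
exists (fun z i => D i z), (fun z i j => E i j z); split => // [z i j|z v].
  by have [] := HE i.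
set q := quad _ v; set l := lin _ v.
pose f s := G (z + s *: v) - s * l - 2^-1 * s ^+ 2 * q.
have L0 : 0 <= L ^+ 1 * l1 v ^+ 3.
  rewrite expr1; have := le_trans (normr_ge0 _) (lG 0 v) => Lv.
  by rewrite exprS mulrA mulr_ge0// sqr_ge0.
have incr x y : 0 <= x -> x <= y -> y <= 1 ->
    `|f y - f x| <= L * l1 v ^+ 3 * (y - x) + (L * l1 v ^+ 2 + `|q|) * (y - x) ^+ 2.
  move=> x0 xy y1.
  have -> : f y - f x = (G (z + x *: v + (y - x) *: v) - G (z + x *: v) -
      \sum_i ((y - x) *: v) i 0 * D i (z + x *: v)) +
      (y - x) * (\sum_i v i 0 * (D i (z + x *: v) - D i z - \sum_j (x *: v) j 0 * E i j z)) -
      2^-1 * (y - x) ^+ 2 * q.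
    rewrite -[z + x *: v + _]addrA -scalerDl subrKC.
    have -> : \sum_i ((y - x) *: v) i 0 * D i (z + x *: v) =
        (y - x) * \sum_i v i 0 * D i (z + x *: v).
      by rewrite mulr_sumr; apply: eq_bigr => i _; rewrite mxE mulrA.
    have -> : \sum_i v i 0 * (D i (z + x *: v) - D i z - \sum_j (x *: v) j 0 * E i j z) =
        \sum_i v i 0 * D i (z + x *: v) - l - x * q.
      rewrite /l /q /lin /quad mulr_sumr -!sumrB; apply: eq_bigr => i _.
      rewrite (eq_bigr (fun j => x * (v j 0 * E i j z))); last first.
        by move=> j _; rewrite mxE mulrA.
      by rewrite -mulr_sumr; ring.
    by rewrite /f; field.
  have dyx : `|y - x| = y - x by rewrite ger0_norm// subr_ge0.
  apply: le_trans (ler_normB _ _) _.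
  have -> : L * l1 v ^+ 3 * (y - x) + (L * l1 v ^+ 2 + `|q|) * (y - x) ^+ 2 =
     (L * ((y - x) * l1 v) ^+ 2 + (y - x) * (L * l1 v ^+ 3)) + (y - x) ^+ 2 * `|q| by ring.
  rewrite lerD//; last first.
    rewrite normrM ler_wpM2r// ger0_norm ?mulr_ge0 ?sqr_ge0 ?subr_ge0//.
    by rewrite ler_piMl ?sqr_ge0// invf_le1// ler1n.
  apply: le_trans (ler_normD _ _) _; rewrite lerD//.
    by have := HD (z + x *: v) ((y - x) *: v); rewrite l1Z dyx.
  rewrite normrM dyx ler_wpM2l ?subr_ge0//.
  apply: le_trans (ler_norm_sum _ _ _) _.
  rewrite (_ : L * l1 v ^+ 3 = \sum_i `|v i 0| * (L * l1 v ^+ 2)); last first.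
    by rewrite -mulr_suml -/(l1 v); ring.
  apply: ler_sum => i _; rewrite normrM ler_wpM2l//.
  have [_ HEi] := HE i; apply: le_trans (HEi z (x *: v)) _.
  have L00 := le_trans (normr_ge0 _) (bD i z).
  rewrite ler_wpM2l// l1Z exprMn ler_piMl ?sqr_ge0// expr_le1// ger0_norm//.
  exact: le_trans xy y1.
have fE : G (z + v) - G z - l - 2^-1 * q = f 1 - f 0.
  by rewrite /f scale1r scale0r addr0; ring.
rewrite fE ler_norml; apply/andP; split.
  suff : - f 1 - - f 0 <= L * l1 v ^+ 3 * (1 - 0).
    by rewrite subr0 mulr1; move: (f 1) (f 0) => *; lra.
  apply: (@increment_le R (fun s => - f s) _ (L * l1 v ^+ 2 + `|q|)) => // x y x0 xy y1.
  have := incr x y x0 xy y1; rewrite ler_norml => /andP[+ _].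
  by move: (_ + _) (f x) (f y) => *; lra.
suff : f 1 - f 0 <= L * l1 v ^+ 3 * (1 - 0) by rewrite subr0 mulr1.
apply: (@increment_le R f _ (L * l1 v ^+ 2 + `|q|)) => // x y x0 xy y1.
by have := incr x y x0 xy y1; rewrite ler_norml => /andP[].
Qed.

End Taylor.

(** * Resolvents of random walks *)

Section Resolvent.
Variables (R : realType) (n : nat) (I : finType) (w : I -> R) (r : R).
Hypotheses (w_ge0 : forall i, 0 <= w i) (w_sum : \sum_i w i = 1) (r01 : 0 <= r <= 1).
Local Notation V := 'cV[R]_n.
Implicit Types (P G : V -> R) (L : R) (a : I -> V).

Definition walk a G : V -> R := fun z => \sum_i w i * G (z + a i).

(* Iterates converging to the resolvent [(1 - r) (1 - r walk)^-1 P]. *)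
Fixpoint rit a P (N : nat) : V -> R :=
  if N is N'.+1 then fun z => (1 - r) * P z + r * walk a (rit a P N') z else P.

Lemma walk_reg m L a G : reg m L G -> reg m L (walk a G).
Proof.
move=> rG; have := @reg_sum R n I (index_enum I) m (fun i => `|w i| * L)
  (fun i z => w i * G (z + a i)) (fun i => reg_scale (w i) (reg_shift (a i) rG)).
rewrite -mulr_suml (eq_bigr w) ?w_sum ?mul1r// => i _; by rewrite ger0_norm.
Qed.

Lemma rit_reg m L a P N : reg m L P -> reg m L (rit a P N).
Proof.
have /andP[r0 r1] := r01 => rP; elim: N => //= N IH.
have := reg_add (reg_scale (1 - r) rP) (reg_scale r (walk_reg a IH)).
rewrite !ger0_norm ?subr_ge0//; congr (reg m _ _); ring.
Qed.

Lemma walk_le a G1 G2 z : (forall z, G1 z <= G2 z) -> walk a G1 z <= walk a G2 z.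
Proof. by move=> H; apply: ler_sum => i _; rewrite ler_wpM2l. Qed.

(** The iteration contracts by the factor r, and its first step is controlled by the Lipschitz
    constant of P and the mean length of a step. Late iterates therefore almost solve the resolvent
    equation. *)
Lemma rit_step L a P N z : lip L P ->
  `|rit a P N.+1 z - rit a P N z| <= r ^+ N.+1 * (L * \sum_i w i * l1 (a i)).
Proof.
have /andP[r0 r1] := r01 => lP; elim: N z => [|N IH] z.
  rewrite /= (_ : _ - _ = r * (walk a P z - P z)); last by ring.
  rewrite normrM expr1 ger0_norm// ler_wpM2l//.
  rewrite -[P z]mul1r -w_sum mulr_suml /walk -sumrB mulr_sumr.
  apply: le_trans (ler_norm_sum _ _ _) _; apply: ler_sum => i _.
  by rewrite -mulrBr normrM ger0_norm// mulrCA ler_wpM2l.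
have -> : rit a P N.+2 z - rit a P N.+1 z =
    r * \sum_i w i * (rit a P N.+1 (z + a i) - rit a P N (z + a i)).
  rewrite [rit a P N.+2]/= -/(rit a P N.+1) [X in _ - X]/= /walk.
  rewrite opprD addrACA subrr add0r -mulrBr -sumrB; congr (_ * _).
  by apply: eq_bigr => i _; rewrite mulrBr.
rewrite normrM (ger0_norm r0) exprS -[leRHS]mulrA ler_wpM2l//.
apply: le_trans (ler_norm_sum _ _ _) _.
rewrite -[leRHS]mul1r -w_sum mulr_suml; apply: ler_sum => i _.
by rewrite normrM ger0_norm// ler_wpM2l.
Qed.

(* Running two walks with the same random choices. *)
Lemma rit_joint (a1 a2 : I -> V) P1 P2 (Q : V -> V -> R) c C e N :
  (forall z z', P1 z + P2 z' <= Q z z' + c) ->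
  (forall z z', \sum_i w i * Q (z + a1 i) (z' + a2 i) <= Q z z' + e) ->
  r * e = (1 - r) * C ->
  forall z z', rit a1 P1 N z + rit a2 P2 N z' <= Q z z' + c + C + r ^+ N * `|C|.
Proof.
have /andP[r0 r1] := r01 => HP HQ eC; elim: N => [|N IH] z z' /=.
  rewrite expr0 mul1r; apply: le_trans (HP z z') _.
  by have := ler_norm (- C); rewrite normrN; lra.
rewrite addrACA -!mulrDr /walk -big_split/=.
have H1 : (1 - r) * (P1 z + P2 z') <= (1 - r) * (Q z z' + c).
  by rewrite ler_wpM2l// subr_ge0.
set W := \sum_(i in I) _.
have H2 : W <= Q z z' + e + (c + C + r ^+ N * `|C|).
  apply: (@le_trans _ _ (\sum_i (w i * Q (z + a1 i) (z' + a2 i) +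
      w i * (c + C + r ^+ N * `|C|)))); last first.
    by rewrite big_split/= -mulr_suml w_sum mul1r lerD2r.
  apply: ler_sum => i _; rewrite -!mulrDr ler_wpM2l//.
  by have := IH (z + a1 i) (z' + a2 i); rewrite !addrA.
(* By [eC], C = r (C + e): the gain e of a step and the discount balance at C, and only the initial
   error |C| shrinks geometrically. *)
have := ler_wpM2l r0 H2; rewrite exprS -mulrA.
move: eC H1; move: (r ^+ N * `|C|) (Q z z') (P1 z + P2 z') W {H2} => x q p W.
by lra.
Qed.

(** By the second hypothesis Psi is a supersolution of the resolvent equation with datum - P, and
    such a barrier is preserved by the monotone iteration. *)
Lemma rit_ge a P (Psi : V -> R) N :
  (forall z, - Psi z <= P z) ->
  (forall z, (1 - r) * - P z + r * walk a Psi z <= Psi z) ->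
  forall z, - Psi z <= rit a P N z.
Proof.
have /andP[r0 r1] := r01 => H1 H2; elim: N => //= N IH z.
have : walk a (fun z => - Psi z) z <= walk a (rit a P N) z by exact: walk_le.
have -> : walk a (fun z => - Psi z) z = - walk a Psi z.
  by rewrite /walk -sumrN; apply: eq_bigr => i _; rewrite mulrN.
move=> /(ler_wpM2l r0); have := H2 z; move: (walk _ _ _) (walk _ _ _) => x y.
by lra.
Qed.

End Resolvent.

(** * Random walks in time and space, and their generator *)

Section RandomWalk.
Variables (R : realType) (n d : nat).
Local Notation V := 'cV[R]_n.+1.
Local Notation I := ('I_d.+1 * bool)%type.
Implicit Types (S : 'I_d -> V) (h : R).

(** Coordinate [ord0] is time. Index 0 moves time forward by h^2 whatever the sign; any other index
    moves by h S_j or - h S_j according to the sign. In this parabolic scaling all moves count at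
    the same order in the generator. *)
Definition wstep h S (i : I) : V :=
  if unlift ord0 i.1 is Some j then (if i.2 then h else - h) *: S j
  else h ^+ 2 *: basis R ord0.

Definition wweight : I -> R := fun=> (2 * d.+1%:R)^-1.

(** The mean number of steps per unit of time, so that [wrate h] times (walk - 1) approximates
    [gen S]. With r = [wdisc h], the operator (1 - r) (1 - r walk)^-1 is the resolvent at 1 of this
    approximation. *)
Definition wrate h : R := d.+1%:R / h ^+ 2.
Definition wdisc h : R := wrate h / (1 + wrate h).

Lemma wsumE (F : I -> R) : \sum_i wweight i * F i =
  (2 * d.+1%:R)^-1 * (F (ord0, true) + F (ord0, false) +
     \sum_j (F (lift ord0 j, true) + F (lift ord0 j, false))).
Proof.
rewrite -mulr_sumr; congr (_ * _).
rewrite (eq_bigr (fun p => F (p.1, p.2))); last by case.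
by rewrite -(pair_bigA _ (fun i b => F (i, b)))/= big_ord_recl big_bool;
  congr (_ + _); apply: eq_bigr => j _; rewrite big_bool.
Qed.

Lemma wsum_step h S (F : V -> R) : \sum_i wweight i * F (wstep h S i) =
  (2 * d.+1%:R)^-1 * (F (h ^+ 2 *: basis R ord0) *+ 2 +
     \sum_j (F (h *: S j) + F (- h *: S j))).
Proof.
rewrite wsumE /wstep/= unlift_none mulr2n; congr (_ * (_ + _)).
by apply: eq_bigr => j _; rewrite liftK.
Qed.

Lemma wweight_ge0 i : 0 <= wweight i.
Proof. by rewrite invr_ge0 mulr_ge0. Qed.

Lemma wweight_sum : \sum_i wweight i = 1.
Proof.
rewrite /wweight sumr_const card_prod card_ord card_bool -[LHS]mulr_natl natrM.
by rewrite [X in X / _]mulrC divff// mulf_neq0// pnatr_eq0.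
Qed.

Lemma wrate_gt0 h : 0 < h -> 0 < wrate h.
Proof. by move=> h0; rewrite divr_gt0// exprn_gt0. Qed.

Lemma wdisc01 h : 0 < h -> 0 <= wdisc h < 1.
Proof.
move=> /wrate_gt0 c0; rewrite divr_ge0 ?ltW//= ?addr_gt0//.
by rewrite ltr_pdivrMr ?addr_gt0// mul1r ltrDr.
Qed.

Lemma wdisc_le1 h : 0 < h -> 0 <= wdisc h <= 1.
Proof. by move=> /wdisc01/andP[-> /ltW]. Qed.

Lemma wwalkE h S G z : 0 < h -> wrate h * (walk wweight (wstep h S) G z - G z) =
  (G (z + h ^+ 2 *: basis R ord0) - G z) / h ^+ 2 +
  \sum_j (G (z + h *: S j) + G (z + - h *: S j) - G z *+ 2) / (2 * h ^+ 2).
Proof.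
move=> h0; rewrite /walk (wsum_step h S (fun v => G (z + v))).
rewrite -mulr_suml sumrB sumr_const card_ord /wrate.
set A := \sum_j _; rewrite -mulr_natl -[_ *+ d]mulr_natl.
have d0 : 1 + d%:R != 0 :> R by rewrite nat1r pnatr_eq0.
by rewrite -nat1r; field; rewrite d0 gt_eqF.
Qed.

Definition gen S (a : 'I_n.+1 -> R) (H : 'I_n.+1 -> 'I_n.+1 -> R) : R :=
  a ord0 + 2^-1 * \sum_j quad H (S j).

(** Linear terms cancel between h S_j and - h S_j, so the cubic remainder, divided by h^2, leaves
    O(h). The time step has in addition a second-order term of size h^2. *)
Lemma wwalk_gen h S G z a H L : 0 < h <= 1 -> 0 <= L -> (forall i j, `|H i j| <= L) ->
  (forall v, `|G (z + v) - G z - lin a v - 2^-1 * quad H v| <= L * l1 v ^+ 3) ->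
  `|wrate h * (walk wweight (wstep h S) G z - G z) - gen S a H|
     <= L * (2 + \sum_j l1 (S j) ^+ 3) * h.
Proof.
case/andP=> h0 h1 L0 HL HG; rewrite wwalkE//.
have h20 : h ^+ 2 != 0 by rewrite gt_eqF// exprn_gt0.
set A := (_ - _) / _.
have linb : lin a (basis R ord0) = a ord0.
  rewrite /lin (bigD1 ord0)//= big1 ?mxE ?eqxx ?mul1r ?addr0// => i i0.
  by rewrite mxE (negbTE i0) mul0r.
have qb : quad H (basis R ord0) = H ord0 ord0.
  have E F : \sum_i (basis R (@ord0 n)) i 0 * F i = F ord0 :> R.
    rewrite (bigD1 ord0)//= big1 ?mxE ?eqxx ?mul1r ?addr0// => i i0.
    by rewrite mxE (negbTE i0) mul0r.
  by rewrite /quad E E.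
have HA : `|A - a ord0| <= L * 2 * h.
  have := HG (h ^+ 2 *: basis R ord0); rewrite linZ quadZ l1_basis linb qb.
  rewrite (ger0_norm (exprn_ge0 _ (ltW h0))) => H1.
  have -> : A - a ord0 = (G (z + h ^+ 2 *: basis R ord0) - G z - h ^+ 2 * a ord0 -
     2^-1 * ((h ^+ 2) ^+ 2 * H ord0 ord0)) / h ^+ 2 + 2^-1 * h ^+ 2 * H ord0 ord0.
    by rewrite /A; field; exact: lt0r_neq0.
  apply: le_trans (ler_normD _ _) _.
  have h2h : h ^+ 2 <= h by rewrite expr2 ler_piMl// ltW.
  rewrite (_ : L * 2 * h = L * h + h * L); last by ring.
  rewrite lerD//.
    rewrite normrM normfV (ger0_norm (exprn_ge0 _ (ltW h0))) ler_pdivrMr ?exprn_gt0//.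
    apply: le_trans H1 _; rewrite -mulrA ler_wpM2l//.
    rewrite (_ : (h ^+ 2) ^+ 3 = h ^+ 2 * h ^+ 2 * h ^+ 2); last by ring.
    rewrite ler_wpM2r ?exprn_ge0 ?(ltW h0)//; apply: le_trans h2h.
    by rewrite ler_piMl ?exprn_ge0 ?(ltW h0)// (le_trans _ h1)// expr2 ler_piMl// ltW.
  have k0 : 0 <= 2^-1 * h ^+ 2 by rewrite mulr_ge0 ?invr_ge0 ?exprn_ge0 ?(ltW h0).
  rewrite normrM (ger0_norm k0) ler_pM//.
  apply: le_trans h2h; rewrite ler_piMl ?exprn_ge0 ?(ltW h0)// invf_le1// ler1n//.
have HB j : `|(G (z + h *: S j) + G (z + - h *: S j) - G z *+ 2) / (2 * h ^+ 2) -
    2^-1 * quad H (S j)| <= L * l1 (S j) ^+ 3 * h.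
  have H1 := HG (h *: S j); have H2 := HG (- h *: S j).
  rewrite !linZ !quadZ !l1Z sqrrN normrN (ger0_norm (ltW h0)) in H1 H2.
  have -> : (G (z + h *: S j) + G (z + - h *: S j) - G z *+ 2) / (2 * h ^+ 2) -
    2^-1 * quad H (S j) =
    ((G (z + h *: S j) - G z - h * lin a (S j) - 2^-1 * (h ^+ 2 * quad H (S j))) +
     (G (z + - h *: S j) - G z - - h * lin a (S j) - 2^-1 * (h ^+ 2 * quad H (S j))))
      / (2 * h ^+ 2).
    by field; exact: lt0r_neq0.
  rewrite normrM normfV ler_pdivrMr; last by rewrite normr_gt0 mulf_neq0.
  apply: le_trans (ler_normD _ _) _; apply: le_trans (lerD H1 H2) _.
  have k0 : 0 <= 2 * h ^+ 2 by rewrite pmulr_rge0// exprn_ge0// ltW.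
  rewrite (ger0_norm k0).
  by rewrite le_eqVlt; apply/orP; left; apply/eqP; ring.
rewrite (_ : _ - gen S a H = (A - a ord0) + \sum_j ((G (z + h *: S j) +
    G (z + - h *: S j) - G z *+ 2) / (2 * h ^+ 2) - 2^-1 * quad H (S j))); last first.
  by rewrite /gen sumrB -mulr_sumr; ring.
apply: le_trans (ler_normD _ _) _.
rewrite (mulrDr L) mulrDl lerD// mulr_sumr mulr_suml.
by apply: le_trans (ler_norm_sum _ _ _) _; apply: ler_sum => j _.
Qed.

Lemma resolvent_eq h S P G z : 0 < h ->
  G z - P z - wrate h * (walk wweight (wstep h S) G z - G z) =
  (1 + wrate h) * (G z - (1 - wdisc h) * P z - wdisc h * walk wweight (wstep h S) G z).
Proof.
move=> h0; have c0 := wrate_gt0 h0; rewrite /wdisc; move: (wrate h) c0 => c c0.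
by field; rewrite gt_eqF// addr_gt0.
Qed.

Definition sqn (v : V) : R := \sum_i v i 0 ^+ 2.

Lemma sqnD v w : sqn (v + w) = sqn v + 2 * \sum_i v i 0 * w i 0 + sqn w.
Proof.
rewrite /sqn mulr_sumr -!big_split/=; apply: eq_bigr => i _.
by rewrite mxE; ring.
Qed.

Lemma sqnZ c v : sqn (c *: v) = c ^+ 2 * sqn v.
Proof. by rewrite /sqn mulr_sumr; apply: eq_bigr => i _; rewrite mxE exprMn. Qed.

Lemma sqn_ge0 v : 0 <= sqn v.
Proof. by apply: sumr_ge0 => i _; exact: sqr_ge0. Qed.

Lemma sqn_basis i : sqn (basis R i) = 1.
Proof.
rewrite /sqn (bigD1 i)//= big1 ?mxE ?eqxx ?expr1n ?addr0// => j ji.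
by rewrite mxE (negbTE ji) expr0n.
Qed.

(** The barrier is L (c + |z|^2), with c the constant in the statement. The discrete generator takes
    |z|^2 to 2 z_0 + h^2 + sum_j |S_j|^2; once z_0 and the l1 norm are absorbed into |z|^2, the
    constants left are dominated by n + 5. The bound depends neither on h nor on N. *)
Lemma rit_lower h S P L N z : 0 < h <= 1 -> 0 <= L ->
  (forall z, - (L * (1 + l1 z)) <= P z) ->
  - (L * (n%:R + 5 + \sum_j sqn (S j) + sqn z)) <= rit wweight (wdisc h) (wstep h S) P N z.
Proof.
case/andP=> h0 h1 L0 HP; set c := n%:R + 5 + _.
have c0 := wrate_gt0 h0.
pose Psi z := L * (c + sqn z).
have nE : n.+1%:R = \sum_(i < n.+1) (1 : R) by rewrite sumr_const card_ord.
apply: (@rit_ge _ _ _ _ _ wweight_ge0 (wdisc_le1 h0) _ _ Psi) => {z} [z|z].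
  apply: le_trans (HP z); rewrite lerN2 ler_wpM2l//.
  have : l1 z <= n.+1%:R + sqn z.
    rewrite /l1 /sqn nE -big_split/=.
    apply: ler_sum => i _; rewrite -[X in 1 + X]real_normK ?num_real//.
    by move: (`|z i 0|) => x; nra.
  have S0 : 0 <= \sum_j sqn (S j) by apply: sumr_ge0 => j _; exact: sqn_ge0.
  by rewrite /c -natr1; lra.
rewrite -subr_ge0.
rewrite (_ : _ - _ = (Psi z - (1 - wdisc h) * - P z - wdisc h * walk wweight (wstep h S) Psi z)); last by ring.
rewrite -(pmulr_rge0 _ (addr_gt0 ltr01 c0)) -(resolvent_eq S (fun z => - P z) Psi z h0).
rewrite wwalkE//.
have E1 : (Psi (z + h ^+ 2 *: basis R ord0) - Psi z) / h ^+ 2 = L * (2 * z ord0 0 + h ^+ 2).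
  rewrite /Psi sqnD sqnZ sqn_basis (bigD1 ord0)//= big1 => [|i i0]; last first.
    by rewrite !mxE (negbTE i0) !mulr0.
  by rewrite !mxE !eqxx/=; field; exact: lt0r_neq0.
have E2 j : (Psi (z + h *: S j) + Psi (z + - h *: S j) - Psi z *+ 2) / (2 * h ^+ 2) =
   L * sqn (S j).
  rewrite /Psi !sqnD !sqnZ.
  have -> : \sum_i z i 0 * (- h *: S j) i 0 = - \sum_i z i 0 * (h *: S j) i 0.
    by rewrite -sumrN; apply: eq_bigr => i _; rewrite !mxE mulNr mulrN.
  by field; exact: lt0r_neq0.
rewrite E1 (eq_bigr _ (fun j _ => E2 j)) -mulr_sumr.
have HPz : P z >= - (L * (1 + (n%:R + 1) / 2 + sqn z / 2)).
  apply: le_trans (HP z); rewrite lerN2 ler_wpM2l// -addrA lerD2l.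
  rewrite natr1 /l1 /sqn nE -mulrDl -big_split/= mulr_suml.
  apply: ler_sum => i _; rewrite -[X in 1 + X]real_normK ?num_real//.
  move: (`|z i 0|) => x; have := sqr_ge0 (x - 1); rewrite sqrrB1; lra.
have Hz : 2 * z ord0 0 <= sqn z / 2 + 2.
  have : z ord0 0 ^+ 2 <= sqn z.
    by rewrite /sqn (bigD1 ord0)//= lerDl sumr_ge0// => i _; exact: sqr_ge0.
  move: (z ord0 0) => x; have := sqr_ge0 (x - 2); rewrite sqrrB; lra.
have Hh : h ^+ 2 <= 1 by rewrite expr_le1// ltW.
have := ler_wpM2l L0 Hz; have := ler_wpM2l L0 Hh.
have nL : 0 <= n%:R * L by rewrite mulr_ge0.
move: HPz; rewrite /Psi /c.
move: (P z) (sqn z) (\sum_j sqn (S j)) (z ord0 0) (h ^+ 2) => p q s x k.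
by rewrite !mulrDr; nra.
Qed.

End RandomWalk.

(** * Comparison with frozen coefficients *)

Section Comparison.
Variables (R : realType) (n d : nat).
Local Notation V := 'cV[R]_n.+1.
Implicit Types (S : 'I_d -> V) (D : V -> Prop).

(** Contact from above relative to D with a cubic error, which is what the expansions of the
    resolvent and of the barrier provide. *)
Definition touched D (U : V -> R) z a H := exists C delta, 0 < delta /\
  forall v, D (z + v) -> l1 v < delta ->
    U (z + v) <= U z + lin a v + 2^-1 * quad H v + C * l1 v ^+ 3.

(** The form in which upper semicontinuity on a compact box enters the comparison: the test
    functions are Lipschitz there. *)
Definition attains D (U : V -> R) := forall (G : V -> R) M,
  (forall z z', D z -> D z' -> `|G z' - G z| <= M * l1 (z' - z)) ->
  exists z0, D z0 /\ forall z, D z -> U z - G z <= U z0 - G z0.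

(* U satisfies [- tr (S S^T H) / 2 - a_0 <= kappa] at the points where it is
   touched from above by functions with derivatives at most C. *)
Definition frozen_sub D (U : V -> R) S K C kappa := forall z a H, D z ->
  (forall i, `|z i 0| < K) -> (forall i, `|a i| <= C) -> (forall i j, `|H i j| <= C) ->
  `|U z| <= C -> touched D U z a H -> - gen S a H <= kappa.

Definition rowsq S (i : 'I_n.+1) : R := \sum_j S j i 0 ^+ 2.

(** The numbers come from 4 x^3 <= x^4 / 2 + 216 and 6 x^2 s <= x^4 / 2 + 18 s^2, used in
    [gen_quart]. *)
Definition barrier_cst S : R := 216 + 18 * \sum_i rowsq S i ^+ 2.

Definition quart (z : V) : R := \sum_i z i 0 ^+ 4.

Lemma quartB (K : R) (z z' : V) : (forall i, `|z i 0| <= K) -> (forall i, `|z' i 0| <= K) ->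
  `|quart z' - quart z| <= 4 * K ^+ 3 * l1 (z' - z).
Proof.
move=> zK zK'; rewrite /quart -sumrB; apply: le_trans (ler_norm_sum _ _ _) _.
rewrite /l1 mulr_sumr; apply: ler_sum => i _; rewrite !mxE.
have := zK i; have := zK' i; move: (z i 0) (z' i 0) => x y yK xK.
have K0 : 0 <= K by exact: le_trans yK.
have -> : y ^+ 4 - x ^+ 4 = (y ^+ 3 + y ^+ 2 * x + y * x ^+ 2 + x ^+ 3) * (y - x) by ring.
rewrite normrM ler_wpM2r//.
have nX (t : R) m : `|t| <= K -> `|t ^+ m| <= K ^+ m.
  by move=> tK; rewrite normrX lerXn2r.
apply: le_trans (ler_normD _ _) _.
have -> : 4 * K ^+ 3 = (K ^+ 3 + K ^+ 2 * K + K * K ^+ 2) + K ^+ 3 by ring.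
rewrite lerD// ?nX//; apply: le_trans (ler_normD _ _) _; rewrite lerD//.
  by apply: le_trans (ler_normD _ _) _; rewrite lerD// ?nX// normrM ler_pM// nX.
by rewrite normrM ler_pM// nX.
Qed.

Lemma pow3_sum (v : V) : \sum_i `|v i 0| ^+ 3 <= l1 v ^+ 3.
Proof.
rewrite /l1; elim: (index_enum _) => [|i s IH]; first by rewrite !big_nil expr0n.
rewrite !big_cons; move: IH.
have : 0 <= \sum_(j <- s) `|v j 0| by apply: sumr_ge0.
move: (\sum_(j <- s) _) (\sum_(j <- s) _) (normr_ge0 (v i 0)) => a b.
move: (`|v i 0|) => c c0 b0 ab.
have -> : (c + b) ^+ 3 = c ^+ 3 + b ^+ 3 + 3 * (c * b * (c + b)) by ring.
have : 0 <= c * b * (c + b) by rewrite !mulr_ge0// addr_ge0.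
lra.
Qed.

Lemma quart_taylor (K : R) (z v : V) : (forall i, `|z i 0| <= K) -> l1 v <= 1 ->
  quart (z + v) <= quart z + lin (fun i => 4 * z i 0 ^+ 3) v +
    2^-1 * quad (fun i j => 12 * z i 0 ^+ 2 * (i == j)%:R) v + (4 * K + 1) * l1 v ^+ 3.
Proof.
move=> zK v1.
have K0 : 0 <= K by exact: le_trans (zK ord0).
have -> : quad (fun i j => 12 * z i 0 ^+ 2 * (i == j)%:R) v =
    \sum_i 12 * z i 0 ^+ 2 * v i 0 ^+ 2.
  apply: eq_bigr => i _; rewrite (bigD1 i)//= big1 => [|j ji].
    by rewrite eqxx/=; ring.
  by rewrite eq_sym (negbTE ji) !mulr0.
apply: le_trans (lerD (lexx _) (ler_wpM2l _ (pow3_sum v))); last by rewrite addr_ge0// mulr_ge0.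
rewrite /quart /lin !mulr_sumr -!big_split/=; apply: ler_sum => i _; rewrite mxE.
have := zK i; have := le_trans (coord_le_l1 v i) v1; move: (z i 0) (v i 0) => x y y1 xK.
have -> : (x + y) ^+ 4 = x ^+ 4 + y * (4 * x ^+ 3) + 2^-1 * (12 * x ^+ 2 * y ^+ 2) +
   (4 * x + y) * y ^+ 3 by field.
rewrite lerD2l -normrX; apply: le_trans (ler_norm _) _.
rewrite normrM ler_wpM2r//; apply: le_trans (ler_normD _ _) _.
by rewrite lerD// normrM ger0_norm// ler_wpM2l.
Qed.

Lemma genD S a a' H H' : gen S (fun i => a i + a' i) (fun i j => H i j + H' i j) =
  gen S a H + gen S a' H'.
Proof.
have qD v : quad (fun i j => H i j + H' i j) v = quad H v + quad H' v.
  rewrite /quad -big_split/=; apply: eq_bigr => i _; rewrite -mulrDr -big_split/=.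
  by congr (_ * _); apply: eq_bigr => j _; rewrite mulrDr.
rewrite /gen (eq_bigr (fun j => quad H (S j) + quad H' (S j))); last by move=> j _.
by rewrite big_split/=; ring.
Qed.

Lemma genZ S c a H : gen S (fun i => c * a i) (fun i j => c * H i j) = c * gen S a H.
Proof.
have qZ v : quad (fun i j => c * H i j) v = c * quad H v.
  rewrite /quad mulr_sumr; apply: eq_bigr => i _; rewrite [RHS]mulrCA; congr (_ * _).
  by rewrite mulr_sumr; apply: eq_bigr => j _; rewrite mulrCA.
by rewrite /gen (eq_bigr _ (fun j _ => qZ (S j))) -mulr_sumr; ring.
Qed.

(** The first-order and the second-order term are each absorbed by half of [quart]. Hence [quart] is
    a supersolution of the resolvent equation up to a constant, and a small multiple of it can be
    added to W at a small cost. *)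
Lemma gen_quart S (z : V) :
  gen S (fun i => 4 * z i 0 ^+ 3) (fun i j => 12 * z i 0 ^+ 2 * (i == j)%:R)
    <= quart z + barrier_cst S.
Proof.
have -> : gen S (fun i => 4 * z i 0 ^+ 3) (fun i j => 12 * z i 0 ^+ 2 * (i == j)%:R) =
   4 * z ord0 0 ^+ 3 + \sum_i 6 * z i 0 ^+ 2 * rowsq S i.
  rewrite /gen; congr (_ + _); rewrite mulr_sumr.
  rewrite (eq_bigr (fun j => \sum_i 6 * z i 0 ^+ 2 * S j i 0 ^+ 2)); last first.
    move=> j _; rewrite /quad mulr_sumr; apply: eq_bigr => i _.
    rewrite (bigD1 i)//= big1 => [|l li]; last by rewrite eq_sym (negbTE li) !mulr0.
    by rewrite eqxx/=; field.
  rewrite exchange_big/=; apply: eq_bigr => i _; rewrite /rowsq.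
  by rewrite mulr_sumr.
have q0 : z ord0 0 ^+ 4 <= quart z.
  by rewrite /quart (bigD1 ord0)//= lerDl sumr_ge0// => i _; rewrite exprn_even_ge0.
have : \sum_i 6 * z i 0 ^+ 2 * rowsq S i <= \sum_i (z i 0 ^+ 4 / 2 + 18 * rowsq S i ^+ 2).
  apply: ler_sum => i _; move: (z i 0) (rowsq S i) => x s.
  rewrite -subr_ge0 (_ : _ - _ = 2^-1 * (x ^+ 2 - 6 * s) ^+ 2); last by field.
  by rewrite mulr_ge0// ?invr_ge0// sqr_ge0.
rewrite big_split/= -mulr_suml -mulr_sumr -/(quart z) /barrier_cst.
have : 4 * z ord0 0 ^+ 3 <= z ord0 0 ^+ 4 / 2 + 216.
  move: (z ord0 0) => x; rewrite -subr_ge0.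
  rewrite (_ : _ - _ = 2^-1 * ((x - 6) ^+ 2 * ((x + 2) ^+ 2 + 8))); last by field.
  apply: mulr_ge0; first by rewrite invr_ge0.
  by apply: mulr_ge0; [exact: sqr_ge0|apply: addr_ge0; [exact: sqr_ge0|]].
move: q0; move: (z ord0 0 ^+ 4) (4 * z ord0 0 ^+ 3) (quart z) (\sum_i rowsq S i ^+ 2).
by move=> *; lra.
Qed.

(** Let z0 maximize U - W - kb quart over D; the barrier excludes |z0_i| = K. If the conclusion
    failed, the resolvent inequality would give - gen W > kappa + 3 eta + kb quart at z0. By
    [gen_quart], minus the generator of the touching function W + kb quart would then exceed kappa +
    2 eta, against [frozen_sub]. *)
Lemma core D (U P W : V -> R) S (K kappa eta kb L B0 CU C1 : R)
    (a : V -> 'I_n.+1 -> R) (H : V -> 'I_n.+1 -> 'I_n.+1 -> R) :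
  0 <= kb -> 0 < eta -> D 0 -> (forall z, D z -> forall i, `|z i 0| <= K) ->
  attains D U -> lip L W ->
  (forall z i, `|a z i| <= L) -> (forall z i j, `|H z i j| <= L) ->
  (forall z v, `|W (z + v) - W z - lin (a z) v - 2^-1 * quad (H z) v| <= L * l1 v ^+ 3) ->
  (forall z, P z <= W z - gen S (a z) (H z) + eta) ->
  (forall z, D z -> U z <= P z + eta) ->
  (forall z, D z -> - B0 <= W z) -> (forall z, D z -> U z <= CU) ->
  CU + B0 + `|kappa| < kb * K ^+ 4 -> kb * barrier_cst S <= eta ->
  L + 4 * kb * K ^+ 3 + 12 * kb * K ^+ 2 + `|CU| + `|B0| + `|kappa| <= C1 ->
  frozen_sub D U S K C1 (kappa + eta) ->
  U 0 <= W 0 + kappa + 5 * eta.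
Proof.
move=> kb0 eta0 D0 DK UM lW aL HL WT hres hP hW hU hB hCS hC1 HU.
rewrite leNgt; apply/negP => U0.
have K0 : 0 <= K by exact: le_trans (normr_ge0 _) (DK 0 D0 ord0).
pose G z := W z + kb * quart z.
have [z z' Dz Dz'|z0 [Dz0 z0M]] := UM G (L + 4 * kb * K ^+ 3).
  rewrite /G opprD addrACA -mulrBr.
  apply: le_trans (ler_normD _ _) _; rewrite mulrDl lerD//.
    by have := lW z (z' - z); rewrite subrKC.
  rewrite normrM ger0_norm//.
  rewrite (_ : 4 * kb * _ * _ = kb * (4 * K ^+ 3 * l1 (z' - z))); last by ring.
  rewrite ler_wpM2l//.
  exact: (quartB (DK z Dz) (DK z' Dz')).
have G0 : G 0 = W 0.
  by rewrite /G /quart big1 ?mulr0 ?addr0// => i _; rewrite mxE expr0n.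
have UG : kappa + 5 * eta < U z0 - G z0.
  by apply: lt_le_trans (z0M 0 D0); rewrite G0; lra.
have q0 : 0 <= kb * quart z0.
  by rewrite mulr_ge0// sumr_ge0// => i _; rewrite exprn_even_ge0.
have kn := ler_norm (- kappa); rewrite normrN in kn.
have z0K i : `|z0 i 0| < K.
  rewrite lt_neqAle DK// andbT; apply/eqP => zK.
  have : kb * K ^+ 4 <= kb * quart z0.
    rewrite ler_wpM2l// -zK -normrX ger0_norm ?exprn_even_ge0//.
    by rewrite /quart (bigD1 i)//= lerDl sumr_ge0// => j _; rewrite exprn_even_ge0.
  have := hW z0 Dz0; have := hU z0 Dz0; move: UG; rewrite /G => *; lra.
pose aa i := a z0 i + kb * (4 * z0 i 0 ^+ 3).
pose HH i j := H z0 i j + kb * (12 * z0 i 0 ^+ 2 * (i == j)%:R).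
have zX m i : `|z0 i 0 ^+ m| <= K ^+ m by rewrite normrX lerXn2r// ltW.
have KX m : 0 <= kb * K ^+ m by rewrite mulr_ge0// exprn_ge0.
have n1 := normr_ge0 CU; have n2 := normr_ge0 B0; have n3 := normr_ge0 kappa.
have L0 : 0 <= L by apply: le_trans (aL 0 ord0).
have taa i : `|aa i| <= C1.
  have H3 : kb * `|z0 i 0 ^+ 3| <= kb * K ^+ 3 by rewrite ler_wpM2l.
  apply: le_trans (ler_normD _ _) _; rewrite (normrM kb) (normrM 4) (ger0_norm kb0) (@ger0_norm _ 4)//.
  have := aL z0 i; have := KX 2%N; have := KX 3%N; move: hC1 H3.
  by move: (K ^+ 3) (K ^+ 2) (`|_ ^+ 3|) (`|a z0 i|) => *; lra.
have tHH i j : `|HH i j| <= C1.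
  have H3 : kb * `|z0 i 0 ^+ 2 * (i == j)%:R| <= kb * K ^+ 2.
    by rewrite ler_wpM2l//; case: eqP => _; rewrite ?mulr1// mulr0 normr0 exprn_ge0.
  apply: le_trans (ler_normD _ _) _; rewrite -[12 * _ * _]mulrA (normrM kb) (ger0_norm kb0).
  rewrite (normrM 12) (@ger0_norm _ 12)//.
  have := HL z0 i j; have := KX 2%N; have := KX 3%N; move: hC1 H3.
  by move: (K ^+ 3) (K ^+ 2) (`|_ * _|) (`|H z0 i j|) => *; lra.
have U1 : `|U z0| <= C1.
  have c0 : CU <= `|CU| by exact: ler_norm. have b0 : B0 <= `|B0| by exact: ler_norm.
  have := KX 2%N; have := KX 3%N; have := hW z0 Dz0; have := hU z0 Dz0.
  move: UG hC1; rewrite /G => *; rewrite ler_norml; apply/andP; split; lra.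
have tch : touched D U z0 aa HH.
  exists (L + kb * (4 * K + 1)), 1; split => // v Dv v1.
  have := z0M _ Dv; rewrite /G => H1.
  have H2 := quart_taylor (DK z0 Dz0) (ltW v1).
  have := ler_wpM2l kb0 H2 => {}H2.
  have H3 := le_trans (ler_norm _) (WT z0 v).
  have -> : lin aa v = lin (a z0) v + kb * lin (fun i => 4 * z0 i 0 ^+ 3) v.
    rewrite /lin mulr_sumr -big_split/=; apply: eq_bigr => i _; by rewrite /aa; ring.
  have -> : quad HH v = quad (H z0) v +
      kb * quad (fun i j => 12 * z0 i 0 ^+ 2 * (i == j)%:R) v.
    rewrite /quad mulr_sumr -big_split/=; apply: eq_bigr => i _.
    rewrite /HH [kb * _]mulrCA -mulrDr; congr (_ * _); rewrite mulr_sumr -big_split/=.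
    by apply: eq_bigr => j _; ring.
  move: H1 H2 H3; move: (lin _ _) (lin _ _) (quad _ _) (quad _ _) => x1 x2 x3 x4.
  move: (U _) (U _) (W _) (W _) (quart _) (quart _) (l1 _ ^+ 3) => *; lra.
have /(_ z0 aa HH Dz0 z0K taa tHH U1 tch) := HU.
have -> : gen S aa HH = gen S (a z0) (H z0) + kb * gen S (fun i => 4 * z0 i 0 ^+ 3)
    (fun i j => 12 * z0 i 0 ^+ 2 * (i == j)%:R).
  by rewrite /aa /HH genD genZ.
have := ler_wpM2l kb0 (gen_quart S z0); rewrite (mulrDr kb (quart _)).
have := hres z0; have := hP z0 Dz0; move: UG hCS; rewrite /G.
set g1 := gen S (a z0) _; set g2 := kb * gen S _ _; move: g1 g2 => g1 g2.
move: (U z0) (P z0) (W z0) (kb * quart _) (kb * barrier_cst _).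
by move=> *; lra.
Qed.

End Comparison.

(** * Lipschitz envelopes and joint inequalities *)

Section Envelope.
Variables (R : realType) (n : nat).
Local Notation V := 'cV[R]_n.
Implicit Types (D : V -> Prop) (U : V -> R) (L : R).

(** The least L-Lipschitz majorant of U on D. It lives on the whole space, since the walks leave D,
    and it inherits from the point 0 the lower bound U 0 - L l1(z), although U itself has none. *)
Definition env D U L (z : V) : R := sup [set U y - L * l1 (z - y) | y in [set y | D y]].

Section EnvelopeTheory.
Variables (D : V -> Prop) (U : V -> R) (L CU : R).
Hypotheses (D0 : D 0) (UC : forall z, D z -> U z <= CU) (L0 : 0 <= L).

Let has_sup_env z : has_sup [set U y - L * l1 (z - y) | y in [set y | D y]].
Proof.
split; first by exists (U 0 - L * l1 (z - 0)), 0.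
exists CU => _ [y Dy <-]; apply: le_trans (UC Dy).
by rewrite gerBl mulr_ge0// l1_ge0.
Qed.

Lemma env_ge z y : D y -> U y - L * l1 (z - y) <= env D U L z.
Proof. by move=> Dy; apply: sup_ubound; [case: (has_sup_env z)|exists y]. Qed.

Lemma env_le z c : (forall y, D y -> U y - L * l1 (z - y) <= c) -> env D U L z <= c.
Proof.
move=> H; apply: ge_sup; first by case: (has_sup_env z).
by move=> _ [y Dy <-]; exact: H.
Qed.

Lemma env_lip : lip L (env D U L).
Proof.
have H z v : env D U L (z + v) <= env D U L z + L * l1 v.
  apply: env_le => y Dy; have := env_ge z Dy.
  have := l1D (z + v - y) (- v); rewrite l1N addrAC addrK.
  move=> /(ler_wpM2l L0); rewrite mulrDr; lra.
move=> z v; rewrite ler_norml; have := H z v; have := H (z + v) (- v).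
by rewrite l1N addrK; lra.
Qed.

End EnvelopeTheory.

(** The slope L pays for moving the arguments of Q from the domains to arbitrary points, so the
    joint bound extends to the whole space. *)
Lemma env_joint D1 D2 U1 U2 L CU1 CU2 (Q : V -> V -> R) c :
  D1 0 -> D2 0 -> (forall z, D1 z -> U1 z <= CU1) -> (forall z, D2 z -> U2 z <= CU2) ->
  0 <= L ->
  (forall y y' z z', D1 y -> D2 y' ->
     U1 y + U2 y' <= Q z z' + L * (l1 (z - y) + l1 (z' - y')) + c) ->
  forall z z', env D1 U1 L z + env D2 U2 L z' <= Q z z' + c.
Proof.
move=> D10 D20 U1C U2C L0 H z z'; rewrite -lerBrDr.
apply: (env_le D10 U1C L0) => // y Dy; rewrite lerBrDr addrC -lerBrDr.
apply: (env_le D20 U2C L0) => // y' Dy'; have := H y y' z z' Dy Dy'.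
by rewrite mulrDr; lra.
Qed.

(** Both functions are averaged over the same displacement x e_i. Then Q grows at most by an odd
    term, of average zero, and by B x^2 <= B rho. *)
Lemma bsmooth_joint rho (s : seq 'I_n) L (G1 G2 : V -> R) (Q : V -> V -> R) c B :
  0 < rho <= 1 -> 0 <= B -> lip L G1 -> lip L G2 ->
  (forall z z' i, exists l, forall x, Q (z + x *: basis R i) (z' + x *: basis R i) <=
     Q z z' + l * x + B * x ^+ 2) ->
  (forall z z', G1 z + G2 z' <= Q z z' + c) ->
  forall z z', bsmooth rho s G1 z + bsmooth rho s G2 z' <=
     Q z z' + c + (size s)%:R * (B * rho).
Proof.
move=> /andP[rho0 rho1] B0 lG1 lG2 HQ HG; elim: s => [|i s IH] z z' /=.
  by rewrite mul0r addr0.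
have l1' : lip L (bsmooth rho s G1) by apply: (@reg_lip _ _ 0); apply: bsmooth_reg => //; split.
have l2' : lip L (bsmooth rho s G2) by apply: (@reg_lip _ _ 0); apply: bsmooth_reg => //; split.
have s1 := lip_slice1 z i l1'; have s2 := lip_slice1 z' i l2'.
rewrite /bavg -[X in _ + X]mul1r -(avg_lin _ _ s1 s2).
have [l Hl] := HQ z z' i.
apply: (@avg_le _ _ _ _ l rho rho0 (lipschitz1D s1 (lipschitz1Z 1 s2))) => x xr.
rewrite mul1r; apply: le_trans (IH _ _) _; have := Hl x.
have : B * x ^+ 2 <= B * rho.
  rewrite ler_wpM2l// -real_normK ?num_real// expr2.
  by apply: (@le_trans _ _ (rho * 1)); [rewrite ler_pM// (le_trans xr)|rewrite mulr1].
rewrite -natr1 mulrDl mul1r; move: (Q _ _) (Q z z') (B * x ^+ 2) (_%:R * _) => *; lra.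
Qed.

End Envelope.

Section OneSide.
Variables (R : realType) (n d : nat).
Local Notation V := 'cV[R]_n.+1.
Implicit Types (S : 'I_d -> V) (D : V -> Prop).

Definition mollified D U L rho : V -> R := smooth rho (smooth rho (env D U L)).

Definition approx D U L rho h S N : V -> R :=
  rit (@wweight R d) (wdisc d h) (wstep h S) (mollified D U L rho) N.

(** An instance of [core] with P the mollified envelope and W an iterate of its resolvent. One eta
    pays for the mollification; another is shared equally by the replacement of the generator by the
    walk and the stop at the N-th iterate. *)
Lemma one_side D U S (K kappa eta kb L rho h CU C1 : R) N :
  let N1 : R := n.+1%:R in let L2 := L / rho / rho in
  let B0 := L * (n%:R + 5 + \sum_j sqn (S j) + N1 * K ^+ 2) in
  0 <= kb -> 0 < eta -> D 0 -> (forall z, D z -> forall i, `|z i 0| <= K) ->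
  attains D U -> U 0 = 0 -> (forall z, D z -> U z <= CU) ->
  0 < rho <= 1 -> 1 <= L -> 2 * N1 * (L * rho) <= eta -> eta <= 1 -> 0 < h <= 1 ->
  L2 * (2 + \sum_j l1 (S j) ^+ 3) * h <= eta / 2 ->
  (1 + wrate d h) * (wdisc d h ^+ N.+1 * (L2 * \sum_i wweight R i * l1 (wstep h S i)))
    <= eta / 2 ->
  CU + B0 + `|kappa| < kb * K ^+ 4 -> kb * barrier_cst S <= eta ->
  L2 + 4 * kb * K ^+ 3 + 12 * kb * K ^+ 2 + `|CU| + `|B0| + `|kappa| <= C1 ->
  frozen_sub D U S K C1 (kappa + eta) ->
  U 0 <= approx D U L rho h S N 0 + kappa + 5 * eta.
Proof.
move=> N1 L2 B0 kb0 eta0 D0 DK UM U0 UC rho01 L1 Lrho eta1 h01 hL hN hB hCS hC1 HU.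
have [/andP[rho0 rho1] /andP[h0 h1]] := (rho01, h01).
have L0 : 0 <= L by exact: le_trans L1.
have Lr0 : 0 <= L / rho by rewrite divr_ge0// ltW.
have L20 : 0 <= L2 by rewrite divr_ge0// ltW.
set g := env D U L; have lg : lip L g by exact: env_lip D0 UC L0.
have lg1 : lip L (smooth rho g).
  by apply: (@reg_lip _ _ 0); apply: bsmooth_reg => //; split.
have r2 : reg 2 L2 (mollified D U L rho).
  by apply: smooth_reg => //; apply: smooth_reg => //; split.
have Pg z : `|mollified D U L rho z - g z| <= eta.
  rewrite -[X in `|X|](subrKA (smooth rho g z)); apply: le_trans (ler_normD _ _) _.
  have := bsmooth_close (enum 'I_n.+1) z rho0 lg.
  have := bsmooth_close (enum 'I_n.+1) z rho0 lg1.
  rewrite size_enum_ord -/N1 -/(smooth rho _) -/(mollified D U L rho) -/(smooth rho _).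
  by move: (`|_|) (`|_|) => *; lra.
pose W := approx D U L rho h S N.
have rW : reg 2 L2 W.
  apply: rit_reg => //; [exact: wweight_ge0|exact: wweight_sum|exact: wdisc_le1].
have [a [H [aL HL WT]]] := reg2_taylor rW.
apply: (@core _ _ _ D U (mollified D U L rho) W S K kappa eta kb L2 B0 CU C1 a H) => //.
- exact: reg_lip rW.
- move=> z.
  (* By [resolvent_eq] the residual of the N-th iterate is 1 + [wrate d h] times its distance to the
     next iterate. *)
  have E1 : `|W z - mollified D U L rho z - wrate d h *
      (walk (@wweight R d) (wstep h S) W z - W z)| <= eta / 2.
    have c0 : 0 <= 1 + wrate d h by rewrite addr_ge0// ltW// wrate_gt0.
    rewrite (resolvent_eq S) // normrM (ger0_norm c0).
    apply: le_trans hN; rewrite ler_wpM2l//.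
    have := rit_step (@wweight_ge0 R d) (@wweight_sum R d) (wdisc_le1 d h0) (wstep h S)
      N z (reg_lip r2).
    by rewrite distrC /=; apply: le_trans; rewrite le_eqVlt; apply/orP; left;
      apply/eqP; congr `|_|; rewrite /W /approx; ring.
  have E2 := wwalk_gen S h01 L20 (HL z) (WT z).
  move: E1; rewrite ler_norml => /andP[E1 _]; move: E2; rewrite ler_norml => /andP[E2 _].
  move: hL E1 E2; set X := wrate d h * _; move: X => X.
  move: (gen _ _ _) (mollified _ _ _ _ _) (W z) => *; lra.
- move=> z Dz; have := env_ge D0 UC L0 z Dz; rewrite subrr l10 mulr0 subr0 -/(g z).
  have := Pg z; rewrite ler_norml => /andP[+ _].
  by move: (mollified _ _ _ _ _) (g z) => *; lra.
(* The lower bound on the mollified envelope comes from the single point 0 of D, where U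
   vanishes. *)
- move=> z Dz; apply: le_trans (rit_lower S _ _ h01 L0 _); last first.
    move=> y; have := env_ge D0 UC L0 y D0; rewrite U0 subr0 -/(g y) add0r.
    have := Pg y; rewrite ler_norml => /andP[+ _]; rewrite mulrDr mulr1.
    by move: (mollified _ _ _ _ _) (g y) (L * l1 y) => *; lra.
  rewrite lerN2 /B0 ler_wpM2l// lerD2l /sqn /N1 mulr_natl -[X in _ *+ X]card_ord -sumr_const.
  by apply: ler_sum => i _; rewrite -real_normK ?num_real// lerXn2r ?nnegrE// ?DK// (le_trans _ (DK z Dz i)).
Qed.

End OneSide.

(** * Comparison of two blown-up functions through a quadratic coupling *)

Section ScaledEstimate.
Variables (R : realType) (n d : nat).
Local Notation V := 'cV[R]_n.+1.
Implicit Types (S : 'I_d -> V) (D : V -> Prop) (v z : V).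

Definition ssq v : R := \sum_(i < n) v (lift ord0 i) 0 ^+ 2.

(** The square of z - z' includes the time coordinate, which common time steps leave unchanged; b1
    and b2 weight the space coordinates only. *)
Definition coupling (p1 p2 al b1 b2 : R) z z' : R :=
  p1 * z ord0 0 + p2 * z' ord0 0 + al * sqn (z - z') + b1 * ssq z + b2 * ssq z'.

Definition coupled_trace (al b1 b2 : R) (S1 S2 : 'I_d -> V) : R :=
  \sum_j (al * sqn (S1 j - S2 j) + b1 * ssq (S1 j) + b2 * ssq (S2 j)).

Variables p1 p2 al b1 b2 : R.
Hypotheses (al0 : 0 <= al) (b10 : 0 <= b1) (b20 : 0 <= b2).
Local Notation Q := (coupling p1 p2 al b1 b2).

Lemma coupling_sym z z' v v' : Q (z + v) (z' + v') + Q (z + - v) (z' + - v') =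
  Q z z' *+ 2 + 2 * (al * sqn (v - v') + b1 * ssq v + b2 * ssq v').
Proof.
have E1 : sqn (z + v - (z' + v')) + sqn (z + - v - (z' + - v')) =
    2 * sqn (z - z') + 2 * sqn (v - v').
  rewrite /sqn !mulr_sumr -!big_split/=; apply: eq_bigr => i _; rewrite !mxE; ring.
have E2 x y : ssq (x + y) + ssq (x + - y) = 2 * ssq x + 2 * ssq y.
  rewrite /ssq !mulr_sumr -!big_split/=; apply: eq_bigr => i _; rewrite !mxE; ring.
rewrite /coupling !mxE.
transitivity (p1 * z ord0 0 *+ 2 + p2 * z' ord0 0 *+ 2 +
  al * (sqn (z + v - (z' + v')) + sqn (z + - v - (z' + - v'))) +
  b1 * (ssq (z + v) + ssq (z + - v)) + b2 * (ssq (z' + v') + ssq (z' + - v'))); first by ring.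
by rewrite E1 !E2; ring.
Qed.

Lemma shiftB (z z' w : V) : z + w - (z' + w) = z - z'.
Proof. by rewrite opprD addrACA subrr addr0. Qed.

Lemma coupling_time z z' x : Q (z + x *: basis R ord0) (z' + x *: basis R ord0) =
  Q z z' + x * (p1 + p2).
Proof.
have E y : ssq (y + x *: basis R ord0) = ssq y.
  by apply: eq_bigr => i _; rewrite !mxE eq_sym (negbTE (neq_lift _ _)) mulr0 addr0.
by rewrite /coupling shiftB !E !mxE !eqxx/=; ring.
Qed.

(** Second differences of a quadratic polynomial are exact, so the gain per step carries no error in
    h. The factor h^2 / (d + 1) is the mean duration of a step. *)
Lemma coupling_walk h (S1 S2 : 'I_d -> V) z z' :
  \sum_i wweight R i * Q (z + wstep h S1 i) (z' + wstep h S2 i) =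
  Q z z' + h ^+ 2 / d.+1%:R * (p1 + p2 + coupled_trace al b1 b2 S1 S2).
Proof.
rewrite (wsumE (fun i => Q (z + wstep h S1 i) (z' + wstep h S2 i))).
rewrite /wstep/= unlift_none coupling_time.
rewrite (eq_bigr (fun j => Q z z' *+ 2 + 2 * (h ^+ 2 *
    (al * sqn (S1 j - S2 j) + b1 * ssq (S1 j) + b2 * ssq (S2 j))))); last first.
  have sZ v : ssq (h *: v) = h ^+ 2 * ssq v.
    by rewrite /ssq mulr_sumr; apply: eq_bigr => i _; rewrite mxE exprMn.
  move=> j _; rewrite liftK !scaleNr coupling_sym -scalerBr sqnZ !sZ.
  by congr (_ + _); ring.
rewrite big_split/= -!mulr_sumr -/(coupled_trace al b1 b2 S1 S2) sumr_const card_ord.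
rewrite -[_ *+ d]mulr_natr -natr1; field.
by rewrite nat1r pnatr_eq0.
Qed.

Lemma coupling_basis z z' i : exists l, forall x,
  Q (z + x *: basis R i) (z' + x *: basis R i) <= Q z z' + l * x + (b1 + b2) * x ^+ 2.
Proof.
case: (unliftP ord0 i) => [j|] ->; last first.
  exists (p1 + p2) => x; rewrite coupling_time [_ * x]mulrC lerDl.
  by rewrite mulr_ge0 ?addr_ge0 ?sqr_ge0.
have E y x : ssq (y + x *: basis R (lift ord0 j)) = ssq y + 2 * x * y (lift ord0 j) 0 + x ^+ 2.
  rewrite /ssq (bigD1 j)//= [in RHS](bigD1 j)//= !mxE !eqxx/=.
  rewrite (eq_bigr (fun i => y (lift ord0 i) 0 ^+ 2)); first by ring.
  by move=> l lj; rewrite !mxE (inj_eq lift_inj) (negbTE lj) mulr0 addr0.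
exists (2 * b1 * z (lift ord0 j) 0 + 2 * b2 * z' (lift ord0 j) 0) => x.
by rewrite /coupling shiftB !E !mxE /= mulr0 !addr0 le_eqVlt; apply/orP; left; apply/eqP; ring.
Qed.

(** By convexity a square at y exceeds the square at z by at most the slope at y times the distance.
    The slope is thus bounded on the box alone while z and z' are arbitrary, as [env_joint]
    requires. *)
Lemma coupling_env (K : R) (z z' y y' : V) :
  (forall i, `|y i 0| <= K) -> (forall i, `|y' i 0| <= K) ->
  Q y y' <= Q z z' + (`|p1| + `|p2| + 4 * al * K + 2 * b1 * K + 2 * b2 * K) *
    (l1 (z - y) + l1 (z' - y')).
Proof.
move=> yK y'K; have K0 : 0 <= K := le_trans (normr_ge0 _) (yK ord0).
set a := l1 (z - y); set b := l1 (z' - y').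
have [a0 b0] : 0 <= a /\ 0 <= b by split; exact: l1_ge0.
have Hp (p : R) (x w : V) : p * x ord0 0 <= p * w ord0 0 + `|p| * l1 (w - x).
  have := ler_wpM2l (normr_ge0 p) (coord_le_l1 (w - x) ord0).
  rewrite !mxE -normrM; have := ler_norm (- (p * (w ord0 0 - x ord0 0))).
  by rewrite normrN; lra.
have Hs (x w : V) : (forall i, `|x i 0| <= K) -> ssq x <= ssq w + 2 * K * l1 (w - x).
  move=> xK; apply: (@le_trans _ _ (\sum_(i < n) (w (lift ord0 i) 0 ^+ 2 +
      2 * K * `|(w - x) (lift ord0 i) 0|))); last first.
    rewrite big_split/= -mulr_sumr lerD2l ler_wpM2l// ?mulr_ge0//.
    by rewrite /l1 big_ord_recl lerDr.
  apply: ler_sum => i _; have := xK (lift ord0 i); rewrite !mxE.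
  move: (x _ _) (w _ _) => s t sK.
  have : (s * (s - t)) <= K * `|t - s|.
    by apply: le_trans (ler_norm _) _; rewrite normrM distrC ler_wpM2r.
  by have := sqr_ge0 (s - t); nra.
have Hd : sqn (y - y') <= sqn (z - z') + 4 * K * (a + b).
  apply: (@le_trans _ _ (\sum_(i < n.+1) ((z - z') i 0 ^+ 2 +
      4 * K * (`|(z - y) i 0| + `|(z' - y') i 0|)))); last first.
    by rewrite big_split/= -mulr_sumr big_split.
  apply: ler_sum => i _; have := yK i; have := y'K i; rewrite !mxE.
  move: (y _ _) (y' _ _) (z _ _) (z' _ _) => s s' t t' s'K sK.
  have : (s - s') * ((s - t) - (s' - t')) <= (2 * K) * (`|t - s| + `|t' - s'|).
    apply: le_trans (ler_norm _) _; rewrite normrM ler_pM//.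
      by apply: le_trans (ler_normB _ _) _; lra.
    by apply: le_trans (ler_normB _ _) _; rewrite (distrC s) (distrC s').
  by have := sqr_ge0 ((s - s') - (t - t')); nra.
have := Hp p1 y z; have := Hp p2 y' z'; have := ler_wpM2l al0 Hd.
have := ler_wpM2l b10 (Hs _ z yK); have := ler_wpM2l b20 (Hs _ z' y'K).
rewrite -/a -/b /coupling.
have := mulr_ge0 (normr_ge0 p1) b0; have := mulr_ge0 (normr_ge0 p2) a0.
have := mulr_ge0 (mulr_ge0 b10 K0) b0; have := mulr_ge0 (mulr_ge0 b20 K0) a0.
move: (ssq y) (ssq z) (ssq y') (ssq z') (sqn _) (sqn _) (`|p1|) (`|p2|) => *.
by lra.
Qed.

End ScaledEstimate.

Lemma exp_small (R : realType) (r A e : R) : 0 <= r < 1 -> 0 < e ->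
  exists N, forall N', (N <= N')%N -> r ^+ N' * A <= e.
Proof.
move=> /andP[r0 r1] e0.
have : (fun n => r ^+ n * `|A|) @ \oo --> (0 * `|A| : R).
  by apply: cvgMl; apply: cvg_expr; rewrite ger0_norm.
rewrite mul0r => /cvgr0Pnorm_le /(_ e e0)[N _ HN]; exists N => N' NN'.
have := HN N' NN'; apply: le_trans; apply: le_trans (ler_norm _) _.
by rewrite !normrM normr_id.
Qed.

Lemma barrier_cst_gt0 (R : realType) n d (S : 'I_d -> 'cV[R]_n.+1) : 0 < barrier_cst S.
Proof.
rewrite /barrier_cst ltr_wpDr// mulr_ge0// sumr_ge0// => i _; exact: sqr_ge0.
Qed.

(** The joint bound passes through the envelopes, two rounds of averages and the coupled walks. The
    walks add [tr]: each step gains [tr] divided by the rate, and the discounted number of steps, r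
    / (1 - r), is that rate. *)
Lemma approx_joint (R : realType) n d (S1 S2 : 'I_d -> 'cV[R]_n.+1)
    (p1 p2 al b1 b2 eta L rho h CU : R) N (D1 D2 : 'cV[R]_n.+1 -> Prop) U1 U2 :
  let Q := coupling p1 p2 al b1 b2 in
  let tr := p1 + p2 + coupled_trace al b1 b2 S1 S2 in
  0 <= b1 -> 0 <= b2 -> 0 <= L -> 0 < rho <= 1 -> 0 < h ->
  2 * n.+1%:R * ((b1 + b2) * rho) <= eta ->
  D1 0 -> D2 0 -> (forall z, D1 z -> U1 z <= CU) -> (forall z, D2 z -> U2 z <= CU) ->
  (forall z z', D1 z -> D2 z' -> U1 z + U2 z' <= Q z z' + eta) ->
  (forall z z' y y', D1 y -> D2 y' ->
     Q y y' <= Q z z' + L * (l1 (z - y) + l1 (z' - y'))) ->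
  forall z z', approx D1 U1 L rho h S1 N z + approx D2 U2 L rho h S2 N z' <=
    Q z z' + 2 * eta + tr + wdisc d h ^+ N * `|tr|.
Proof.
move=> Q tr b10 b20 L0 rho01 h0 brho D10 D20 UC1 UC2 H12 Qenv.
have HE z z' : env D1 U1 L z + env D2 U2 L z' <= Q z z' + eta.
  apply: (env_joint D10 D20 UC1 UC2 L0 (c := eta)) => y y' w w' Dy Dy'.
  by apply: le_trans (H12 _ _ Dy Dy') _; rewrite lerD2r; exact: Qenv.
have bs0 : 0 <= b1 + b2 by rewrite addr_ge0.
have cb := @coupling_basis R n p1 p2 al b1 b2 b10 b20.
have lg1 := env_lip D10 UC1 L0; have lg2 := env_lip D20 UC2 L0.
have /andP[rho0 _] := rho01.
have lip_s (g : 'cV[R]_n.+1 -> R) : lip L g -> lip L (smooth rho g).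
  by move=> lg; apply: (@reg_lip _ _ 0); apply: bsmooth_reg => //; split.
have J1 := bsmooth_joint (enum 'I_n.+1) rho01 bs0 lg1 lg2 cb HE.
have J2 := bsmooth_joint (enum 'I_n.+1) rho01 bs0 (lip_s _ lg1) (lip_s _ lg2) cb.
have J3 z z' : mollified D1 U1 L rho z + mollified D2 U2 L rho z' <= Q z z' + 2 * eta.
  apply: le_trans (J2 (eta + (size (enum 'I_n.+1))%:R * ((b1 + b2) * rho)) _ z z') _.
    by move=> y y'; rewrite addrA; exact: J1.
  rewrite size_enum_ord; move: brho; rewrite -mulrA.
  by rewrite /Q; set X := n.+1%:R * _; move: X (coupling _ _ _ _ _ z z') => x q; lra.
apply: (@rit_joint R n.+1 _ (@wweight R d) _ (@wweight_ge0 R d) (@wweight_sum R d)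
  (wdisc_le1 d h0) _ _ _ _ _ _ _ (h ^+ 2 / d.+1%:R * tr) N J3) => [z z'|].
  by rewrite coupling_walk.
rewrite /wdisc /wrate; have d0 : 0 < d.+1%:R :> R by rewrite ltr0n.
move: (d.+1%:R : R) d0 => e e0; field.
have he : 0 < h ^+ 2 + e by rewrite addr_gt0// exprn_gt0.
by rewrite !gt_eqF.
Qed.

(** K and C1 come before the domains and the functions, because the scale of the blow-up is chosen
    in terms of them. The 13 eta are twice 5 from [one_side], 2 from the joint bound of the
    mollified envelopes and 1 from stopping the walks. *)
Lemma scaled_estimate (R : realType) n d (S1 S2 : 'I_d -> 'cV[R]_n.+1)
    (p1 p2 al b1 b2 k1 k2 eta : R) :
  0 <= al -> 0 <= b1 -> 0 <= b2 -> 0 < eta <= 1 ->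
  exists K C1 : R, 0 < K /\ forall (D1 D2 : 'cV[R]_n.+1 -> Prop) (U1 U2 : 'cV[R]_n.+1 -> R),
    D1 0 -> D2 0 -> U1 0 = 0 -> U2 0 = 0 ->
    (forall z, D1 z -> forall i, `|z i 0| <= K) ->
    (forall z, D2 z -> forall i, `|z i 0| <= K) ->
    attains D1 U1 -> attains D2 U2 ->
    (forall z z', D1 z -> D2 z' -> U1 z + U2 z' <= coupling p1 p2 al b1 b2 z z' + eta) ->
    frozen_sub D1 U1 S1 K C1 (k1 + eta) -> frozen_sub D2 U2 S2 K C1 (k2 + eta) ->
    0 <= p1 + p2 + coupled_trace al b1 b2 S1 S2 + k1 + k2 + 13 * eta.
Proof.
move=> al0 b10 b20 /andP[eta0 eta1].
pose N1 : R := n.+1%:R; have N10 : 0 < N1 by rewrite ltr0n.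
have N1ge : 1 <= N1 by rewrite ler1n.
pose M : R := `|p1| + `|p2| + 4 * al + 2 * b1 + 2 * b2 + 1.
have M1 : 1 <= M by rewrite /M lerDr !addr_ge0// mulr_ge0.
pose s1 : R := \sum_j sqn (S1 j); pose s2 : R := \sum_j sqn (S2 j).
have s10 : 0 <= s1 by apply: sumr_ge0 => j _; exact: sqn_ge0.
have s20 : 0 <= s2 by apply: sumr_ge0 => j _; exact: sqn_ge0.
pose cS : R := n%:R + 5 + s1 + s2 + N1.
(* A K^3 has to exceed CU + B0 + |kappa|. Since the slope L is itself proportional to K, CU is of
   order K^2 and B0 of order K^3. *)
pose A : R := M * N1 + 1 + M * cS + `|k1| + `|k2| + 1.
pose CSm : R := barrier_cst S1 + barrier_cst S2.
have B10 := barrier_cst_gt0 S1; have B20 := barrier_cst_gt0 S2.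
have cS0 : 0 <= cS by rewrite /cS !addr_ge0// ?ler0n// ltW.
have A1 : 1 <= A.
  by rewrite /A lerDr !addr_ge0// mulr_ge0// ?(le_trans ler01 M1)// ltW.
have A0 : 0 < A by exact: lt_le_trans A1.
have CS0 : 0 < CSm by rewrite addr_gt0.
pose K : R := 1 + A * CSm / eta.
have AC0 : 0 <= A * CSm / eta by rewrite divr_ge0// ?mulr_ge0// ltW.
have K1 : 1 <= K by rewrite lerDl.
have K0 : 0 < K by exact: lt_le_trans K1.
(* With this coefficient the barrier is at least A K^3 on the faces of the box, while its cost kb
   CSm stays below eta by the choice of K. Degree four makes both possible, against a lower bound of
   order K^3. *)
pose kb : R := A / K; have kb0 : 0 <= kb by rewrite divr_ge0// ltW.
have kbCSm : kb * CSm <= eta.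
  rewrite /kb mulrAC ler_pdivrMr//.
  have -> : eta * K = eta + A * CSm by rewrite /K; field; rewrite gt_eqF.
  by rewrite lerDr ltW.
pose L : R := M * K.
have L1 : 1 <= L by rewrite -[1](mulr1 1) ler_pM.
have L0 : 0 <= L by exact: le_trans L1.
pose X : R := eta + 2 * N1 * (L + b1 + b2) + 2 * N1.
have X0 : 0 < X by rewrite !addr_gt0// ?mulr_gt0// ltr_wpDr// ltr_wpDr// (lt_le_trans _ L1).
pose rho : R := eta / X.
have NL0 : 0 <= 2 * N1 * (L + b1 + b2) by rewrite mulr_ge0 ?addr_ge0// ?mulr_ge0// ltW.
have rho01 : 0 < rho <= 1.
  by rewrite divr_gt0//= ler_pdivrMr// mul1r /X; lra.
have [rho0 rho1] := andP rho01.
have rhoX : rho * X = eta by rewrite mulfVK// gt_eqF.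
have N1p := ltW N10; have rho0' := ltW rho0.
have N2p : 0 <= 2 * N1 by rewrite mulr_ge0.
have Lrho : 2 * N1 * (L * rho) <= eta.
  have : 0 <= rho * (2 * N1 * (b1 + b2) + 2 * N1).
    by apply: mulr_ge0 => //; apply: addr_ge0 => //; apply: mulr_ge0 => //; exact: addr_ge0.
  have : 0 <= rho * eta by rewrite mulr_ge0// ltW.
  by rewrite -rhoX /X; nra.
have brho : 2 * N1 * ((b1 + b2) * rho) <= eta.
  have : 0 <= rho * (2 * N1 * L + 2 * N1).
    by apply: mulr_ge0 => //; apply: addr_ge0 => //; exact: mulr_ge0.
  have : 0 <= rho * eta by rewrite mulr_ge0// ltW.
  by rewrite -rhoX /X; nra.
pose L2 : R := L / rho / rho.
have L20 : 0 <= L2 by rewrite !divr_ge0// ltW.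
pose c1 : R := 2 + \sum_j l1 (S1 j) ^+ 3; pose c2 : R := 2 + \sum_j l1 (S2 j) ^+ 3.
have [c10 c20] : 0 <= c1 /\ 0 <= c2.
  by split; rewrite addr_ge0// sumr_ge0// => j _; rewrite exprn_ge0// l1_ge0.
pose h : R := eta / (2 * (eta + L2 * c1 + L2 * c2)).
have [Lc1 Lc2] : 0 <= L2 * c1 /\ 0 <= L2 * c2 by split; exact: mulr_ge0.
have Y0 : 0 < 2 * (eta + L2 * c1 + L2 * c2) by rewrite mulr_gt0// !ltr_wpDr.
have h0 : 0 < h by rewrite divr_gt0.
have h1 : h <= 1 by rewrite ler_pdivrMr// mul1r; lra.
have hY : h * (2 * (eta + L2 * c1 + L2 * c2)) = eta by rewrite mulfVK// gt_eqF.
have hE : eta / 2 = h * (eta + L2 * c1 + L2 * c2).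
  by rewrite -[in LHS]hY [2 * _]mulrC mulrA mulfK.
have hL1 : L2 * c1 * h <= eta / 2.
  rewrite hE; have := mulr_ge0 (ltW h0) Lc2; have := mulr_ge0 (ltW h0) (ltW eta0).
  by rewrite [_ * h]mulrC !mulrDr; move: (h * eta) (h * (L2 * c1)) (h * (L2 * c2)) => *; lra.
have hL2 : L2 * c2 * h <= eta / 2.
  rewrite hE; have := mulr_ge0 (ltW h0) Lc1; have := mulr_ge0 (ltW h0) (ltW eta0).
  by rewrite [_ * h]mulrC !mulrDr; move: (h * eta) (h * (L2 * c1)) (h * (L2 * c2)) => *; lra.
pose tr : R := p1 + p2 + coupled_trace al b1 b2 S1 S2.
pose r : R := wdisc d h; have r01 : 0 <= r < 1 := wdisc01 d h0.
have e20 : 0 < eta / 2 by rewrite divr_gt0.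
have [m1 Hm1] := @exp_small R r ((1 + wrate d h) * (L2 * \sum_i wweight R i * l1 (wstep h S1 i))) _ r01 e20.
have [m2 Hm2] := @exp_small R r ((1 + wrate d h) * (L2 * \sum_i wweight R i * l1 (wstep h S2 i))) _ r01 e20.
have [m3 Hm3] := @exp_small R r `|tr| _ r01 eta0.
pose N := (m1 + m2 + m3)%N.
have {}Hm1 := Hm1 N.+1 (ltnW (leq_ltn_trans (leq_trans (leq_addr m2 m1) (leq_addr m3 _)) (ltnSn N))).
have {}Hm2 := Hm2 N.+1 (ltnW (leq_ltn_trans (leq_trans (leq_addl m1 m2) (leq_addr m3 _)) (ltnSn N))).
have {}Hm3 := Hm3 N (leq_addl _ _).
pose CU : R := L * (N1 * K) + eta.
pose B0 (s : R) : R := L * (n%:R + 5 + s + N1 * K ^+ 2).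
pose C (k s : R) : R := L2 + 4 * kb * K ^+ 3 + 12 * kb * K ^+ 2 + `|CU| + `|B0 s| + `|k|.
exists K, (`|C k1 s1| + `|C k2 s2|); split => // D1 D2 U1 U2 D10 D20 U10 U20 D1K D2K M1a M2a H12 F1 F2.
have Q00 : coupling p1 p2 al b1 b2 (0 : 'cV[R]_n.+1) 0 = 0.
  have sq0 : ssq (0 : 'cV[R]_n.+1) = 0 by apply: big1 => i _; rewrite mxE expr0n.
  rewrite /coupling !sq0 /sqn big1 ?mxE ?mulr0 ?addr0// => i _.
  by rewrite !mxE subrr expr0n.
have LL : `|p1| + `|p2| + 4 * al * K + 2 * b1 * K + 2 * b2 * K <= L.
  rewrite /L /M !mulrDl mul1r.
  have : `|p1| <= `|p1| * K by rewrite ler_peMr.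
  have : `|p2| <= `|p2| * K by rewrite ler_peMr.
  by lra.
have Qenv (z z' y y' : 'cV[R]_n.+1) : (forall i, `|y i 0| <= K) -> (forall i, `|y' i 0| <= K) ->
    coupling p1 p2 al b1 b2 y y' <= coupling p1 p2 al b1 b2 z z' + L * (l1 (z - y) + l1 (z' - y')).
  move=> yK y'K; apply: le_trans (coupling_env p1 p2 al0 b10 b20 z z' yK y'K) _.
  by rewrite lerD2l ler_wpM2r// addr_ge0// l1_ge0.
have zK0 i : `|(0 : 'cV[R]_n.+1) i 0| <= K by rewrite mxE normr0 ltW.
have l1K (z : 'cV[R]_n.+1) : (forall i, `|z i 0| <= K) -> L * l1 z <= L * (N1 * K).
  by move=> zK; rewrite ler_wpM2l// l1_le.
(* The joint inequality at z' = 0, where U2 vanishes, bounds U1 from above on its domain by a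
   constant independent of U1. *)
have UC1 z : D1 z -> U1 z <= CU.
  move=> Dz; have := H12 z 0 Dz D20; rewrite U20 addr0 => /le_trans; apply.
  rewrite lerD2r; apply: le_trans (Qenv 0 0 _ _ (D1K z Dz) zK0) _.
  by rewrite Q00 !sub0r !l1N l10 addr0 add0r; exact: l1K (D1K z Dz).
have UC2 z : D2 z -> U2 z <= CU.
  move=> Dz; have := H12 0 z D10 Dz; rewrite U10 add0r => /le_trans; apply.
  rewrite lerD2r; apply: le_trans (Qenv 0 0 _ _ zK0 (D2K z Dz)) _.
  by rewrite Q00 !sub0r !l1N l10 add0r add0r; exact: l1K (D2K z Dz).
have hB s k : 0 <= s <= s1 + s2 -> `|k| <= `|k1| + `|k2| ->
    CU + B0 s + `|k| < kb * K ^+ 4.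
  move=> /andP[s0 sle] kle.
  have -> : kb * K ^+ 4 = A * K ^+ 3 by rewrite /kb; field; rewrite gt_eqF.
  have K3 : 1 <= K ^+ 3 by rewrite exprn_ege1.
  have K23 : K ^+ 2 <= K ^+ 3 by rewrite [leRHS]exprS ler_peMl// exprn_ge0// ltW.
  have K13 : K <= K ^+ 3.
    by rewrite [leRHS]exprS ler_peMr ?(ltW K0)// exprn_ege1.
  have MN0 : 0 <= M * N1 by rewrite mulr_ge0// ?(le_trans _ M1)// ltW.
  have T1 : L * (N1 * K) <= M * N1 * K ^+ 3.
    by rewrite /L (_ : _ * _ = M * N1 * K ^+ 2); [exact: ler_wpM2l|ring].
  have T2 : B0 s <= M * cS * K ^+ 3.
    rewrite /B0 /L /cS -!mulrA ler_wpM2l ?(le_trans _ M1)// [in leRHS]mulrDl mulrDr.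
    rewrite lerD//; last first.
      by rewrite (_ : K * _ = N1 * K ^+ 3)//; ring.
    rewrite mulrC ler_pM// ?(ltW K0)// ?addr_ge0//; move: sle; rewrite -!addrA; lra.
  have T3 : `|k| <= (`|k1| + `|k2|) * K ^+ 3.
    by apply: le_trans kle _; rewrite ler_peMr// addr_ge0.
  rewrite /CU /A; move: T1 T2 T3 K3; rewrite !mulrDl !mul1r; lra.
have s1le : 0 <= s1 <= s1 + s2 by rewrite s10 lerDl.
have s2le : 0 <= s2 <= s1 + s2 by rewrite s20 lerDr.
have kb1 : kb * barrier_cst S1 <= eta.
  by apply: le_trans kbCSm; rewrite ler_wpM2l// lerDl ltW.
have kb2 : kb * barrier_cst S2 <= eta.
  by apply: le_trans kbCSm; rewrite ler_wpM2l// lerDr ltW.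
have R1 : U1 0 <= approx D1 U1 L rho h S1 N 0 + k1 + 5 * eta.
  apply: (@one_side _ _ _ D1 U1 S1 K k1 eta kb L rho h CU (`|C k1 s1| + `|C k2 s2|) N) => //.
  - by rewrite h0.
  - by rewrite mulrCA; exact: Hm1.
  - by apply: hB => //; rewrite lerDl.
  - by apply: (@le_trans _ _ `|C k1 s1|); [exact: ler_norm|rewrite lerDl].
have R2 : U2 0 <= approx D2 U2 L rho h S2 N 0 + k2 + 5 * eta.
  apply: (@one_side _ _ _ D2 U2 S2 K k2 eta kb L rho h CU (`|C k1 s1| + `|C k2 s2|) N) => //.
  - by rewrite h0.
  - by rewrite mulrCA; exact: Hm2.
  - by apply: hB => //; rewrite lerDr.
  - by apply: (@le_trans _ _ `|C k2 s2|); [exact: ler_norm|rewrite lerDr].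
have J5 : approx D1 U1 L rho h S1 N 0 + approx D2 U2 L rho h S2 N 0 <=
    coupling p1 p2 al b1 b2 (0 : 'cV[R]_n.+1) 0 + 2 * eta + tr + r ^+ N * `|tr|.
  apply: (@approx_joint R n d S1 S2 p1 p2 al b1 b2 eta L rho h CU N D1 D2 U1 U2) => // z z' y y' Dy Dy'.
  exact: Qenv (D1K _ Dy) (D2K _ Dy').
rewrite Q00 add0r in J5.
move: R1 R2 J5 Hm3; rewrite U10 U20 /tr.
move: (approx _ _ _ _ _ _ _ _) (approx _ _ _ _ _ _ _ _) (r ^+ N * _) => *; lra.
Qed.

(** * Semicontinuity and compactness *)

Section Semicontinuity.
Variables (R : realType) (P : Type) (dd : P -> P -> R).
Implicit Types (D : P -> Prop) (f g : P -> R).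

Definition uscg D f := forall p, D p -> forall e, 0 < e ->
  exists delta, 0 < delta /\ forall p', D p' -> dd p p' < delta -> f p' < f p + e.

Definition contg D f := forall p, D p -> forall e, 0 < e ->
  exists delta, 0 < delta /\ forall p', D p' -> dd p p' < delta -> `|f p' - f p| < e.

(** Compactness as a near-covering property along the integers. It passes to products and images and
    replaces the extraction of subsequences: an assertion for all large N on D is checked only near
    each point. *)
Definition covered D := forall Q : nat -> P -> Prop,
  (forall p, D p -> exists delta N0, 0 < delta /\
     forall N p', (N0 <= N)%N -> D p' -> dd p p' < delta -> Q N p') ->
  exists N0, forall N p, (N0 <= N)%N -> D p -> Q N p.

Lemma contg_usc D f : contg D f -> uscg D f.
Proof.
move=> H p Dp e e0; have [d [d0 Hd]] := H p Dp e e0; exists d; split=> // p' Dp' pp'.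
by have := Hd p' Dp' pp'; rewrite ltr_norml => /andP[_]; lra.
Qed.

Lemma uscgD D f g : uscg D f -> uscg D g -> uscg D (fun p => f p + g p).
Proof.
move=> Hf Hg p Dp e e0; have e20 : 0 < e / 2 by rewrite divr_gt0.
have [d1 [d10 H1]] := Hf p Dp _ e20; have [d2 [d20 H2]] := Hg p Dp _ e20.
exists (Num.min d1 d2); split; first by rewrite lt_min d10.
move=> p' Dp'; rewrite lt_min => /andP[/(H1 p' Dp') + /(H2 p' Dp')]; lra.
Qed.

Lemma contg_cst D c : contg D (fun=> c).
Proof.
by move=> p Dp e e0; exists 1; split => // p' _ _; rewrite subrr normr0.
Qed.

Lemma contgD D f g : contg D f -> contg D g -> contg D (fun p => f p + g p).
Proof.
move=> Hf Hg p Dp e e0; have e20 : 0 < e / 2 by rewrite divr_gt0.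
have [d1 [d10 H1]] := Hf p Dp _ e20; have [d2 [d20 H2]] := Hg p Dp _ e20.
exists (Num.min d1 d2); split; first by rewrite lt_min d10.
move=> p' Dp'; rewrite lt_min => /andP[/(H1 p' Dp') + /(H2 p' Dp')].
by rewrite !ltr_norml => /andP[? ?] /andP[? ?]; apply/andP; split; lra.
Qed.

Lemma contgM D f g : contg D f -> contg D g -> contg D (fun p => f p * g p).
Proof.
move=> Hf Hg p Dp e e0; pose m := `|f p| + `|g p| + 1.
have m0 : 0 < m by rewrite ltr_wpDl// addr_ge0.
have m1 : 1 <= m by rewrite lerDr addr_ge0.
pose e1 := Num.min 1 (e / (3 * m)).
have e10 : 0 < e1 by rewrite lt_min ltr01 divr_gt0// mulr_gt0.
have [d1 [d10 H1]] := Hf p Dp _ e10; have [d2 [d20 H2]] := Hg p Dp _ e10.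
exists (Num.min d1 d2); split; first by rewrite lt_min d10.
move=> p' Dp'; rewrite lt_min => /andP[/(H1 p' Dp') F /(H2 p' Dp') G].
have -> : f p' * g p' - f p * g p = (f p' - f p) * (g p' - g p) +
   (f p' - f p) * g p + f p * (g p' - g p) by ring.
have e1m : e1 * (3 * m) <= e by rewrite -ler_pdivlMr ?mulr_gt0// /e1 ge_min lexx orbT.
have e11 : e1 <= 1 by rewrite /e1 ge_min lexx.
have a1 : `|(f p' - f p) * (g p' - g p)| < e1 * m.
  rewrite normrM; apply: (@lt_le_trans _ _ (e1 * e1)); last first.
    by rewrite ler_wpM2l ?(ltW e10)// (le_trans e11).
  exact: ltr_pM.
have a2 : `|(f p' - f p) * g p| <= e1 * m.
  rewrite normrM ler_pM ?(ltW F)//; have := normr_ge0 (f p); rewrite /m; lra.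
have a3 : `|f p * (g p' - g p)| <= e1 * m.
  rewrite normrM mulrC ler_pM ?(ltW G)//; have := normr_ge0 (g p); rewrite /m; lra.
apply: le_lt_trans (ler_normD _ _) _; apply: le_lt_trans (lerD (ler_normD _ _) (lexx _)) _.
by move: e1m a1 a2 a3; move: (`|_ * _|) (`|_ * _|) (`|_ * _|) => *; lra.
Qed.

Lemma contgN D f : contg D f -> contg D (fun p => - f p).
Proof.
move=> Hf p Dp e /(Hf p Dp)[d [d0 H]]; exists d; split => // p' Dp' pp'.
by rewrite -opprD normrN; exact: H.
Qed.

Lemma contgX D f n : contg D f -> contg D (fun p => f p ^+ n).
Proof.
move=> Hf; elim: n => [|n IH].
  by have := @contg_cst D 1; congr (contg D _); apply/funext => p; rewrite expr0.
by have := contgM Hf IH; congr (contg D _); apply/funext => p; rewrite exprS.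
Qed.

Lemma contg_sum D (I : Type) (s : seq I) (F : I -> P -> R) :
  (forall i, contg D (F i)) -> contg D (fun p => \sum_(i <- s) F i p).
Proof.
move=> H; elim: s => [|i s IH].
  by have := @contg_cst D 0; congr (contg D _); apply/funext => p; rewrite big_nil.
by have := contgD (H i) IH; congr (contg D _); apply/funext => p; rewrite big_cons.
Qed.

Lemma contgV D f : contg D f -> (forall p, D p -> 0 < f p) -> contg D (fun p => (f p)^-1).
Proof.
move=> Hf f0 p Dp e e0; have fp := f0 p Dp.
have e10 : 0 < Num.min (f p / 2) (e * f p ^+ 2 / 2).
  by rewrite lt_min !divr_gt0// mulr_gt0// exprn_gt0.
have [d [d0 H]] := Hf p Dp _ e10; exists d; split => // p' Dp' pp'.
have := H p' Dp' pp'; rewrite lt_min => /andP[h1 h2]; have fp' := f0 p' Dp'.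
have -> : (f p')^-1 - (f p)^-1 = (f p - f p') / (f p' * f p).
  by field; rewrite !gt_eqF.
rewrite normrM normfV (gtr0_norm (mulr_gt0 fp' fp)) ltr_pdivrMr ?mulr_gt0// distrC.
have f2 : f p / 2 <= f p' by move: h1; rewrite ltr_norml; lra.
apply: lt_le_trans h2 _; have := ler_wpM2l (ltW e0) (ler_wpM2r (ltW fp) f2).
by apply: le_trans; rewrite le_eqVlt; apply/orP; left; apply/eqP; ring.
Qed.

Lemma uscgM D f c : contg D c -> (forall p, D p -> 0 < c p) -> uscg D f ->
  uscg D (fun p => c p * f p).
Proof.
move=> Hc c0 Hf p Dp e e0; have cp := c0 p Dp.
have e10 : 0 < e / (4 * c p) by rewrite divr_gt0// mulr_gt0.
have [d1 [d10 H1]] := Hf p Dp _ e10.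
pose m := `|f p + e / (4 * c p)| + 1; have m0 : 0 < m by rewrite ltr_wpDl.
have e20 : 0 < e / (2 * m) by rewrite divr_gt0// mulr_gt0.
have [d2 [d20 H2]] := Hc p Dp _ e20.
exists (Num.min d1 d2); split; first by rewrite lt_min d10.
move=> p' Dp'; rewrite lt_min => /andP[/(H1 p' Dp') F /(H2 p' Dp') C].
have cp' := c0 p' Dp'.
apply: (@lt_trans _ _ (c p' * (f p + e / (4 * c p)))); first by rewrite ltr_pM2l.
have : (c p' - c p) * (f p + e / (4 * c p)) <= e / 2.
  apply: le_trans (ler_norm _) _; rewrite normrM.
  apply: (@le_trans _ _ (e / (2 * m) * m)); last by rewrite invfM mulrA mulfVK ?gt_eqF.
  by rewrite ler_pM ?(ltW C)// /m lerDl.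
have : c p * (e / (4 * c p)) = e / 4 by field; rewrite gt_eqF.
by rewrite mulrBl !mulrDr; move: (c p' * _) (c p * _) (c p' * _) (c p * _) => *; lra.
Qed.

Lemma uscg_bounded D f : covered D -> uscg D f -> exists B, forall p, D p -> f p <= B.
Proof.
move=> cD Hf; have [p Dp|N0 HN0] := cD (fun N p => f p <= N%:R).
  have [delta [d0 H]] := Hf p Dp 1 ltr01.
  exists delta, (Num.bound `|f p + 1|); split => // N p' NN Dp' pp'.
  apply: ltW; apply: lt_le_trans (H p' Dp' pp') _; apply: le_trans (ler_norm _) _.
  by apply: le_trans (ltW (archi_boundP (normr_ge0 _))) _; rewrite ler_nat.
by exists N0%:R => p Dp; exact: HN0.
Qed.

(** If the supremum were not attained, f <= sup - 1 / (N + 1) would hold near each point for large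
    N, hence on all of D for some N. *)
Lemma uscg_max D f p1 : covered D -> D p1 -> uscg D f ->
  exists p0, D p0 /\ forall p, D p -> f p <= f p0.
Proof.
move=> cD Dp1 Hf; have [B HB] := uscg_bounded cD Hf.
pose E := [set f p | p in [set p | D p]].
have supE : has_sup E by split; [exists (f p1), p1|exists B => _ [p Dp <-]; exact: HB].
have EM p : D p -> f p <= sup E.
  by move=> Dp; apply: sup_ubound; [case: supE|exists p].
apply: contrapT => noM.
have lM p : D p -> f p < sup E.
  move=> Dp; rewrite lt_neqAle EM// andbT; apply/eqP => fM; apply: noM.
  by exists p; split => // y /EM; rewrite fM.
have [p Dp|N0 HN0] := cD (fun N p => f p <= sup E - N.+1%:R^-1).
  have gap : 0 < (sup E - f p) / 2 by rewrite divr_gt0// subr_gt0 lM.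
  have [delta [d0 H]] := Hf p Dp _ gap.
  have [N0] := ltr_add_invr gap; rewrite add0r => HN0.
  exists delta, N0; split => // N p' NN Dp' pp'; have := H p' Dp' pp'.
  have : N.+1%:R^-1 <= N0.+1%:R^-1 :> R by rewrite lef_pV2 ?posrE ?ltr0n// ler_nat.
  by move: (sup E) (f p) (f p') (N.+1%:R^-1) (N0.+1%:R^-1) HN0 => *; lra.
have : sup E <= sup E - N0.+1%:R^-1.
  by apply: ge_sup; [case: supE|move=> _ [p Dp <-]; exact: HN0].
by apply/negP; rewrite -ltNge ltrBlDr ltrDl invr_gt0 ltr0n.
Qed.

End Semicontinuity.

Section Boxes.
Variables (R : realType) (n : nat) (lo hi : 'I_n -> R).
Local Notation V := 'cV[R]_n.

Definition box (z : V) := forall i, lo i <= z i 0 <= hi i.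

Lemma box_cover (P : nat -> V -> Prop) :
  (forall z, box z -> exists delta N0, 0 < delta /\
     forall N z', (N0 <= N)%N -> box z' -> l1 (z' - z) < delta -> P N z') ->
  exists N0, forall N z, (N0 <= N)%N -> box z -> P N z.
Proof.
move=> HP.
have /compact_near_coveringP cK : compact [set v : 'rV[R]_n | forall i, `[lo i, hi i]%classic (v ord0 i)].
  by apply: (@rV_compact _ _ (fun i => `[lo i, hi i]%classic)) => i; exact: segment_compact.
have [|N0 _ HN0] := @cK nat \oo (fun N v => box v^T -> P N v^T) _.
  move=> v /= vK; have bv : box v^T by move=> i; rewrite mxE; have := vK i; rewrite /= in_itv.
  have [delta [N0 [d0 H]]] := HP _ bv.
  have dn0 : 0 < delta / n.+1%:R by rewrite divr_gt0.
  exists (ball v (delta / n.+1%:R), [set N | (N0 <= N)%N]).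
    by split; [exact: nbhsx_ballx|exists N0].
  move=> [w N] [/= [_ vw] NN0] bw; apply: (H N) => //.
  apply: (@le_lt_trans _ _ (n%:R * (delta / n.+1%:R))); last first.
    by rewrite mulrCA gtr_pMr// ltr_pdivrMr// mul1r ltr_nat.
  apply: l1_le => i; rewrite !mxE; apply: ltW; have := vw 0 i; rewrite /ball/= distrC.
  by [].
exists N0 => N z NN0 bz; rewrite -[z]trmxK; apply: (HN0 N NN0); last by rewrite trmxK.
by move=> i; rewrite /= mxE in_itv; exact: bz.
Qed.

Definition usc (D : V -> Prop) (U : V -> R) := forall z, D z -> forall e, 0 < e ->
  exists delta, 0 < delta /\ forall z', D z' -> l1 (z' - z) < delta -> U z' < U z + e.

Lemma usc_bounded (U : V -> R) : usc box U -> exists B, forall z, box z -> U z <= B.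
Proof. exact: uscg_bounded box_cover. Qed.

Lemma usc_max (U : V -> R) z1 : box z1 -> usc box U ->
  exists z0, box z0 /\ forall z, box z -> U z <= U z0.
Proof. exact: uscg_max box_cover. Qed.

Lemma usc_attains (U : V -> R) z1 : box z1 -> usc box U ->
  forall (G : V -> R) M,
  (forall z z', box z -> box z' -> `|G z' - G z| <= M * l1 (z' - z)) ->
  exists z0, box z0 /\ forall z, box z -> U z - G z <= U z0 - G z0.
Proof.
move=> bz1 HU G M GM; apply: (usc_max bz1) => z bz e e0.
have e20 : 0 < e / 2 by rewrite divr_gt0.
have [delta [d0 H]] := HU z bz _ e20.
pose m := `|M| + 1; have m0 : 0 < m by rewrite ltr_wpDl.
exists (Num.min delta (e / 2 / m)); split; first by rewrite lt_min d0 !divr_gt0.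
move=> z' bz'; rewrite lt_min => /andP[/(H z' bz') H1].
rewrite ltr_pdivlMr// mulrDr mulr1 => H2.
have := GM z z' bz bz'; rewrite ler_norml => /andP[H3 _].
have := ler_wpM2r (l1_ge0 (z' - z)) (ler_norm M).
have := l1_ge0 (z' - z).
rewrite mulrC in H2; move: H1 H2 H3; move: (l1 _) (`|M| * _) => *; lra.
Qed.

End Boxes.

(** * Semicontinuity, continuity and jets in terms of an explicit distance *)

Section Interface.
Variables (R : realType) (k : nat).
Local Notation X := (R * 'cV[R]_k)%type.
Implicit Types (p : X) (x : 'cV[R]_k).

Definition dist p p' : R := `|p'.1 - p.1| + l1 (p'.2 - p.2).

Lemma dist_ge0 p p' : 0 <= dist p p'.
Proof. by rewrite addr_ge0// l1_ge0. Qed.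

Lemma dist_refl p : dist p p = 0.
Proof. by rewrite /dist !subrr normr0 l10 addr0. Qed.

Lemma dist_triangle p p' p'' : dist p p'' <= dist p p' + dist p' p''.
Proof.
rewrite /dist addrACA lerD//.
  by rewrite -[p''.1 - p.1](subrKA p'.1) addrC ler_normD.
by rewrite -[p''.2 - p.2](subrKA p'.2) addrC l1D.
Qed.

Lemma near_distP p (P : set X) :
  nbhs p P <-> exists delta, 0 < delta /\ forall p', dist p p' < delta -> P p'.
Proof.
split.
  move=> /nbhs_ballP[e e0 He]; exists e; split => // -[t x] /= H; apply: He.
  split; rewrite /ball/=.
    by rewrite distrC; apply: le_lt_trans H; rewrite lerDl l1_ge0.
  split => // i j; rewrite (ord1 j) /ball/= distrC; apply: le_lt_trans H.
  apply: le_trans (ler_wpDl _ (lexx _)); last exact: normr_ge0.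
  by have := coord_le_l1 (x - p.2) i; rewrite !mxE.
move=> [e [e0 He]]; apply/nbhs_ballP.
have en : 0 < e / k.+2%:R by rewrite divr_gt0.
exists (e / k.+2%:R) => // -[t x] [/= H1 [_ H2]]; apply: He; rewrite /dist/=.
have H3 : l1 (x - p.2) <= k%:R * (e / k.+2%:R).
  apply: l1_le => i; rewrite !mxE; apply: ltW; have := H2 i 0.
  by rewrite /ball/= distrC.
have : `|t - p.1| < e / k.+2%:R by move: H1; rewrite /ball/= distrC.
have : e = k%:R * (e / k.+2%:R) + 2 * (e / k.+2%:R).
  by rewrite -mulrDl -natrD addn2 mulrC mulfVK.
move: H3 en; move: (e / _) => y; move: (l1 _) (`|_|) (k%:R * y) => *; lra.
Qed.

Lemma within_distP (D : set X) p (P : set X) : within D (nbhs p) P <->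
  exists delta, 0 < delta /\ forall p', D p' -> dist p p' < delta -> P p'.
Proof.
apply: (iff_trans (near_distP p (fun p' => D p' -> P p'))).
split => -[e [e0 He]]; exists e; split => // p'.
  by move=> Dp' /He; apply.
by move=> pp' Dp'; exact: He.
Qed.

Definition usc_d (D : X -> Prop) (u : X -> R) := forall p, D p -> forall e, 0 < e ->
  exists delta, 0 < delta /\ forall p', D p' -> dist p p' < delta -> u p' < u p + e.

Lemma usc_onP D u : usc_on D u -> usc_d D u.
Proof.
move=> H p Dp e e0; have := H p (- u p - e).
rewrite lte_fin gtrBl => /(_ e0)[V nV HV].
have /within_distP[d [d0 Hd]] : within D (nbhs p) V by rewrite (nbhs_subspace_in Dp).
exists d; split => // p' Dp' pp'.
have := HV p' (Hd p' Dp' pp'); rewrite lte_fin; lra.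
Qed.

Lemma lsc_onP D u : lsc_on D u -> usc_d D (fun p => - u p).
Proof.
move=> H p Dp e e0; have := H p (u p - e).
rewrite lte_fin gtrBl => /(_ e0)[V nV HV].
have /within_distP[d [d0 Hd]] : within D (nbhs p) V by rewrite (nbhs_subspace_in Dp).
exists d; split => // p' Dp' pp'.
have := HV p' (Hd p' Dp' pp'); rewrite lte_fin; lra.
Qed.

Lemma cont_withinP (a b : nat) D (F : X -> 'M[R]_(a, b)) : {within D, continuous F} ->
  forall p, D p -> forall e, 0 < e ->
  exists delta, 0 < delta /\ forall p', D p' -> dist p p' < delta ->
    forall i j, `|F p' i j - F p i j| < e.
Proof.
move=> cF p Dp e e0.
have nV := cF p (ball (F p) e) (nbhsx_ballx _ _ e0).
have /within_distP[d [d0 Hd]] : within D (nbhs p) (F @^-1` ball (F p) e).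
  by rewrite (nbhs_subspace_in Dp).
exists d; split => // p' Dp' pp' i j.
have [_] := Hd p' Dp' pp'; move=> /(_ i j); by rewrite /ball/= distrC.
Qed.

Lemma cont_within_realP D (F : X -> R) : {within D, continuous F} ->
  forall p, D p -> forall e, 0 < e ->
  exists delta, 0 < delta /\ forall p', D p' -> dist p p' < delta -> `|F p' - F p| < e.
Proof.
move=> cF p Dp e e0.
have nV := cF p (ball (F p) e) (nbhsx_ballx _ _ e0).
have /within_distP[d [d0 Hd]] : within D (nbhs p) (F @^-1` ball (F p) e).
  by rewrite (nbhs_subspace_in Dp).
exists d; split => // p' Dp' pp'.
by have := Hd p' Dp' pp'; rewrite /ball/= distrC.
Qed.

Lemma enormE (a b : nat) (A : 'M[R]_(a, b)) : enorm A ^+ 2 = \sum_i \sum_j A i j ^+ 2.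
Proof.
rewrite sqr_sqrtr// sumr_ge0// => i _; apply: sumr_ge0 => j _; exact: sqr_ge0.
Qed.

Lemma enorm_ge0 (a b : nat) (A : 'M[R]_(a, b)) : 0 <= enorm A.
Proof. exact: sqrtr_ge0. Qed.

Lemma enorm_coord (a b : nat) (A : 'M[R]_(a, b)) i j : `|A i j| <= enorm A.
Proof.
rewrite -(@ler_pXn2r _ 2)// ?nnegrE ?enorm_ge0// real_normK ?num_real// enormE.
rewrite (bigD1 i)//= (bigD1 j)//= -addrA lerDl addr_ge0// sumr_ge0// => *.
  exact: sqr_ge0.
by apply: sumr_ge0 => *; exact: sqr_ge0.
Qed.

Lemma l1_enorm x : l1 x <= k%:R * enorm x.
Proof. by apply: l1_le => i; exact: enorm_coord. Qed.

Lemma dotpE (x y : 'cV[R]_k) : dotp x y = \sum_i x i 0 * y i 0.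
Proof. by rewrite /dotp mxE; apply: eq_bigr => i _; rewrite mxE. Qed.

(** Undoing the blow-up leaves an error |dt| dist + dist^3. For dist <= 1, dist^2 is at most a
    multiple of |dt| + |dx|^2, so this error is a parabolic little-o. *)
Lemma superjet_intro T (u : X -> R) p (a : R) (q : 'cV[R]_k) (M : 'M[R]_k) (C delta : R) :
  M^T = M -> 0 < delta ->
  (forall p', domain k T p' -> dist p p' < delta ->
    u p' <= jet_poly (u p) p a q M p' +
      C * (`|p'.1 - p.1| * dist p p' + dist p p' ^+ 3)) ->
  superjet T u p a q M.
Proof.
move=> MT d0 H; split => //.
(* The positive part of the excess over the polynomial fulfils the inequality on the whole domain;
   the bound near p then only has to make it small. *)
exists (fun p' => Num.max 0 (u p' - jet_poly (u p) p a q M p')); split; last first.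
  by move=> p' _; rewrite -lerBlDl le_max lexx orbT.
apply/eqoP => e e0; apply/within_distP.
pose c := `|C| * (3 + 2 * k%:R ^+ 2) + 1; have c0 : 0 < c.
  by rewrite ltr_wpDl// mulr_ge0// addr_ge0// mulr_ge0// exprn_ge0.
exists (Num.min delta (Num.min 1 (e / c))).
split; first by rewrite !lt_min d0 ltr01 divr_gt0.
move=> p' Dp'; rewrite !lt_min => /and3P[pd p1 pe].
rewrite ger0_norm ?le_max ?lexx//.
have s0 := dist_ge0 p p'; set s := dist p p' in pd p1 pe s0 *.
have := H p' Dp' pd; rewrite -/s.
set t := `|p'.1 - p.1|; set E := enorm _.
have t0 : 0 <= t by exact: normr_ge0. have E0 : 0 <= E by exact: enorm_ge0.
have E20 : 0 <= E ^+ 2 by exact: sqr_ge0.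
rewrite [X in e * X]ger0_norm ?addr_ge0// -lerBlDl => H1.
rewrite ge_max mulr_ge0 ?addr_ge0 ?(ltW e0)//=; apply: le_trans H1 _.
have sl : s <= t + k%:R * E by rewrite /s /dist lerD2l l1_enorm.
have ts : t <= s by rewrite /s /dist lerDl l1_ge0.
have s2 : s ^+ 2 <= 2 * t + 2 * k%:R ^+ 2 * E ^+ 2.
  have : s ^+ 2 <= (t + k%:R * E) ^+ 2 by rewrite lerXn2r ?nnegrE// ?addr_ge0// mulr_ge0.
  have := sqr_ge0 (t - k%:R * E); have : t ^+ 2 <= t.
    by rewrite expr2 ler_piMr// (le_trans ts)// ltW.
  by rewrite !sqrrD; nra.
have H2 : t * s + s ^+ 3 <= s * (3 * t + 2 * k%:R ^+ 2 * E ^+ 2).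
  by rewrite exprS mulrC -mulrDr ler_wpM2l//; lra.
have H3 : 3 * t + 2 * k%:R ^+ 2 * E ^+ 2 <= (3 + 2 * k%:R ^+ 2) * (t + E ^+ 2).
  have : 0 <= 2 * k%:R ^+ 2 * t by rewrite mulr_ge0// mulr_ge0// exprn_ge0.
  by nra.
have H4 : 0 <= t * s + s ^+ 3 by rewrite addr_ge0 ?mulr_ge0// exprn_ge0.
apply: (@le_trans _ _ (`|C| * (s * ((3 + 2 * k%:R ^+ 2) * (t + E ^+ 2))))).
  apply: le_trans (ler_wpM2r H4 (ler_norm C)) _; rewrite ler_wpM2l//.
  by apply: le_trans H2 _; rewrite ler_wpM2l.
rewrite mulrCA mulrA mulrA -mulrA [s * _]mulrC !mulrA ler_wpM2r ?addr_ge0//.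
rewrite ltr_pdivlMr// in pe.
have : `|C| * (3 + 2 * k%:R ^+ 2) * s <= c * s by rewrite ler_wpM2r// /c lerDl.
by move: pe; move: (`|C|) => *; nra.
Qed.

End Interface.

(** * Parabolic blow-up and doubling of variables *)

Section BlowUp.
Variables (R : realType) (k d : nat) (T : R).
Local Notation X := (R * 'cV[R]_k)%type.
Local Notation V := 'cV[R]_k.+1.
Implicit Types (z w : X) (v : V) (mu : R) (q : 'cV[R]_k).

(* u is, near z and near the value u z, a viscosity subsolution of
   [- p - tr (sigma sigma^T M) / 2 - F w (u w) q <= 0], and the data are
   (semi)continuous there. *)
Definition local_sub (u : X -> R) z q (sigma : X -> 'M[R]_(k, d))
    (F : X -> R -> 'cV[R]_k -> R) : Prop :=
  [/\ usc_d (domain k T) u,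
      exists r, 0 < r /\ forall w p q' M, domain k T w -> dist z w < r ->
        `|u w - u z| < r -> superjet T u w p q' M ->
        - p - 2^-1 * \tr (sigma w *m (sigma w)^T *m M) - F w (u w) q' <= 0,
      forall e, 0 < e -> exists delta, 0 < delta /\ forall w y q', domain k T w ->
        dist z w < delta -> `|y - u z| < delta -> l1 (q' - q) < delta ->
        F w y q' <= F z (u z) q + e &
      forall e, 0 < e -> exists delta, 0 < delta /\ forall w, domain k T w ->
        dist z w < delta -> forall i j, `|sigma w i j - sigma z i j| < e].

Definition spatial v : 'cV[R]_k := \col_i v (lift ord0 i) 0.

Definition zoom z mu v : X := (z.1 + mu ^+ 2 * v ord0 0, z.2 + mu *: spatial v).

Definition unzoom mu (w : X) : V :=
  \col_i (if unlift ord0 i is Some j then w.2 j 0 / mu else w.1 / mu ^+ 2).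

Definition blowup (u : X -> R) z q mu v : R :=
  (u (zoom z mu v) - u z - mu * dotp q (spatial v)) / mu ^+ 2.

(** Only the time interval is cut, by [0, T]. When z lies at time 0 the box is one-sided in time, in
    agreement with jets taken relative to [0, T]. *)
Definition zlo z mu (K : R) (i : 'I_k.+1) : R :=
  if i == ord0 then Num.max (- K) (- z.1 / mu ^+ 2) else - K.
Definition zhi z mu (K : R) (i : 'I_k.+1) : R :=
  if i == ord0 then Num.min K ((T - z.1) / mu ^+ 2) else K.

Definition lift_cols (A : 'M[R]_(k, d)) (j : 'I_d) : V :=
  \col_i (if unlift ord0 i is Some l then A l j else 0).

Lemma boxP z mu K v : 0 < mu -> box (zlo z mu K) (zhi z mu K) v <->
  (forall i, `|v i 0| <= K) /\ domain k T (zoom z mu v).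
Proof.
move=> mu0; have mu20 : 0 < mu ^+ 2 by rewrite exprn_gt0.
have dE : domain k T (zoom z mu v) <-> (- z.1 / mu ^+ 2 <= v ord0 0 <= (T - z.1) / mu ^+ 2).
  rewrite /domain /= in_itv/= ler_pdivrMr// ler_pdivlMr// [_ * v _ _]mulrC.
  by split => [[/andP[? ?] _]|/andP[? ?]]; [apply/andP; split; lra|split=> //; apply/andP; split; lra].
split => [bv|[vK /dE/andP[d1 d2]] i].
  split.
    move=> i; have := bv i; rewrite /zlo /zhi ler_norml; case: ifP => // _.
    by rewrite ge_max le_min => /andP[/andP[-> _] /andP[-> _]].
  apply/dE; have := bv ord0; rewrite /zlo /zhi eqxx ge_max le_min.
  by move=> /andP[/andP[_ ->] /andP[_ ->]].
have := vK i; rewrite /zlo /zhi ler_norml; case: eqP => [->|_ //].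
by rewrite ge_max le_min => /andP[-> ->]; rewrite d1 d2.
Qed.

Lemma zoomD z mu v v' : zoom z mu (v + v') = zoom (zoom z mu v) mu v'.
Proof.
rewrite /zoom mxE; congr (_, _) => /=; first by ring.
rewrite -addrA -scalerDr; congr (_ + _ *: _).
by apply/matrixP => i j; rewrite !mxE.
Qed.

Lemma unzoomK z mu w : 0 < mu -> zoom z mu (unzoom mu (w.1 - z.1, w.2 - z.2)) = w.
Proof.
move=> mu0; case: w => t x; rewrite /zoom /unzoom mxE unlift_none; congr (_, _) => /=.
  by field; rewrite gt_eqF.
apply/matrixP => i j; rewrite !mxE liftK !mxE (ord1 j).
by field; rewrite gt_eqF.
Qed.

Lemma l1_split v : l1 v = `|v ord0 0| + l1 (spatial v).
Proof.
by rewrite /l1 big_ord_recl; congr (_ + _); apply: eq_bigr => i _; rewrite mxE.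
Qed.

Lemma dist_zoom z mu v : 0 < mu <= 1 -> dist z (zoom z mu v) <= mu * l1 v.
Proof.
move=> /andP[mu0 mu1]; rewrite /dist /zoom/= ![_ + _ - _]addrC !addKr l1Z l1_split mulrDr.
rewrite normrM normrX (gtr0_norm mu0) lerD2r expr2 -mulrA ler_wpM2l ?(ltW mu0)//.
by rewrite ler_piMl.
Qed.

Lemma l1_unzoom mu w : 0 < mu <= 1 -> l1 (unzoom mu w) <= (`|w.1| + l1 w.2) / mu ^+ 2.
Proof.
move=> /andP[mu0 mu1]; have mu20 : 0 < mu ^+ 2 by rewrite exprn_gt0.
rewrite l1_split mulrDl mxE unlift_none normrM normfV normrX (gtr0_norm mu0) lerD2l.
rewrite (_ : spatial _ = mu^-1 *: w.2); last first.
  by apply/matrixP => i j; rewrite !mxE liftK (ord1 j) mulrC.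
rewrite l1Z normfV (gtr0_norm mu0) mulrC ler_wpM2l ?l1_ge0//.
by rewrite lef_pV2 ?posrE// expr2 ler_piMr// ltW.
Qed.

Lemma dotp_le q x : `|dotp q x| <= l1 q * l1 x.
Proof.
rewrite dotpE; apply: le_trans (ler_norm_sum _ _ _) _.
rewrite {1}/l1 mulr_suml; apply: ler_sum => i _; rewrite normrM ler_wpM2l//.
exact: coord_le_l1.
Qed.

Lemma dotpD q x y : dotp q (x + y) = dotp q x + dotp q y.
Proof. by rewrite /dotp mulmxDr mxE. Qed.

Lemma dotpDl q q' x : dotp (q + q') x = dotp q x + dotp q' x.
Proof. by rewrite /dotp linearD mulmxDl mxE. Qed.

Lemma dotpZ q x c : dotp q (c *: x) = c * dotp q x.
Proof. by rewrite /dotp -scalemxAr mxE. Qed.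

Lemma dotpZl q x c : dotp (c *: q) x = c * dotp q x.
Proof. by rewrite /dotp linearZ -scalemxAl mxE. Qed.

Lemma blowupE u z q mu v : 0 < mu ->
  u (zoom z mu v) = u z + mu * dotp q (spatial v) + mu ^+ 2 * blowup u z q mu v.
Proof. by move=> mu0; rewrite /blowup; field; rewrite gt_eqF. Qed.

Lemma spatialD v v' : spatial (v + v') = spatial v + spatial v'.
Proof. by apply/matrixP => i j; rewrite !mxE. Qed.

Lemma blowup_usc u z q mu K : 0 < mu <= 1 -> usc_d (domain k T) u ->
  usc (box (zlo z mu K) (zhi z mu K)) (blowup u z q mu).
Proof.
move=> mu01 Hu v bv e e0; have /andP[mu0 mu1] := mu01.
have mu20 : 0 < mu ^+ 2 by rewrite exprn_gt0.
have [_ Dv] := (boxP z K v mu0).1 bv.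
have e20 : 0 < e * mu ^+ 2 / 2 by rewrite divr_gt0// mulr_gt0.
have [delta [d0 Hd]] := Hu _ Dv _ e20.
pose c := l1 q + 1; have c0 : 0 < c by rewrite ltr_wpDl// l1_ge0.
exists (Num.min delta (e * mu ^+ 2 / 2 / c)); split; first by rewrite lt_min d0 divr_gt0.
move=> v' bv'; rewrite lt_min => /andP[v1 v2].
have [_ Dv'] := (boxP z K v' mu0).1 bv'.
have zE : zoom z mu v' = zoom (zoom z mu v) mu (v' - v) by rewrite -zoomD subrKC.
have l0 := l1_ge0 (v' - v).
have dd : dist (zoom z mu v) (zoom z mu v') < delta.
  rewrite zE; apply: le_lt_trans (dist_zoom _ _ mu01) _.
  by apply: le_lt_trans v1; rewrite ler_piMl.
have := Hd _ Dv' dd; rewrite !(blowupE u z q v) // (blowupE u z q v')//.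
have -> : spatial v' = spatial v + spatial (v' - v).
  by rewrite -spatialD subrKC.
rewrite dotpD.
have : `|mu * dotp q (spatial (v' - v))| < e * mu ^+ 2 / 2.
  rewrite normrM (gtr0_norm mu0); apply: (@le_lt_trans _ _ (c * l1 (v' - v))).
    rewrite -[leRHS]mul1r ler_pM ?(ltW mu0)//; apply: le_trans (dotp_le _ _) _.
    rewrite ler_pM ?l1_ge0//; first by rewrite lerDl.
    by rewrite (l1_split (v' - v)) lerDr.
  by rewrite mulrC -ltr_pdivlMr.
rewrite ltr_norml => /andP[H1 _] H2.
rewrite -(ltr_pM2l mu20) mulrDr [mu ^+ 2 * e]mulrC.
by move: H1 H2; rewrite mulrDr; move: (mu ^+ 2 * _) (mu ^+ 2 * _) (mu * _) (mu * _) (e * _) => *; lra.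
Qed.

Definition spatial_sym (H : 'I_k.+1 -> 'I_k.+1 -> R) : 'M[R]_k :=
  \matrix_(i, l) (2^-1 * (H (lift ord0 i) (lift ord0 l) + H (lift ord0 l) (lift ord0 i))).

Lemma spatial_symT H : (spatial_sym H)^T = spatial_sym H.
Proof. by apply/matrixP => i l; rewrite !mxE addrC. Qed.

Definition qsum H (x : 'cV[R]_k) : R :=
  \sum_i \sum_l x i 0 * x l 0 * H (lift ord0 i) (lift ord0 l).

Lemma qsum_dotp H x : dotp x (spatial_sym H *m x) = qsum H x.
Proof.
rewrite dotpE /qsum.
under eq_bigr => i _ do rewrite mxE mulr_sumr.
transitivity (2^-1 * ((\sum_i \sum_l x i 0 * x l 0 * H (lift ord0 i) (lift ord0 l)) +
   \sum_i \sum_l x l 0 * x i 0 * H (lift ord0 l) (lift ord0 i))).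
  rewrite -big_split/= mulr_sumr; apply: eq_bigr => i _.
  rewrite -big_split/= mulr_sumr; apply: eq_bigr => l _.
  by rewrite mxE; ring.
rewrite [X in _ + X]exchange_big/=; set A := \sum_i _.
by rewrite -mulr2n -[A *+ 2]mulr_natl mulrA mulVf ?mul1r// pnatr_eq0.
Qed.

Lemma tr_qsum (A : 'M[R]_(k, d)) H :
  \tr (A *m A^T *m spatial_sym H) = \sum_j qsum H (col j A).
Proof.
rewrite -mulmxA mxtrace_mulC -mulmxA /mxtrace.
apply: eq_bigr => j _; rewrite -qsum_dotp /dotp tr_col.
rewrite !mxE; apply: eq_bigr => i _; rewrite !mxE; congr (_ * _).
by apply: eq_bigr => l _; rewrite !mxE.
Qed.

Lemma quad_split H v : quad H v = v ord0 0 * (v ord0 0 * H ord0 ord0 +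
    \sum_l v (lift ord0 l) 0 * (H ord0 (lift ord0 l) + H (lift ord0 l) ord0)) +
  qsum H (spatial v).
Proof.
rewrite /quad big_ord_recl big_ord_recl.
rewrite [X in _ + X](eq_bigr (fun i => v (lift ord0 i) 0 * (v ord0 0 * H (lift ord0 i) ord0) +
  \sum_l spatial v i 0 * spatial v l 0 * H (lift ord0 i) (lift ord0 l))); last first.
  move=> i _; rewrite big_ord_recl mulrDr; congr (_ + _).
  by rewrite mulr_sumr; apply: eq_bigr => l _; rewrite !mxE mulrA.
rewrite big_split/= -/(qsum H (spatial v)) addrA; congr (_ + _).
rewrite -[in RHS]addrC !mulrDr -addrA [in RHS]addrC; congr (_ + _).
rewrite !mulr_sumr -big_split/=; apply: eq_bigr => i _; ring.
Qed.

Lemma quad_lift_cols H (A : 'M[R]_(k, d)) j : quad H (lift_cols A j) = qsum H (col j A).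
Proof.
rewrite quad_split mxE unlift_none mul0r add0r; congr (qsum H _).
by apply/matrixP => i l; rewrite !mxE liftK.
Qed.

End BlowUp.

Section Frozen.
Variables (R : realType) (k d : nat) (T : R).
Local Notation X := (R * 'cV[R]_k)%type.
Local Notation V := 'cV[R]_k.+1.
Implicit Types (z w : X) (v : V) (mu : R) (q : 'cV[R]_k).

(** Undoing the scaling turns the slope a into the time derivative a_0 and the gradient q + mu a',
    and keeps the spatial Hessian. The entries of H that involve time do not belong to a parabolic
    jet; they go into the error |dt| dist. *)
Lemma touched_superjet u z q mu K v a H : 0 < mu <= 1 ->
  box (zlo z mu K) (zhi T z mu K) v -> (forall i, `|v i 0| < K) ->
  touched (box (zlo z mu K) (zhi T z mu K)) (blowup u z q mu) v a H ->
  superjet T u (zoom z mu v) (a ord0) (q + mu *: (\col_i a (lift ord0 i))) (spatial_sym H).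
Proof.
move=> mu01 bv vK [C [delta [d0 HC]]]; have /andP[mu0 mu1] := mu01.
have mu20 : 0 < mu ^+ 2 by rewrite exprn_gt0.
(* The margin of v to the faces of the cube ensures that all points of the domain near [zoom z mu v]
   come from points of the box. *)
have [eps [eps0 Heps]] : exists eps, 0 < eps /\ forall i, `|v i 0| + eps <= K.
  case: (@Order.TotalTheory.arg_maxP _ _ _ ord0 xpredT (fun i => `|v i 0|) isT) => i0 _ Hi0.
  exists (K - `|v i0 0|); split; first by rewrite subr_gt0.
  by move=> i; have := Hi0 i isT; rewrite /= => H1; lra.
set w := zoom z mu v.
pose C1 := \sum_i \sum_j `|H i j|.
have HC1 i j : `|H i j| <= C1.
  rewrite /C1 (bigD1 i)//= (bigD1 j)//= -addrA lerDl addr_ge0// sumr_ge0// => *.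
  by apply: sumr_ge0.
have C10 : 0 <= C1 := le_trans (normr_ge0 _) (HC1 ord0 ord0).
apply: (@superjet_intro R k T u w _ _ _ (C1 / mu ^+ 2 + `|C| * mu ^+ 2 / mu ^+ 2 ^+ 3)
  (Num.min delta eps * mu ^+ 2)); first exact: spatial_symT.
  by rewrite mulr_gt0// lt_min d0.
move=> w' Dw'; rewrite -ltr_pdivrMr// lt_min => /andP[wd we].
pose dv := unzoom mu (w'.1 - w.1, w'.2 - w.2).
have ldv : l1 dv <= dist w w' / mu ^+ 2 by exact: l1_unzoom.
have zE : zoom z mu (v + dv) = w' by rewrite zoomD unzoomK.
have bv' : box (zlo z mu K) (zhi T z mu K) (v + dv).
  apply/(boxP T z K _ mu0); split; last by rewrite zE.
  move=> i; rewrite mxE; apply: le_trans (ler_normD _ _) _.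
  apply: le_trans (Heps i); rewrite lerD2l; apply: le_trans (coord_le_l1 _ _) _.
  exact: le_trans ldv (ltW we).
have := HC dv bv' (le_lt_trans ldv wd).
rewrite -(ler_pM2l mu20) => Hu.
have uE' := blowupE u z q (v + dv) mu0; rewrite zE in uE'.
have uE := blowupE u z q v mu0; rewrite -/w in uE.
have t0 : dv ord0 0 = (w'.1 - w.1) / mu ^+ 2 by rewrite mxE unlift_none.
have t1 : w'.1 - w.1 = mu ^+ 2 * dv ord0 0 by rewrite t0; field; rewrite gt_eqF.
have x1 : w'.2 - w.2 = mu *: spatial dv.
  by apply/matrixP => i j; rewrite !mxE liftK (ord1 j) !mxE; field; rewrite gt_eqF.
rewrite /jet_poly t1 x1 dotpDl -scalemxAr !dotpZ !dotpZl qsum_dotp.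
have linE : lin a dv = dv ord0 0 * a ord0 + dotp (\col_i a (lift ord0 i)) (spatial dv).
  rewrite /lin big_ord_recl dotpE; congr (_ + _).
  by apply: eq_bigr => i _; rewrite [X in _ = X * _]mxE [X in _ = _ * X]mxE mulrC.
rewrite uE' spatialD dotpD.
have cross : mu ^+ 2 * (2^-1 * (dv ord0 0 * (dv ord0 0 * H ord0 ord0 +
    \sum_l dv (lift ord0 l) 0 * (H ord0 (lift ord0 l) + H (lift ord0 l) ord0)))) <=
    C1 / mu ^+ 2 * (`|mu ^+ 2 * dv ord0 0| * dist w w').
  apply: le_trans (ler_norm _) _; rewrite (normrM (mu ^+ 2)) (normrM 2^-1).
  rewrite (normrM (dv ord0 0)) (normrM (mu ^+ 2)) (gtr0_norm mu20).
  rewrite (@ger0_norm _ 2^-1) ?invr_ge0//.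
  set A := `|_ + _|.
  have HA : A <= 2 * C1 * l1 dv.
    apply: le_trans (ler_normD _ _) _; rewrite l1_split mulrDr lerD//.
      rewrite normrM mulrC ler_wpM2r//; apply: le_trans (HC1 _ _) _.
      by rewrite ler_peMl// ler1n.
    apply: le_trans (ler_norm_sum _ _ _) _; rewrite /l1 mulr_sumr; apply: ler_sum => i _.
    rewrite normrM [spatial dv _ _]mxE [leLHS]mulrC ler_wpM2r//; apply: le_trans (ler_normD _ _) _.
    by have := HC1 ord0 (lift ord0 i); have := HC1 (lift ord0 i) ord0; lra.
  have HA' : 2^-1 * A <= C1 / mu ^+ 2 * dist w w'.
    have := ler_wpM2l C10 ldv; rewrite mulrA mulrAC; lra.
  rewrite [leLHS](_ : _ = mu ^+ 2 * `|dv ord0 0| * (2^-1 * A)); last by ring.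
  rewrite [leRHS](_ : _ = mu ^+ 2 * `|dv ord0 0| * (C1 / mu ^+ 2 * dist w w')); last by ring.
  by rewrite ler_wpM2l// mulr_ge0// ltW.
have cubic : mu ^+ 2 * (C * l1 dv ^+ 3) <= `|C| * mu ^+ 2 / mu ^+ 2 ^+ 3 * dist w w' ^+ 3.
  rewrite [leRHS](_ : _ = mu ^+ 2 * (`|C| * (dist w w' / mu ^+ 2) ^+ 3)); last by rewrite expr_div_n; ring.
  rewrite ler_wpM2l ?(ltW mu20)//; apply: le_trans (ler_wpM2r _ (ler_norm C)) _.
    by rewrite exprn_ge0// l1_ge0.
  by rewrite ler_wpM2l// lerXn2r ?nnegrE ?l1_ge0// divr_ge0 ?dist_ge0// ltW.
have g1 : 0 <= C1 / mu ^+ 2 * dist w w' ^+ 3.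
  by rewrite mulr_ge0 ?divr_ge0 ?exprn_ge0 ?dist_ge0 ?(ltW mu0).
have g2 : 0 <= `|C| * mu ^+ 2 / mu ^+ 2 ^+ 3 * (`|mu ^+ 2 * dv ord0 0| * dist w w').
  apply: mulr_ge0; last by apply: mulr_ge0; rewrite ?dist_ge0.
  apply: mulr_ge0; first by apply: mulr_ge0 => //; exact: ltW.
  by rewrite invr_ge0 exprn_ge0// ltW.
move: Hu cross cubic g1 g2; rewrite uE quad_split linE.
move: (C1 / mu ^+ 2) (`|C| * mu ^+ 2 / mu ^+ 2 ^+ 3) (`|mu ^+ 2 * dv ord0 0|) => k1 k2 t.
move: (\sum_l _) (dotp (\col_i _) _) (qsum _ _) (l1 dv) (dist _ _) => s1 s2 s3 s4 s5.
move: (blowup _ _ _ _ _) (blowup _ _ _ _ _) (dotp q _) (dotp q _) (u z) => b1 b2 d1 d2 uz.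
move: (dv ord0 0) (a ord0) (H ord0 ord0) => x1' x2' x3'.
move=> Hu cross cubic g1 g2; lra.
Qed.

End Frozen.

Section Doubling.
Variables (R : realType) (k d : nat) (T : R).
Local Notation X := (R * 'cV[R]_k)%type.
Local Notation V := 'cV[R]_k.+1.
Implicit Types (z w : X) (v : V) (mu : R) (q : 'cV[R]_k).

Lemma qsum_close (H : 'I_k.+1 -> 'I_k.+1 -> R) (x y : 'cV[R]_k) (C B e : R) :
  (forall i l, `|H i l| <= C) -> (forall i, `|y i 0| <= B) -> e <= 1 ->
  (forall i, `|x i 0 - y i 0| <= e) ->
  `|qsum H x - qsum H y| <= k%:R * k%:R * (C * (2 * B + 1) * e).
Proof.
move=> HC yB e1 xy; rewrite /qsum -sumrB.
have C0 : 0 <= C := le_trans (normr_ge0 _) (HC ord0 ord0).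
have sumk (F : 'I_k -> R) c : (forall i, `|F i| <= c) -> `|\sum_i F i| <= k%:R * c.
  move=> Fc; apply: le_trans (ler_norm_sum _ _ _) _.
  rewrite mulr_natl -[X in _ *+ X]card_ord -sumr_const.
  by apply: ler_sum => i _.
rewrite -mulrA; apply: (sumk) => i; rewrite -sumrB; apply: sumk => l.
rewrite -mulrBl normrM -mulrA mulrC ler_pM//.
have e0 : 0 <= e := le_trans (normr_ge0 _) (xy i).
have B0 : 0 <= B := le_trans (normr_ge0 _) (yB i).
have := xy i; have := xy l; have := yB l; have := yB i.
move: (x i 0) (x l 0) (y i 0) (y l 0) => a b a' b' a'B b'B bb aa.
have -> : a * b - a' * b' = (a - a') * (b - b') + a' * (b - b') + (a - a') * b' by ring.
have -> : (2 * B + 1) * e = 1 * e + B * e + e * B by ring.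
apply: le_trans (ler_normD _ _) _; rewrite lerD//; last by rewrite normrM ler_pM.
apply: le_trans (ler_normD _ _) _; rewrite lerD// normrM ler_pM//.
exact: le_trans e1.
Qed.

(** The bounds K and C1 in [frozen_sub] confine the point, the value and the gradient, once the
    blow-up is undone, to a neighbourhood of (z, u z, q) of size O(mu), where the viscosity
    inequality and the moduli of F and sigma apply. *)
Lemma blowup_frozen u z q (sigma : X -> 'M[R]_(k, d)) F K C1 eta :
  local_sub T u z q sigma F -> 0 < K -> 0 < eta ->
  exists mu0, 0 < mu0 <= 1 /\ forall mu, 0 < mu < mu0 ->
    frozen_sub (box (zlo z mu K) (zhi T z mu K)) (blowup u z q mu)
      (lift_cols (sigma z)) K C1 (F z (u z) q + eta).
Proof.
move=> [_ [r [r0 Hr]] HF Hs] K0 eta0.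
have eta20 : 0 < eta / 2 by rewrite divr_gt0.
have [dF [dF0 HF']] := HF _ eta20.
pose B : R := \sum_i \sum_j `|sigma z i j|.
have sB i j : `|sigma z i j| <= B.
  rewrite /B (bigD1 i)//= (bigD1 j)//= -addrA lerDl addr_ge0// sumr_ge0// => *.
  by apply: sumr_ge0.
have B0 : 0 <= B by apply: sumr_ge0 => i _; apply: sumr_ge0.
pose M : R := d%:R * (k%:R * k%:R * (`|C1| * (2 * B + 1))) + 1.
have M0' : 0 <= d%:R * (k%:R * k%:R * (`|C1| * (2 * B + 1))).
  by apply: mulr_ge0 => //; apply: mulr_ge0; apply: mulr_ge0 => //; rewrite addr_ge0// mulr_ge0.
have M0 : 0 < M by rewrite ltr_wpDl.
pose e1 := Num.min 1 (eta / M).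
have e10 : 0 < e1 by rewrite lt_min ltr01 divr_gt0.
have [ds [ds0 Hs']] := Hs _ e10.
pose dm := Num.min r (Num.min dF ds).
have dm0 : 0 < dm by rewrite !lt_min r0 dF0 ds0.
pose Y : R := k.+1%:R * K * (1 + l1 q) + `|C1| * k.+1%:R + 1.
have Y0 : 0 < Y.
  rewrite ltr_wpDl// addr_ge0// mulr_ge0//; first by rewrite mulr_ge0// ltW.
  by rewrite addr_ge0// l1_ge0.
exists (Num.min 1 (dm / Y)); split; first by rewrite lt_min ltr01 divr_gt0//= ge_min lexx.
move=> mu /andP[mu0]; rewrite lt_min => /andP[mu1 muY].
have mu01 : 0 < mu <= 1 by rewrite mu0 ltW.
rewrite ltr_pdivlMr// in muY.
have small x : x <= mu * Y -> [/\ x < r, x < dF & x < ds].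
  move=> xY; have : x < dm by exact: le_lt_trans xY muY.
  by rewrite !lt_min => /and3P[].
move=> v a H bv vK aC HC UC tch.
have [vK' Dw] := (boxP T z K v mu0).1 bv; set w := zoom z mu v in Dw.
have C0 : 0 <= C1 := le_trans (normr_ge0 _) UC.
have lv : l1 v <= k.+1%:R * K by apply: l1_le.
have p1 : 0 <= k.+1%:R * K * l1 q by rewrite !mulr_ge0// ?l1_ge0// ltW.
have p2 : 0 <= `|C1| * k.+1%:R by rewrite mulr_ge0.
have p3 : 0 <= k.+1%:R * K by rewrite mulr_ge0// ltW.
have cC : C1 <= `|C1| * k.+1%:R by rewrite (ger0_norm C0) ler_peMr// ler1n.
have [w1 w2 w3] : [/\ dist z w < r, dist z w < dF & dist z w < ds].
  apply: small; apply: le_trans (dist_zoom _ _ mu01) _; rewrite ler_wpM2l ?(ltW mu0)//.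
  by rewrite /Y; lra.
have [u1 u2 _] : [/\ `|u w - u z| < r, `|u w - u z| < dF & `|u w - u z| < ds].
  apply: small.
  rewrite (_ : u w - u z = mu * dotp q (spatial v) + mu ^+ 2 * blowup u z q mu v); last first.
    by rewrite /w (blowupE u z q v mu0); ring.
  apply: le_trans (ler_normD _ _) _; rewrite /Y 2!mulrDr -addrA lerD//.
    rewrite normrM (gtr0_norm mu0) ler_wpM2l ?(ltW mu0)//.
    apply: le_trans (dotp_le _ _) _.
    have : l1 q * l1 (spatial v) <= l1 q * (k.+1%:R * K).
      by rewrite ler_wpM2l ?l1_ge0// (le_trans _ lv)// l1_split lerDr.
    by lra.
  rewrite normrM (gtr0_norm (exprn_gt0 _ mu0)) expr2 -mulrA mulr1.
  have : mu * (mu * `|blowup u z q mu v|) <= mu * (`|C1| * k.+1%:R).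
    rewrite ler_wpM2l ?(ltW mu0)//; apply: le_trans cC.
    by apply: le_trans UC; rewrite ler_piMl// ltW.
  by lra.
set q' := q + mu *: (\col_i a (lift ord0 i)).
have [_ q2 _] : [/\ l1 (q' - q) < r, l1 (q' - q) < dF & l1 (q' - q) < ds].
  apply: small; rewrite /q' addrAC subrr add0r l1Z (gtr0_norm mu0) ler_wpM2l ?(ltW mu0)//.
  apply: (@le_trans _ _ (k%:R * `|C1|)).
    by apply: l1_le => i; rewrite mxE (ger0_norm C0).
  have kE : `|C1| * k.+1%:R = k%:R * `|C1| + `|C1| by rewrite -natr1; ring.
  have := normr_ge0 C1; rewrite /Y kE; move: p1 p3; rewrite mulrDr mulr1.
  by move: (_ * K) (_ * K * _) (`|C1|) (k%:R * _) => *; lra.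
have sj := touched_superjet mu01 bv vK tch.
have := Hr w _ _ _ Dw w1 u1 sj; rewrite tr_qsum.
have := HF' w (u w) q' Dw w2 u2 q2.
rewrite /gen.
have -> : \sum_j quad H (lift_cols (sigma z) j) = \sum_j qsum H (col j (sigma z)).
  by apply: eq_bigr => j _; exact: quad_lift_cols.
have : `|\sum_j qsum H (col j (sigma w)) - \sum_j qsum H (col j (sigma z))| <= eta.
  apply: (@le_trans _ _ (d%:R * (k%:R * k%:R * (`|C1| * (2 * B + 1) * e1)))).
    rewrite -sumrB; apply: le_trans (ler_norm_sum _ _ _) _.
    rewrite mulr_natl -[X in _ *+ X]card_ord -sumr_const.
    apply: ler_sum => j _; apply: qsum_close => //.
    - by rewrite (ger0_norm C0).
    - by move=> i; rewrite mxE.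
    - by rewrite /e1 ge_min lexx.
    - by move=> i; rewrite !mxE ltW//; exact: Hs'.
  have eM : e1 * M <= eta by rewrite -ler_pdivlMr// /e1 ge_min lexx orbT.
  apply: le_trans eM.
  rewrite [leLHS](_ : _ = e1 * (d%:R * (k%:R * k%:R * (`|C1| * (2 * B + 1))))); last by ring.
  by rewrite ler_wpM2l ?(ltW e10)// /M lerDl.
rewrite ler_norml => /andP[_].
rewrite -/q'; move: (\sum_j _) (\sum_j _) (F w _ _) (F z _ _) => *; lra.
Qed.

Lemma ssq_lift_cols (A : 'M[R]_(k, d)) j : ssq (lift_cols A j) = \sum_i A i j ^+ 2.
Proof. by apply: eq_bigr => i _; rewrite mxE liftK. Qed.

Lemma sqn_lift_cols (A B : 'M[R]_(k, d)) j :
  sqn (lift_cols A j - lift_cols B j) = \sum_i (A - B) i j ^+ 2.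
Proof.
rewrite /sqn big_ord_recl !mxE unlift_none subrr expr0n add0r.
by apply: eq_bigr => i _; rewrite !mxE liftK.
Qed.

Lemma coupled_trace_lift al b1 b2 (A B : 'M[R]_(k, d)) :
  coupled_trace al b1 b2 (lift_cols A) (lift_cols B) =
  al * enorm (A - B) ^+ 2 + b1 * enorm A ^+ 2 + b2 * enorm B ^+ 2.
Proof.
rewrite !enormE [\sum_i \sum_j (A - B) i j ^+ 2]exchange_big.
rewrite [\sum_i \sum_j A i j ^+ 2]exchange_big [\sum_i \sum_j B i j ^+ 2]exchange_big/=.
rewrite !mulr_sumr -!big_split/=; apply: eq_bigr => j _.
by rewrite sqn_lift_cols !ssq_lift_cols.
Qed.

Lemma enorm2_col (x : 'cV[R]_k) : enorm x ^+ 2 = \sum_i x i 0 ^+ 2.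
Proof. by rewrite enormE; apply: eq_bigr => i _; rewrite big_ord1. Qed.

Lemma enorm2Z c (x : 'cV[R]_k) : enorm (c *: x) ^+ 2 = c ^+ 2 * enorm x ^+ 2.
Proof. by rewrite !enorm2_col mulr_sumr; apply: eq_bigr => i _; rewrite mxE exprMn. Qed.

(* [mu] is taken so small that the quadratic terms in time cost less than eta. *)
Lemma blowup_coupling u1 u2 z1 z2 q1 q2 mu K (p1 p2 al b1 b2 K0 r eta : R) v v' :
0 < mu <= 1 -> 0 < K -> 0 <= al -> 0 <= K0 ->
mu * (k.+1%:R * K) < r -> mu * (2 * K0 * K ^+ 2) <= eta ->
(forall w1 w2, domain k T w1 -> domain k T w2 -> dist z1 w1 < r -> dist z2 w2 < r ->
  u1 w1 + u2 w2 <= u1 z1 + u2 z2 + p1 * (w1.1 - z1.1) + p2 * (w2.1 - z2.1)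
    + dotp q1 (w1.2 - z1.2) + dotp q2 (w2.2 - z2.2)
    + al * enorm ((w1.2 - z1.2) - (w2.2 - z2.2)) ^+ 2
    + b1 * enorm (w1.2 - z1.2) ^+ 2 + b2 * enorm (w2.2 - z2.2) ^+ 2
    + K0 * ((w1.1 - z1.1) ^+ 2 + (w2.1 - z2.1) ^+ 2)) ->
box (zlo z1 mu K) (zhi T z1 mu K) v -> box (zlo z2 mu K) (zhi T z2 mu K) v' ->
blowup u1 z1 q1 mu v + blowup u2 z2 q2 mu v' <= coupling p1 p2 al b1 b2 v v' + eta.
Proof.
move=> mu01 K0' al0 K00 mr me H; have /andP[mu0 mu1] := mu01.
have mu20 : 0 < mu ^+ 2 by rewrite exprn_gt0.
have K2 : 0 <= 2 * K0 * K ^+ 2 by apply: mulr_ge0; [exact: mulr_ge0|exact: sqr_ge0].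
move=> /(boxP T z1 K v mu0)[vK Dv] /(boxP T z2 K v' mu0)[vK' Dv'].
have near z (y : V) : (forall i, `|y i 0| <= K) -> dist z (zoom z mu y) < r.
  move=> yK; apply: le_lt_trans (dist_zoom _ _ mu01) _; apply: le_lt_trans mr.
  by rewrite ler_wpM2l ?(ltW mu0)// l1_le.
have := H _ _ Dv Dv' (near z1 v vK) (near z2 v' vK').
rewrite (blowupE u1 z1 q1 v mu0) (blowupE u2 z2 q2 v' mu0) /zoom/=.
have E1 (t s : R) : t + s - t = s by rewrite addrC addKr.
have E2 (x y : 'cV[R]_k) : x + y - x = y by rewrite addrC addKr.
rewrite !E1 !E2 !dotpZ -scalerBr !enorm2Z.
have sq (y : V) : enorm (spatial y) ^+ 2 = ssq y.
  by rewrite enorm2_col; apply: eq_bigr => i _; rewrite mxE.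
have sq' : enorm (spatial v - spatial v') ^+ 2 <= sqn (v - v').
  rewrite enorm2_col /sqn [leRHS]big_ord_recl ler_wpDl ?sqr_ge0//.
  by apply: ler_sum => i _; rewrite !mxE.
have := ler_wpM2l al0 sq'; rewrite !sq /coupling.
have tK (y : V) : (forall i, `|y i 0| <= K) -> y ord0 0 ^+ 2 <= K ^+ 2.
  by move=> yK; rewrite -real_normK ?num_real// lerXn2r ?nnegrE// ltW.
have e1 : K0 * (mu ^+ 2 * v ord0 0 ^+ 2 + mu ^+ 2 * v' ord0 0 ^+ 2) <= eta.
  have : K0 * (mu ^+ 2 * v ord0 0 ^+ 2 + mu ^+ 2 * v' ord0 0 ^+ 2) <=
      mu ^+ 2 * (2 * K0 * K ^+ 2).
    rewrite -mulrDr mulrCA ler_wpM2l ?(ltW mu20)//.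
    rewrite [2 * K0]mulrC -mulrA ler_wpM2l// mulr_natl mulr2n lerD// tK//.
  have : mu ^+ 2 * (2 * K0 * K ^+ 2) <= mu * (2 * K0 * K ^+ 2).
    by rewrite ler_wpM2r// expr2 ler_piMl// ltW.
  by move=> B1 B2; exact: le_trans B2 (le_trans B1 me).
move=> A1 A2; rewrite -(ler_pM2l mu20).
have := ler_wpM2l (ltW mu20) A1; have := ler_wpM2l (ltW mu20) e1.
move: A2; rewrite !exprMn.
move: (enorm _ ^+ 2) (sqn _) (ssq v) (ssq v') (dotp _ _) (dotp _ _) (u1 z1) (u2 z2).
move: (blowup _ _ _ _ _) (blowup _ _ _ _ _) (v ord0 0) (v' ord0 0) => *; lra.
Qed.

Lemma spatial0 : spatial (0 : V) = 0.
Proof. by apply/matrixP => i j; rewrite !mxE. Qed.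

Lemma zoom0 z mu : zoom z mu 0 = z.
Proof. by case: z => t x; rewrite /zoom spatial0 mxE mulr0 scaler0 !addr0. Qed.

(** The outcome is the sum of the two viscosity inequalities, with the second-order terms already
    tested against the columns of the diffusion matrices. K0 is arbitrary and absent from the
    conclusion, which leaves the freedom to penalize time as strongly as desired. *)
Lemma doubling u1 u2 z1 z2 q1 q2 (sigma1 sigma2 : X -> 'M[R]_(k, d)) F1 F2
    (p1 p2 al b1 b2 K0 r : R) :
  domain k T z1 -> domain k T z2 ->
  local_sub T u1 z1 q1 sigma1 F1 -> local_sub T u2 z2 q2 sigma2 F2 ->
  0 <= al -> 0 <= b1 -> 0 <= b2 -> 0 <= K0 -> 0 < r ->
  (forall w1 w2, domain k T w1 -> domain k T w2 -> dist z1 w1 < r -> dist z2 w2 < r ->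
    u1 w1 + u2 w2 <= u1 z1 + u2 z2 + p1 * (w1.1 - z1.1) + p2 * (w2.1 - z2.1)
      + dotp q1 (w1.2 - z1.2) + dotp q2 (w2.2 - z2.2)
      + al * enorm ((w1.2 - z1.2) - (w2.2 - z2.2)) ^+ 2
      + b1 * enorm (w1.2 - z1.2) ^+ 2 + b2 * enorm (w2.2 - z2.2) ^+ 2
      + K0 * ((w1.1 - z1.1) ^+ 2 + (w2.1 - z2.1) ^+ 2)) ->
  0 <= p1 + p2 + (al * enorm (sigma1 z1 - sigma2 z2) ^+ 2 + b1 * enorm (sigma1 z1) ^+ 2
    + b2 * enorm (sigma2 z2) ^+ 2) + F1 z1 (u1 z1) q1 + F2 z2 (u2 z2) q2.
Proof.
move=> Dz1 Dz2 L1 L2 al0 b10 b20 K00 r0 H; rewrite -coupled_trace_lift.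
set S1 := lift_cols _; set S2 := lift_cols _; set k1 := F1 _ _ _; set k2 := F2 _ _ _.
rewrite leNgt; apply/negP; set Y := _ + k2 => Y0.
(* Then 13 eta is at most half of - Y. K and C1 depend on eta, and mu is chosen last. *)
pose eta := Num.min 1 (- Y / 26).
have eta0 : 0 < eta by rewrite lt_min ltr01 divr_gt0// oppr_gt0.
have eta1 : eta <= 1 by rewrite /eta ge_min lexx.
have etaY : eta <= - Y / 26 by rewrite /eta ge_min lexx orbT.
have [|K [C1 [K0' HK]]] := @scaled_estimate R k d S1 S2 p1 p2 al b1 b2 k1 k2 eta al0 b10 b20.
  by rewrite eta0.
have [m1 [/andP[m10 m11] Hm1]] := blowup_frozen C1 L1 K0' eta0.
have [m2 [/andP[m20 _] Hm2]] := blowup_frozen C1 L2 K0' eta0.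
have cK0 : 0 < k.+1%:R * K by rewrite mulr_gt0.
pose c2 := 2 * K0 * K ^+ 2 + 1.
have K2 : 0 <= 2 * K0 * K ^+ 2 by apply: mulr_ge0; [exact: mulr_ge0|exact: sqr_ge0].
have c20 : 0 < c2 by rewrite ltr_wpDl.
pose m := Num.min (Num.min m1 m2) (Num.min (r / (k.+1%:R * K)) (eta / c2)).
have m0 : 0 < m by rewrite !lt_min m10 m20 !divr_gt0.
pose mu := m / 2; have mu0 : 0 < mu by rewrite divr_gt0.
have mum : mu < m by rewrite ltr_pdivrMr// mulr_natr mulr2n ltrDr.
move: (mum); rewrite {1}/m !lt_min => /andP[/andP[mm1 mm2] /andP[mr me]].
have mu1 : mu <= 1 by apply: le_trans (ltW mm1) m11.
have mu01 : 0 < mu <= 1 by rewrite mu0.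
have mu20 : 0 < mu ^+ 2 by rewrite exprn_gt0.
rewrite ltr_pdivlMr// in mr; rewrite ltr_pdivlMr// in me.
have b0 z : domain k T z -> box (zlo z mu K) (zhi T z mu K) 0.
  move=> Dz; apply/(boxP T z K _ mu0); split; first by move=> i; rewrite mxE normr0 ltW.
  by rewrite zoom0.
have bl0 u z q : blowup u z q mu 0 = 0.
  by rewrite /blowup zoom0 spatial0 /dotp mulmx0 mxE mulr0 subr0 subrr mul0r.
have me' : mu * (2 * K0 * K ^+ 2) <= eta.
  by apply: le_trans (ltW me); rewrite ler_wpM2l ?(ltW mu0)// /c2 lerDl.
have us1 : usc_d (domain k T) u1 by case: L1.
have us2 : usc_d (domain k T) u2 by case: L2.
have := HK (box (zlo z1 mu K) (zhi T z1 mu K)) (box (zlo z2 mu K) (zhi T z2 mu K))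
  (blowup u1 z1 q1 mu) (blowup u2 z2 q2 mu) (b0 _ Dz1) (b0 _ Dz2) (bl0 _ _ _) (bl0 _ _ _).
move=> /(_ (fun (y : V) by' => ((boxP T z1 K y mu0).1 by').1)).
move=> /(_ (fun (y : V) by' => ((boxP T z2 K y mu0).1 by').1)).
move=> /(_ (usc_attains (b0 _ Dz1) (@blowup_usc R k T u1 z1 q1 mu K mu01 us1))).
move=> /(_ (usc_attains (b0 _ Dz2) (@blowup_usc R k T u2 z2 q2 mu K mu01 us2))).
have H12 v v' := @blowup_coupling u1 u2 z1 z2 q1 q2 mu K p1 p2 al b1 b2 K0 r eta v v'
  mu01 K0' al0 K00 mr me' H.
move=> /(_ H12 (Hm1 _ _) (Hm2 _ _)); rewrite mu0 mm1 mm2 => /(_ isT isT).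
rewrite -/Y => H13; clearbody eta Y; clear -etaY H13 Y0; lra.
Qed.

End Doubling.

Lemma covered_image (R : realType) (P Q : Type) (dP : P -> P -> R) (dQ : Q -> Q -> R)
    (D : P -> Prop) (E : Q -> Prop) (phi : P -> Q) :
  (forall p, D p -> E (phi p)) ->
  (forall q, E q -> exists p, D p /\ phi p = q) ->
  (forall p p', dQ (phi p) (phi p') <= dP p p') ->
  covered dP D -> covered dQ E.
Proof.
move=> phiE phis phid cD A HA.
have [p Dp|N0 HN0] := cD (fun N p => A N (phi p)).
  have [delta [N0 [d0 H]]] := HA _ (phiE p Dp).
  exists delta, N0; split => // N p' NN Dp' pp'; apply: H => //; first exact: phiE.
  exact: le_lt_trans (phid _ _) pp'.
exists N0 => N q NN Eq; have [p [Dp <-]] := phis q Eq; exact: HN0.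
Qed.

(** * Euclidean and Frobenius norms *)

Section EuclideanNorm.
Variable R : realType.

Lemma cauchy_schwarz (I : finType) (a b : I -> R) :
  (\sum_i a i * b i) ^+ 2 <= (\sum_i a i ^+ 2) * (\sum_i b i ^+ 2).
Proof.
set A := \sum_i a i ^+ 2; set B := \sum_i b i ^+ 2; set C := \sum_i a i * b i.
have : 0 <= \sum_i (B * a i - C * b i) ^+ 2 by apply: sumr_ge0 => i _; exact: sqr_ge0.
have -> : \sum_i (B * a i - C * b i) ^+ 2 = B * (A * B - C ^+ 2).
  rewrite (eq_bigr (fun i => B ^+ 2 * a i ^+ 2 + (- (2 * B * C)) * (a i * b i) + C ^+ 2 * b i ^+ 2)).
    by rewrite !big_split/= -!mulr_sumr -/A -/B -/C; ring.
  by move=> i _; ring.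
have B0 : 0 <= B by apply: sumr_ge0 => i _; exact: sqr_ge0.
case: (eqVneq B 0) => [B00 _|nB]; last first.
  by rewrite pmulr_rge0 ?subr_ge0// lt_neqAle eq_sym nB.
have b0 i : b i = 0.
  apply/eqP; rewrite -sqrf_eq0; move/eqP: B00; rewrite psumr_eq0 => [/allP/(_ i)|].
    by rewrite mem_index_enum => /(_ isT).
  by move=> j _; exact: sqr_ge0.
by rewrite /C big1 ?expr0n ?B00 ?mulr0// => i _; rewrite b0 mulr0.
Qed.

Lemma enorm_pair p q (A : 'M[R]_(p, q)) : enorm A ^+ 2 = \sum_ij A ij.1 ij.2 ^+ 2.
Proof. by rewrite enormE pair_big. Qed.

Lemma enormD p q (A B : 'M[R]_(p, q)) : enorm (A + B) <= enorm A + enorm B.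
Proof.
rewrite -(@ler_pXn2r _ 2)// ?nnegrE ?addr_ge0 ?enorm_ge0// sqrrD.
have -> : enorm (A + B) ^+ 2 = enorm A ^+ 2 + 2 * (\sum_ij A ij.1 ij.2 * B ij.1 ij.2) + enorm B ^+ 2.
  rewrite !enorm_pair mulr_sumr -!big_split/=; apply: eq_bigr => ij _.
  by rewrite mxE; ring.
rewrite lerD2r lerD2l -[leRHS]mulr_natl ler_wpM2l//; apply: le_trans (ler_norm _) _.
rewrite -(@ler_pXn2r _ 2)// ?nnegrE ?mulr_ge0 ?enorm_ge0// real_normK ?num_real// exprMn.
by rewrite !enorm_pair; exact: cauchy_schwarz.
Qed.

Lemma enormN p q (A : 'M[R]_(p, q)) : enorm (- A) = enorm A.
Proof.
by congr (Num.sqrt _); apply: eq_bigr => i _; apply: eq_bigr => j _; rewrite mxE sqrrN.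
Qed.

Lemma enormZ p q c (A : 'M[R]_(p, q)) : enorm (c *: A) = `|c| * enorm A.
Proof.
rewrite /enorm -sqrtr_sqr -sqrtrM ?sqr_ge0// mulr_sumr; congr (Num.sqrt _).
apply: eq_bigr => i _; rewrite mulr_sumr; apply: eq_bigr => j _.
by rewrite mxE exprMn.
Qed.

Lemma enormM p q (A : 'M[R]_(p, q)) (x : 'cV[R]_q) : enorm (A *m x) <= enorm A * enorm x.
Proof.
rewrite -(@ler_pXn2r _ 2)// ?nnegrE ?mulr_ge0 ?enorm_ge0// exprMn !enormE mulr_suml.
apply: ler_sum => i _; rewrite big_ord1 mxE; apply: le_trans (cauchy_schwarz _ _) _.
rewrite ler_wpM2l; last first.
- by rewrite le_eqVlt; apply/orP; left; apply/eqP; apply: eq_bigr => j _; rewrite big_ord1.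
- by apply: sumr_ge0 => j _; exact: sqr_ge0.
by [].
Qed.

Lemma enormT p q (A : 'M[R]_(p, q)) : enorm A^T = enorm A.
Proof.
rewrite /enorm exchange_big; congr (Num.sqrt _).
by apply: eq_bigr => i _; apply: eq_bigr => j _; rewrite mxE.
Qed.

Lemma dotp_enorm k (x y : 'cV[R]_k) : `|dotp x y| <= enorm x * enorm y.
Proof.
rewrite -(@ler_pXn2r _ 2)// ?nnegrE ?mulr_ge0 ?enorm_ge0// real_normK ?num_real// exprMn.
rewrite dotpE !enormE; apply: le_trans (cauchy_schwarz _ _) _.
rewrite le_eqVlt; apply/orP; left; apply/eqP; congr (_ * _);
  by apply: eq_bigr => j _; rewrite big_ord1.
Qed.

End EuclideanNorm.

Lemma common_radius (R : realType) (n : nat) (Q : 'I_n -> R -> Prop) :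
  (forall i, exists r, 0 < r /\ forall r', r' <= r -> Q i r') ->
  exists r, 0 < r /\ forall i, Q i r.
Proof.
move=> /choice[r Hr]; exists (\big[Num.min/1]_i r i); split.
  by apply: (big_ind (fun x => 0 < x)) => [//|x y x0 y0|i _]; [rewrite lt_min x0|case: (Hr i)].
by move=> i; have [_ H] := Hr i; apply: H; exact: bigmin_le.
Qed.

Lemma enorm_le (R : realType) p q (A : 'M[R]_(p, q)) e : 0 <= e ->
  (forall i j, `|A i j| <= e) -> enorm A <= (p * q).+1%:R * e.
Proof.
move=> e0 H; rewrite -(@ler_pXn2r _ 2)// ?nnegrE ?mulr_ge0 ?enorm_ge0// enormE exprMn.
apply: (@le_trans _ _ (\sum_(i < p) \sum_(j < q) e ^+ 2)).
  apply: ler_sum => i _; apply: ler_sum => j _.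
  by rewrite -[leLHS]real_normK ?num_real// lerXn2r ?nnegrE.
rewrite !big_const_ord !iter_addr_0 -mulrnA -[leLHS]mulr_natl ler_wpM2r ?sqr_ge0//.
by rewrite -natrX ler_nat mulnC -[leqLHS]muln1 expnS leq_mul ?expn1.
Qed.

(** * Viscosity inequalities at jets *)

Section Equations.
Variables (R : realType) (k : nat) (T : R).
Local Notation X := (R * 'cV[R]_k)%type.
Implicit Types (w z : X) (q : 'cV[R]_k).

Lemma cont_enorm (a b : nat) D (F : X -> 'M[R]_(a, b)) : {within D, continuous F} ->
  forall p, D p -> forall e, 0 < e ->
  exists delta, 0 < delta /\ forall p', D p' -> dist p p' < delta ->
    enorm (F p' - F p) < e.
Proof.
move=> cF p Dp e e0; have e10 : 0 < e / 2 / (a * b).+1%:R by rewrite !divr_gt0.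
have [d [d0 H]] := cont_withinP cF Dp e10; exists d; split => // p' Dp' pp'.
apply: (@le_lt_trans _ _ (e / 2)); last by lra.
have <- : (a * b).+1%:R * (e / 2 / (a * b).+1%:R) = e / 2 by rewrite mulrC divfK.
apply: enorm_le (ltW e10) _ => i j; rewrite !mxE; apply: ltW; exact: H.
Qed.

Lemma dotpN q x : dotp q (- x) = - dotp q x.
Proof. by rewrite /dotp mulmxN mxE. Qed.

Lemma dotpNl q x : dotp (- q) x = - dotp q x.
Proof. by rewrite /dotp linearN mulNmx mxE. Qed.

Lemma dotpB q x y : dotp q (x - y) = dotp q x - dotp q y.
Proof. by rewrite dotpD dotpN. Qed.

Lemma dotpBl q q' x : dotp (q - q') x = dotp q x - dotp q' x.
Proof. by rewrite dotpDl dotpNl. Qed.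

Lemma superjetN (v : X -> R) w p q M :
  superjet T (fun w => - v w) w p q M -> subjet T v w (- p) (- q) (- M).
Proof.
move=> [MT [r [ro Hr]]]; split; first by rewrite linearN/= MT.
exists (fun z => - r z); split.
  apply/eqoP => e e0; have /eqoP/(_ e e0) := ro; apply: filterS => z.
  by rewrite normrN.
move=> z Dz; have := Hr z Dz; rewrite /jet_poly.
by rewrite dotpNl mulNmx dotpN; lra.
Qed.

Variables (d m : nat) (b : X -> 'cV[R]_k) (sigma : X -> 'M[R]_(k, d))
  (f : 'I_m -> X -> R -> 'cV[R]_d -> R) (g : 'I_m -> 'I_m -> X -> R)
  (h : 'I_m -> 'cV[R]_k -> R) (u v : 'I_m -> X -> R).

Lemma jet_limiting (J : (X -> R) -> X -> R -> 'cV[R]_k -> 'M[R]_k -> Prop) (w : X -> R) z p q M :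
  domain k T z -> J w z p q M -> limiting_jet T J w z p q M.
Proof.
move=> Dz H; exists (fun=> z), (fun=> p), (fun=> q), (fun=> M).
by split => //; do 4!(split; first exact: cvg_cst); exact: cvg_cst.
Qed.

Definition hamiltonian i w y q := dotp (b w) q + f i w y ((sigma w)^T *m q).

(** The obstacle is not active for i. Strictness makes the condition stable and forces the
    differential entry of the minimum to be nonpositive for a subsolution. *)
Definition free (u : 'I_m -> X -> R) i w := forall j, j != i -> u j w - g i j w < u i w.

Lemma subsolution_superjet i w p q M : viscosity_subsolution T b sigma f g h u ->
  domain k T w -> w.1 < T -> free u i w -> superjet T (u i) w p q M ->
  - p - 2^-1 * \tr (sigma w *m (sigma w)^T *m M) - hamiltonian i w (u i w) q <= 0.
Proof.
move=> [_ [Hu _]] Dw wT fr J.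
case: w Dw wT fr J => t x Dw wT fr J.
have tT : 0 <= t < T by move: Dw wT; rewrite /domain/= in_itv/= => -[/andP[-> _] _] ->.
have := Hu i t x p q M tT (jet_limiting Dw J); rewrite /system_op ge_min => /orP[|].
  rewrite sube_le0 leNgt => /negP[]; apply/bigmax_ltP; split; first exact: ltNyr.
  by move=> j ji; rewrite lte_fin; exact: fr.
by rewrite lee_fin /hamiltonian; lra.
Qed.

(** Stated for - v, with [- - v i w] and [- q] unreduced, to match the form of [local_sub]. *)
Lemma supersolution_superjet i w p q M : viscosity_supersolution T b sigma f g h v ->
  domain k T w -> w.1 < T -> superjet T (fun w => - v i w) w p q M ->
  (forall j, j != i -> v j w - g i j w <= v i w) /\
  - p - 2^-1 * \tr (sigma w *m (sigma w)^T *m M)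
    + hamiltonian i w (- - v i w) (- q) <= 0.
Proof.
move=> [_ [Hv _]] Dw wT /superjetN J.
case: w Dw wT J => t x Dw wT J.
have tT : 0 <= t < T by move: Dw wT; rewrite /domain/= in_itv/= => -[/andP[-> _] _] ->.
have := Hv i t x _ _ _ tT (jet_limiting Dw J); rewrite /system_op le_min => /andP[].
rewrite subre_ge0// => H; rewrite lee_fin /hamiltonian mulmxN linearN/= => H2; split; last first.
  by rewrite opprK; lra.
move=> j ji; rewrite -lee_fin; apply: le_trans H.
exact: (@le_bigmax_cond _ _ _ _ _ (fun j => j != i)).
Qed.

Hypotheses (b_cont : {within domain k T, continuous b})
  (sigma_cont : {within domain k T, continuous sigma})
  (f_cont : forall i tx, domain k T tx -> forall eps : R, 0 < eps ->
       \forall tx' \near within (domain k T) (nbhs tx),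
         forall y ze, `|f i tx' y ze - f i tx y ze| <= eps)
  (f_lip : forall i, exists C : R, 0 <= C /\
       forall tx y ze y' ze', domain k T tx ->
         `|f i tx y ze - f i tx y' ze'| <= C * (`|y - y'| + enorm (ze - ze')))
  (g_cont : forall i j : 'I_m, i != j -> {within domain k T, continuous (g i j)}).

Lemma enorm_l1 (x : 'cV[R]_k) : enorm x <= l1 x.
Proof.
rewrite -(@ler_pXn2r _ 2)// ?nnegrE ?enorm_ge0 ?l1_ge0// enormE [leRHS]expr2 {1}/l1 mulr_suml.
apply: ler_sum => i _; rewrite big_ord1 -real_normK ?num_real// expr2 ler_wpM2l//.
exact: coord_le_l1.
Qed.

Lemma hamiltonian_cont i z y0 q : domain k T z -> forall e, 0 < e ->
  exists delta, 0 < delta /\ forall w y q', domain k T w ->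
    dist z w < delta -> `|y - y0| < delta -> l1 (q' - q) < delta ->
    `|dotp (b w) q' - dotp (b z) q| <= e /\
    `|f i w y ((sigma w)^T *m q') - f i z y0 ((sigma z)^T *m q)| <= e.
Proof.
move=> Dz e e0; have [C [C0 HC]] := f_lip i.
pose e1 := e / 2 / (C + 1); have C10 : 0 < C + 1 by rewrite ltr_wpDl.
have e10 : 0 < e1 by rewrite !divr_gt0.
pose B := enorm q + enorm (sigma z) + enorm (b z) + 2.
have q0 := enorm_ge0 q; have s0 := enorm_ge0 (sigma z); have b0 := enorm_ge0 (b z).
have B0 : 0 < B by rewrite /B; lra.
pose eta := Num.min 1 (e1 / 3 / B); have eta0 : 0 < eta by rewrite lt_min ltr01 !divr_gt0.
have eta1 : eta <= 1 by rewrite /eta ge_min lexx.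
have etaB : eta * B <= e1 / 3 by rewrite -ler_pdivlMr// /eta ge_min lexx orbT.
clearbody eta.
have e12 : e1 <= e / 2 by rewrite /e1 ler_pdivrMr// ler_peMr ?divr_ge0 ?(ltW e0)// lerDr.
have Ce1 : C * e1 <= e / 2.
  rewrite /e1 mulrCA ler_piMr ?divr_ge0 ?(ltW e0)// ler_pdivrMr// mul1r lerDl ler01.
  by [].
have e20 : 0 < e / 2 by rewrite divr_gt0.
have /within_distP[d1 [d10 H1]] := f_cont i Dz e20.
have [d2 [d20 H2]] := cont_enorm sigma_cont Dz eta0.
have [d3 [d30 H3]] := cont_enorm b_cont Dz eta0.
exists (Num.min eta (Num.min d1 (Num.min d2 d3))).
split; first by rewrite !lt_min eta0 d10 d20.
move=> w y q' Dw; rewrite !lt_min => /and4P[_ w1 w2 w3] /and4P[yy _ _ _] /and4P[qq _ _ _].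
have {}H1 := H1 w Dw w1; have {}H2 := H2 w Dw w2; have {}H3 := H3 w Dw w3.
have {}qq : enorm (q' - q) < eta by apply: le_lt_trans (enorm_l1 _) qq.
have q'q : enorm q' <= enorm q + 1.
  rewrite -[leLHS](congr1 (@enorm R k 1) (subrKC q q')); apply: le_trans (enormD _ _) _.
  by rewrite lerD2l (le_trans (ltW qq)).
have etapos := ltW eta0.
split.
  have -> : dotp (b w) q' - dotp (b z) q = dotp (b w - b z) q' + dotp (b z) (q' - q).
    by rewrite dotpBl dotpB; ring.
  apply: le_trans (ler_normD _ _) _.
  apply: le_trans (lerD (dotp_enorm _ _) (dotp_enorm _ _)) _.
  have a1 := ler_pM (enorm_ge0 _) (enorm_ge0 _) (ltW H3) q'q.
  have a2 := ler_pM (enorm_ge0 _) (enorm_ge0 _) (lexx (enorm (b z))) (ltW qq).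
  apply: le_trans (lerD a1 a2) _.
  have : 0 <= eta * (1 + enorm (sigma z)) by rewrite mulr_ge0// addr_ge0.
  by move: etaB; rewrite /B; nra.
set ze := _ *m q'; set ze0 := _ *m q.
have -> : f i w y ze - f i z y0 ze0 = (f i w y ze - f i z y ze) + (f i z y ze - f i z y0 ze0).
  by ring.
apply: le_trans (ler_normD _ _) _.
apply: le_trans (lerD (H1 _ _) (HC _ _ _ _ _ Dz)) _.
have zz : enorm (ze - ze0) <= eta * (enorm (sigma z) + 1) + eta * enorm q.
  have -> : ze - ze0 = (sigma w)^T *m (q' - q) + (sigma w - sigma z)^T *m q.
    by rewrite /ze /ze0 mulmxBr linearB/= mulmxBl; rewrite addrA subrK.
  apply: le_trans (enormD _ _) _.
  have sw : enorm (sigma w) <= enorm (sigma z) + 1.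
    rewrite -[leLHS](congr1 (@enorm R k d) (subrKC (sigma z) (sigma w))); apply: le_trans (enormD _ _) _.
    by rewrite lerD2l (le_trans (ltW H2)).
  apply: lerD; apply: le_trans (enormM _ _) _; rewrite enormT.
    by rewrite mulrC ler_pM ?enorm_ge0// ltW.
  by rewrite ler_wpM2r// ltW.
have : C * (`|y - y0| + enorm (ze - ze0)) <= C * e1; last by lra.
rewrite ler_wpM2l//; apply: le_trans (lerD (ltW yy) zz) _.
have : 0 <= eta * enorm (b z) by rewrite mulr_ge0.
have : 0 <= eta * (enorm q + enorm (sigma z)) by rewrite mulr_ge0// addr_ge0.
by move: etaB; rewrite /B; nra.
Qed.

Lemma domain_lt z w r : z.1 + r <= T -> dist z w < r -> w.1 < T.
Proof.
move=> zr zw; have H y : y <= dist z w -> y < r by move=> /le_lt_trans; apply.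
have : w.1 - z.1 < r; last by lra.
by apply: H; rewrite (le_trans (ler_norm _))// /dist lerDl l1_ge0.
Qed.

(** [u i] is only upper semicontinuous and may drop near z, so closeness of its values is a
    hypothesis. This is why [local_sub] looks only at points where u is close to [u z]. *)
Lemma free_near i z : (forall j, usc_d (domain k T) (u j)) -> domain k T z -> free u i z ->
  exists r, 0 < r /\ forall w, domain k T w -> dist z w < r -> `|u i w - u i z| < r -> free u i w.
Proof.
move=> u_usc Dz fr.
pose Q j r := j != i -> forall w, domain k T w -> dist z w < r -> `|u i w - u i z| < r ->
  u j w - g i j w < u i w.
have [j|r [r0 Hr]] := @common_radius R m Q; last first.
  by exists r; split => // w Dw zw uu j ji; exact: (Hr j).
case: (eqVneq j i) => [->|ji]; first by exists 1; split => // r' _; rewrite /Q eqxx.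
have gap : 0 < (u i z - (u j z - g i j z)) / 3 by rewrite divr_gt0// subr_gt0 fr.
have [d1 [d10 H1]] := u_usc j z Dz _ gap.
have ij : i != j by rewrite eq_sym.
have [d2 [d20 H2]] := cont_within_realP (g_cont ij) Dz gap.
exists (Num.min ((u i z - (u j z - g i j z)) / 3) (Num.min d1 d2)).
split; first by rewrite !lt_min gap d10.
move=> r' r'r _ w Dw zw uu; have := lt_le_trans uu r'r; have := lt_le_trans zw r'r.
rewrite !lt_min => /and3P[_ /(H1 w Dw) h1 /(H2 w Dw) h2] /and3P[h3 _ _].
by move: h2 h3; rewrite !ltr_norml => /andP[h2 _] /andP[h3 _]; move: h1 h2 h3; lra.
Qed.

Lemma local_sub_subsolution i z q : viscosity_subsolution T b sigma f g h u ->
  domain k T z -> z.1 < T -> free u i z ->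
  local_sub T (u i) z q sigma (hamiltonian i).
Proof.
move=> Hu Dz zT fr; have u_usc j := usc_onP (Hu.1 j).
split => //; last by move=> e e0; exact: (cont_withinP sigma_cont Dz e0).
- have [r [r0 Hr]] := free_near u_usc Dz fr.
  exists (Num.min r (T - z.1)); split; first by rewrite lt_min r0 subr_gt0.
  move=> w p q' M Dw; rewrite !lt_min => /andP[zw zw'] /andP[uu _] J.
  apply: (subsolution_superjet Hu Dw) => //; first by apply: domain_lt zw'; lra.
  exact: Hr.
- move=> e e0; have e20 : 0 < e / 2 by rewrite divr_gt0.
  have [delta [d0 H]] := hamiltonian_cont i (u i z) q Dz e20; exists delta; split => //.
  move=> w y q' Dw zw yy qq; have [] := H w y q' Dw zw yy qq.
  by rewrite /hamiltonian !ler_norml => /andP[_ +] /andP[_ +]; lra.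
Qed.

Lemma local_sub_supersolution i z q : viscosity_supersolution T b sigma f g h v ->
  domain k T z -> z.1 < T ->
  local_sub T (fun w => - v i w) z q sigma (fun w y q => - hamiltonian i w (- y) (- q)).
Proof.
move=> Hv Dz zT; split; [exact: lsc_onP (Hv.1 i)| | |by move=> e e0; exact: (cont_withinP sigma_cont Dz e0)].
- exists (T - z.1); split; first by rewrite subr_gt0.
  move=> w p q' M Dw zw _ J; rewrite opprK.
  by apply: (supersolution_superjet Hv Dw _ J).2; apply: domain_lt zw; lra.
- move=> e e0; have e20 : 0 < e / 2 by rewrite divr_gt0.
  have [delta [d0 H]] := hamiltonian_cont i (v i z) (- q) Dz e20; exists delta; split => //.
  move=> w y q' Dw zw yy qq; have [||] := H w (- y) (- q') Dw zw.
  + by rewrite -normrN; rewrite opprB opprK addrC; move: yy; rewrite opprK.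
  + by rewrite -opprD l1N.
  by rewrite /hamiltonian opprK !ler_norml => /andP[+ _] /andP[+ _]; lra.
Qed.

(** The definition gives the obstacle inequality only where [v i] has a subjet. Minimizing v_i + N
    |w - z|^2 yields such a point w near z with v_i(w) <= v_i(z), and lower semicontinuity of v_j
    carries the inequality back to z. The blow-up at scale 1 with slope 0 serves as change of
    coordinates. *)
Lemma supersolution_obstacle i j z : viscosity_supersolution T b sigma f g h v ->
  domain k T z -> z.1 < T -> j != i -> v j z - g i j z <= v i z.
Proof.
move=> Hv Dz zT ji; rewrite leNgt; apply/negP => gap.
have {}gap : 0 < (v j z - g i j z - v i z) / 3 by rewrite divr_gt0// subr_gt0.
have ij : i != j by rewrite eq_sym.
have v_usc l := lsc_onP (Hv.1 l).
have [d1 [d10 H1]] := v_usc j z Dz _ gap.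
have [d2 [d20 H2]] := cont_within_realP (g_cont ij) Dz gap.
pose r := Num.min (T - z.1) (Num.min d1 d2).
have r0 : 0 < r by rewrite !lt_min subr_gt0 zT d10.
pose K := r / k.+2%:R; have K0 : 0 < K by rewrite divr_gt0.
have one : 0 < (1 : R) <= 1 by rewrite ltr01 lexx.
pose D := box (zlo z 1 K) (zhi T z 1 K).
pose U := blowup (fun w => - v i w) z 0 1.
have UE y : U y = v i z - v i (zoom z 1 y).
  by rewrite /U /blowup expr1n divr1 mul1r /dotp trmx0 mul0mx mxE; ring.
have U_usc : usc D U by exact: blowup_usc.
have [B HB] := usc_bounded U_usc.
have zoom0 : zoom z 1 0 = z.
  rewrite /zoom mxE mulr0 addr0 scale1r (_ : spatial _ = 0) ?addr0; first by case: (z).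
  by apply/matrixP => a c; rewrite !mxE.
have D0 : D 0 by apply/boxP => //; split; [move=> a; rewrite mxE normr0 ltW|rewrite zoom0].
(* N K^2 > |B| keeps the maximum point away from the faces of the cube, as [touched_superjet]
   requires. *)
pose N := `|B| / K ^+ 2 + 1.
have N0 : 0 <= N by rewrite addr_ge0// divr_ge0// sqr_ge0.
have [v0 [Dv0 Hv0]] : exists v0, D v0 /\ forall y, D y -> U y - N * sqn y <= U v0 - N * sqn v0.
  apply: (usc_max D0); apply: uscgD U_usc _; apply: contg_usc.
  apply: contgN; apply: contgM; first exact: contg_cst.
  apply: contg_sum => a; apply: contgX => p _ e e0; exists e; split => // p' _.
  by apply: le_lt_trans; have := coord_le_l1 (p' - p) a; rewrite !mxE.
have sv0 : N * sqn v0 <= U v0.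
  have := Hv0 0 D0; rewrite UE zoom0 subrr /sqn big1 ?mulr0; first lra.
  by move=> a _; rewrite mxE expr0n.
have v0K a : `|v0 a 0| < K.
  rewrite -(@ltr_pXn2r _ 2)// ?nnegrE ?(ltW K0)// real_normK ?num_real//.
  have h1 : v0 a 0 ^+ 2 <= sqn v0.
    by rewrite /sqn (bigD1 a)//= lerDl sumr_ge0// => *; exact: sqr_ge0.
  have h2 := HB v0 Dv0; rewrite ltNge; apply/negP => h3.
  have h4 : N * K ^+ 2 <= N * sqn v0 by rewrite ler_wpM2l// (le_trans h3).
  have h5 : N * K ^+ 2 = `|B| + K ^+ 2 by rewrite /N; field; rewrite gt_eqF.
  have h6 : 0 < K ^+ 2 by rewrite exprn_gt0.
  by have := ler_norm B; move: (`|B|) (N * _) (N * _) (U v0) h2 sv0 h4 h5 => *; lra.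
have [_ Dw] := (boxP T z K v0 ltr01).1 Dv0.
have zw : dist z (zoom z 1 v0) < r.
  apply: le_lt_trans (dist_zoom _ _ one) _; rewrite mul1r.
  apply: (@le_lt_trans _ _ (k.+1%:R * K)); first by apply: l1_le => a; exact: ltW.
  by rewrite /K mulrCA gtr_pMr// ltr_pdivrMr// mul1r ltr_nat.
have tch : touched D U v0 (fun a => 2 * N * v0 a 0) (fun a c => 2 * N * (a == c)%:R).
  exists 0, 1; split => // y Dy _; have := Hv0 _ Dy; rewrite sqnD mul0r addr0.
  have -> : lin (fun a => 2 * N * v0 a 0) y = N * (2 * \sum_a v0 a 0 * y a 0).
    by rewrite /lin !mulr_sumr; apply: eq_bigr => a _; ring.
  have -> : quad (fun a c => 2 * N * (a == c)%:R) y = 2 * N * sqn y.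
    rewrite /quad /sqn mulr_sumr; apply: eq_bigr => a _.
    rewrite (bigD1 a)//= big1 ?eqxx ?mulr1; first by ring.
    by move=> c ca; rewrite eq_sym (negbTE ca) !mulr0.
  have aux (c s1 s2 s3 a a' : R) : a - c * (s1 + 2 * s3 + s2) <= a' - c * s1 ->
    a <= a' + c * (2 * s3) + 2^-1 * (2 * c * s2) by lra.
  exact: aux.
have J := touched_superjet one Dv0 v0K tch.
move: zw; rewrite /r !lt_min => /and3P[wT w1 w2].
have [] := supersolution_superjet Hv Dw _ J; first by apply: domain_lt wT; lra.
move=> /(_ j ji) + _; have := H1 _ Dw w1; have := H2 _ Dw w2.
have := sv0; rewrite UE; have : 0 <= N * sqn v0 by rewrite mulr_ge0// sqn_ge0.
by rewrite ltr_norml => ? ? /andP[_ ?]; move: gap; lra.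
Qed.
End Equations.

Lemma binomial_remainder (R : realType) (n : nat) (s : R) : `|s| <= 1 ->
  `|(1 + s) ^+ n - 1 - n%:R * s| <= 4 ^+ n * s ^+ 2.
Proof.
move=> s1; elim: n => [|n IH].
  by rewrite !expr0 mul0r subr0 subrr normr0 mul1r sqr_ge0.
have -> : (1 + s) ^+ n.+1 - 1 - n.+1%:R * s =
    (1 + s) * ((1 + s) ^+ n - 1 - n%:R * s) + n%:R * s ^+ 2.
  by rewrite exprS -natr1; ring.
apply: le_trans (ler_normD _ _) _; rewrite normrM.
have s2 : `|1 + s| <= 2 by apply: le_trans (ler_normD _ _) _; rewrite normr1; lra.
have q0 := sqr_ge0 s.
rewrite [X in _ + X]ger0_norm; last by rewrite mulr_ge0.
apply: le_trans (lerD (ler_pM (normr_ge0 _) (normr_ge0 _) s2 IH) (lexx _)) _.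
have n4 : n%:R <= 2 * 4 ^+ n :> R.
  rewrite -natrX -natrM ler_nat; apply: leq_trans (ltnW (ltn_expl n (isT : 1 < 4)%N)) _.
  by rewrite leq_pmull.
by rewrite [4 ^+ n.+1]exprS; move: (ler_wpM2r q0 n4); move: (4 ^+ n) (s ^+ 2) => *; lra.
Qed.

(** * The growth weight *)

Section Weight.
Variables (R : realType) (k n l : nat) (T theta m0 : R).
Hypotheses (T0 : 0 < T) (theta0 : 0 <= theta) (m00 : 0 <= m0).
Local Notation X := (R * 'cV[R]_k)%type.
Implicit Types (x xi : 'cV[R]_k) (t : R) (w z : X).

Definition japanese x : R := 1 + enorm x ^+ 2.
(** A polynomial stand-in for a decaying exponential: on [0, T] its base stays in [1/2, 1] and its
    logarithmic derivative is at most - l / (2 T), as negative as desired. *)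
Definition discount t : R := (1 - t / (2 * T)) ^+ l.
(** m0 will be the maximal value. The inequality u - v <= weight, with equality at the maximum
    point, expresses maximality of the quotient without dividing u or v, so the viscosity
    inequalities are used for u and v themselves. *)
Definition weight w : R := discount w.1 * (m0 + theta * japanese w.2 ^+ n.+1).
(** n + 1 comes from |xi|^2 in the linear term of the binomial expansion in [japanese_taylor], 10 *
    4^(n + 1) from its remainder. *)
Definition hess_cst : R := n.+1%:R + 10 * 4 ^+ n.+1.

Lemma japanese_ge1 x : 1 <= japanese x.
Proof. by rewrite /japanese lerDl sqr_ge0. Qed.

Lemma enormD_sqr x xi : enorm (x + xi) ^+ 2 = enorm x ^+ 2 + 2 * dotp x xi + enorm xi ^+ 2.
Proof.
rewrite dotpE !enormE mulr_sumr -!big_split/=; apply: eq_bigr => i _.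
by rewrite !big_ord1 !mxE; ring.
Qed.

Lemma japanese_taylor x xi : enorm xi <= 4^-1 ->
  japanese (x + xi) ^+ n.+1 <= japanese x ^+ n.+1
    + 2 * n.+1%:R * japanese x ^+ n * dotp x xi + hess_cst * japanese x ^+ n * enorm xi ^+ 2.
Proof.
move=> xi4; set S := japanese x; have S1 : 1 <= S := japanese_ge1 x.
have S0 : 0 < S by lra.
pose r := 2 * dotp x xi + enorm xi ^+ 2.
have Er : japanese (x + xi) = S * (1 + r / S).
  by rewrite mulrDr mulr1 mulrCA mulfV ?gt_eqF// mulr1 /S /japanese enormD_sqr /r; ring.
have x0 := enorm_ge0 x; have xi0 := enorm_ge0 xi.
have CS := dotp_enorm x xi.
have SE : S = 1 + enorm x ^+ 2 by [].
have xi2 : enorm xi ^+ 2 <= 16^-1.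
  by have := ler_pM xi0 xi0 xi4 xi4; rewrite -expr2; lra.
have xS : enorm x <= S by rewrite SE; have := sqr_ge0 (enorm x - 1); lra.
have rS : `|r| <= S.
  apply: le_trans (ler_normD _ _) _; rewrite normrM ger0_norm// [`|enorm xi ^+ 2|]ger0_norm ?sqr_ge0//.
  have := ler_pM x0 xi0 xS xi4; lra.
have r2 : r ^+ 2 <= 10 * S * enorm xi ^+ 2.
  have d2 : dotp x xi ^+ 2 <= enorm x ^+ 2 * enorm xi ^+ 2.
    by rewrite -exprMn -[leLHS]real_normK ?num_real// lerXn2r ?nnegrE ?mulr_ge0.
  have d3 : r ^+ 2 <= 8 * dotp x xi ^+ 2 + 2 * (enorm xi ^+ 2) ^+ 2.
    by rewrite /r; have := sqr_ge0 (2 * dotp x xi - enorm xi ^+ 2); lra.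
  have e0 := sqr_ge0 (enorm xi).
  have d4 : enorm xi ^+ 2 * enorm xi ^+ 2 <= enorm xi ^+ 2 by rewrite ler_piMr//; lra.
  have d5 : 0 <= (S - 1) * enorm xi ^+ 2 by rewrite mulr_ge0//; lra.
  have d6 : enorm x ^+ 2 * enorm xi ^+ 2 = (S - 1) * enorm xi ^+ 2 by rewrite SE; ring.
  by move: d2 d3 d4; rewrite d6 [(enorm xi ^+ 2) ^+ 2]expr2; lra.
have rS1 : `|r / S| <= 1 by rewrite normrM normfV (gtr0_norm S0) ler_pdivrMr// mul1r.
have := binomial_remainder n.+1 rS1; rewrite ler_norml => /andP[_ H].
have Sn : 0 <= S ^+ n.+1 by rewrite exprn_ge0// ltW.
rewrite Er exprMn.
have : S ^+ n.+1 * ((1 + r / S) ^+ n.+1 - 1 - n.+1%:R * (r / S))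
    <= 10 * 4 ^+ n.+1 * (S ^+ n * enorm xi ^+ 2).
  apply: le_trans (ler_wpM2l Sn H) _.
  have -> : S ^+ n.+1 * (4 ^+ n.+1 * (r / S) ^+ 2) = 4 ^+ n.+1 * S ^+ n * (r ^+ 2 / S).
    by rewrite exprS; field; rewrite gt_eqF.
  have -> : 10 * 4 ^+ n.+1 * (S ^+ n * enorm xi ^+ 2) = 4 ^+ n.+1 * S ^+ n * (10 * enorm xi ^+ 2).
    by ring.
  rewrite ler_wpM2l//; first by rewrite mulr_ge0 ?exprn_ge0// ltW.
  by rewrite ler_pdivrMr//; move: r2; lra.
have -> : S ^+ n.+1 * ((1 + r / S) ^+ n.+1 - 1 - n.+1%:R * (r / S)) =
   S ^+ n.+1 * (1 + r / S) ^+ n.+1 - S ^+ n.+1 - n.+1%:R * S ^+ n * r.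
  by rewrite [in RHS]exprS [in LHS]exprS; field; rewrite gt_eqF.
by rewrite /hess_cst /r; lra.
Qed.

Lemma discount_bounds t : 0 <= t <= T -> 2^-1 <= 1 - t / (2 * T) <= 1.
Proof.
move=> /andP[t0 tT]; have T2 : 0 < 2 * T by rewrite mulr_gt0.
have : t / (2 * T) <= 2^-1 by rewrite ler_pdivrMr//; lra.
have : 0 <= t / (2 * T) by rewrite divr_ge0// ltW.
by move=> *; apply/andP; split; lra.
Qed.

Lemma discount_gt0 t : 0 <= t <= T -> 0 < discount t.
Proof. by move=> /discount_bounds/andP[h _]; rewrite exprn_gt0// (lt_le_trans _ h). Qed.

Lemma discount_ge t : 0 <= t <= T -> (2^-1) ^+ l <= discount t.
Proof. by move=> /discount_bounds/andP[h _]; rewrite lerXn2r ?nnegrE//; lra. Qed.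

Definition discount' t : R := - (l%:R / (2 * T)) / (1 - t / (2 * T)) * discount t.

Lemma discount'_le t : 0 <= t <= T -> discount' t <= - (l%:R / (2 * T)) * discount t.
Proof.
move=> tT; have /andP[h1 h2] := discount_bounds tT; have d0 := discount_gt0 tT.
rewrite /discount' ler_wpM2r ?(ltW d0)// mulNr lerNr opprK.
rewrite ler_peMr ?divr_ge0 ?mulr_ge0 ?(ltW T0)//.
by rewrite -[leLHS]invr1 lef_pV2 ?posrE//; lra.
Qed.

Lemma discount_taylor t : 0 <= t <= T -> exists K, 0 <= K /\
  forall t', `|t' - t| <= T -> `|discount t' - discount t - discount' t * (t' - t)| <= K * (t' - t) ^+ 2.
Proof.
move=> tT; have /andP[h1 h2] := discount_bounds tT; have d0 := discount_gt0 tT.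
set a := 1 - t / (2 * T) in h1 h2; have a0 : 0 < a by lra.
exists (discount t * 4 ^+ l / (2 * T * a) ^+ 2); split.
  by rewrite mulr_ge0 ?invr_ge0 ?sqr_ge0// mulr_ge0 ?exprn_ge0// ltW.
move=> t' tt'; pose s := - (t' - t) / (2 * T * a).
have s1 : `|s| <= 1.
  have p0 : 0 < 2 * T * a by rewrite !mulr_gt0.
  rewrite normrM normrN normfV (gtr0_norm p0) ler_pdivrMr// mul1r; apply: le_trans tt' _.
  by rewrite mulrAC ler_peMl ?(ltW T0)//; lra.
have E : discount t' = discount t * (1 + s) ^+ l.
  have as_ : a * s = - (t' - t) / (2 * T) by rewrite /s; field; rewrite !gt_eqF.
  rewrite /discount -exprMn; congr (_ ^+ _); rewrite -/a mulrDr mulr1 as_ /a.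
  by field; rewrite gt_eqF.
have -> : discount t' - discount t - discount' t * (t' - t) =
    discount t * ((1 + s) ^+ l - 1 - l%:R * s).
  by rewrite E /discount' -/a /s; field; rewrite !gt_eqF.
rewrite normrM (gtr0_norm d0).
apply: le_trans (ler_wpM2l (ltW d0) (binomial_remainder l s1)) _.
by rewrite le_eqVlt; apply/orP; left; apply/eqP; rewrite /s; field; rewrite !gt_eqF.
Qed.

Lemma contg_time D : contg (@dist R k) D (fun w => w.1).
Proof.
move=> p _ e e0; exists e; split => // p' _; apply: le_lt_trans.
by rewrite /dist lerDl l1_ge0.
Qed.

Lemma contg_coord D i : contg (@dist R k) D (fun w => w.2 i 0).
Proof.
move=> p _ e e0; exists e; split => // p' _; apply: le_lt_trans.
rewrite /dist; have := coord_le_l1 (p'.2 - p.2) i; rewrite !mxE.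
by have := normr_ge0 (p'.1 - p.1); lra.
Qed.

Lemma contg_japanese D : contg (@dist R k) D (fun w => japanese w.2).
Proof.
have : contg (@dist R k) D (fun w => 1 + \sum_i w.2 i 0 ^+ 2).
  by apply: contgD; [exact: contg_cst|apply: contg_sum => i; apply/contgX/contg_coord].
congr (contg _ D _); apply/funext => w; rewrite /japanese enormE.
by congr (_ + _); apply: eq_bigr => i _; rewrite big_ord1.
Qed.

Lemma contg_discount D : contg (@dist R k) D (fun w => discount w.1).
Proof.
apply: contgX; apply: contgD; first exact: contg_cst.
by apply: contgN; apply: contgM; [exact: contg_time|exact: contg_cst].
Qed.

Lemma contg_weight D : contg (@dist R k) D weight.
Proof.
apply: contgM; first exact: contg_discount.
apply: contgD; first exact: contg_cst.
by apply: contgM; [exact: contg_cst|apply: contgX; exact: contg_japanese].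
Qed.

Definition weight_grad z : 'cV[R]_k :=
  (discount z.1 * theta * (2 * n.+1%:R * japanese z.2 ^+ n)) *: z.2.
Definition weight_hess z : R := discount z.1 * theta * (hess_cst * japanese z.2 ^+ n).

(** Young's inequality splits the mixed term in dt and xi into e |xi|^2 and a multiple of dt^2. The
    resulting K may be huge, but [doubling] accepts any coefficient of the squared time
    increments. *)
Lemma weight_taylor z e : domain k T z -> 0 < e -> exists K, 0 <= K /\
  forall w, domain k T w -> dist z w < 4^-1 ->
    weight w <= weight z + discount' z.1 * (m0 + theta * japanese z.2 ^+ n.+1) * (w.1 - z.1)
      + dotp (weight_grad z) (w.2 - z.2) + (weight_hess z + e) * enorm (w.2 - z.2) ^+ 2
      + K * (w.1 - z.1) ^+ 2.
Proof.
have domT w : domain k T w -> 0 <= w.1 <= T by rewrite /domain/= in_itv => -[].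
move=> /domT zT e0; have [K1 [K10 HK1]] := discount_taylor zT.
set S := japanese z.2; have S1 : 1 <= S := japanese_ge1 z.2.
have Sn0 j : 0 <= S ^+ j by rewrite exprn_ge0//; lra.
pose A := m0 + theta * S ^+ n.+1; have A0 : 0 <= A by rewrite addr_ge0// mulr_ge0.
pose G := (2 * n.+1%:R * S ^+ n) *: z.2; pose H := hess_cst * S ^+ n.
have hc0 : 0 <= hess_cst by rewrite addr_ge0// mulr_ge0// exprn_ge0.
have H0 : 0 <= H by rewrite mulr_ge0.
pose K2 := `|discount' z.1| + K1 * T; have K20 : 0 <= K2 by rewrite addr_ge0 ?mulr_ge0// ltW.
pose K3 := enorm G + H; have K30 : 0 <= K3 by rewrite addr_ge0 ?enorm_ge0.
pose c := K2 * theta * K3.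
exists (K1 * A + c ^+ 2 / (4 * e)).
split; first by rewrite addr_ge0 ?mulr_ge0// invr_ge0 mulr_ge0// ltW.
move=> w /domT wT zw; set dt := w.1 - z.1; set xi := w.2 - z.2.
have dtT : `|dt| <= T by rewrite ler_norml /dt; move: wT zT => /andP[? ?] /andP[? ?]; apply/andP; split; lra.
have xi4 : enorm xi <= 4^-1.
  apply: le_trans (enorm_l1 _) (le_trans _ (ltW zw)).
  by rewrite /dist ler_wpDl.
have xi0 := enorm_ge0 xi; have om0 := discount_gt0 wT.
have {}HK1 := HK1 w.1 dtT; rewrite -/dt in HK1.
pose B := dotp G xi + H * enorm xi ^+ 2.
have psi_le : japanese w.2 ^+ n.+1 <= S ^+ n.+1 + B.
  have := japanese_taylor z.2 xi4; rewrite subrKC -/S /B /G /H dotpZl.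
  by rewrite -addrA.
have w_le : weight w <= discount w.1 * (A + theta * B).
  rewrite /weight ler_wpM2l ?(ltW om0)// /A -addrA lerD2l -mulrDr ler_wpM2l//.
have B_le : `|B| <= K3 * enorm xi.
  apply: le_trans (ler_normD _ _) _; rewrite normrM (ger0_norm H0) ger0_norm ?sqr_ge0//.
  have := dotp_enorm G xi.
  have : H * enorm xi ^+ 2 <= H * enorm xi by rewrite ler_wpM2l// expr2 ler_piMr//; lra.
  by rewrite /K3; lra.
have om_le : discount w.1 <= discount z.1 + discount' z.1 * dt + K1 * dt ^+ 2.
  by move: HK1; rewrite ler_norml => /andP[_]; lra.
have om_lip : `|discount w.1 - discount z.1| <= K2 * `|dt|.
  rewrite -[_ - _](subrK (discount' z.1 * dt)); apply: le_trans (ler_normD _ _) _.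
  rewrite normrM /K2; have : K1 * dt ^+ 2 <= K1 * T * `|dt|.
    by rewrite -mulrA ler_wpM2l// -[leLHS]real_normK ?num_real// expr2 ler_wpM2r.
  by move: HK1; move: (`|discount' z.1|) (`|dt|) (`|_ - _|) => *; lra.
have cross : (discount w.1 - discount z.1) * (theta * B) <= c * `|dt| * enorm xi.
  apply: le_trans (ler_norm _) _; rewrite normrM normrM (ger0_norm theta0).
  apply: le_trans (ler_pM (normr_ge0 _) _ om_lip (ler_wpM2l theta0 B_le)) _.
    by rewrite mulr_ge0.
  by rewrite /c; lra.
have young : c * `|dt| * enorm xi <= e * enorm xi ^+ 2 + c ^+ 2 / (4 * e) * dt ^+ 2.
  rewrite -subr_ge0 -[dt ^+ 2]real_normK ?num_real//.
  rewrite (_ : _ - _ = (2 * e * enorm xi - c * `|dt|) ^+ 2 / (4 * e)).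
    by rewrite divr_ge0 ?sqr_ge0// mulr_ge0// ltW.
  by field; rewrite gt_eqF.
have GE : dotp (weight_grad z) xi = discount z.1 * (theta * dotp G xi).
  by rewrite /weight_grad /G !dotpZl -/S; ring.
have omA := ler_wpM2r A0 om_le.
have wz : weight z = discount z.1 * A by [].
have hz : weight_hess z = discount z.1 * theta * H by [].
rewrite GE wz hz -/A; apply: le_trans w_le _.
have split_ : discount w.1 * (A + theta * B) =
  discount w.1 * A + (discount w.1 - discount z.1) * (theta * B) + discount z.1 * (theta * dotp G xi)
   + discount z.1 * theta * H * enorm xi ^+ 2 by rewrite /B; ring.
rewrite split_; move: omA cross young.
move: (c ^+ 2 / (4 * e)) (enorm xi ^+ 2) (dt ^+ 2) (c * _ * _) (_ * (theta * B)) => a1 a2 a3 a4 a5.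
rewrite !mulrDl; move: (discount z.1 * (theta * _)) => a6; lra.
Qed.

End Weight.

(** Otherwise every i in P has a successor in P, and along a cycle of successors the costs telescope
    to 0. By [looping_order], L = o - p consecutive iterates are distinct and the next one repeats
    the first; L >= 2 because a successor differs from i, so the sequence has N = L + 1 >= 3
    terms. *)
Lemma no_free_loop (R : realType) (m : nat) (a : 'I_m -> 'I_m -> R) (y : 'I_m -> R)
    (P : 'I_m -> Prop) i0 :
  (forall (N : nat) (c : nat -> 'I_m), (3 <= N)%N -> c 0%N = c N.-1 ->
     #|[set c (nat_of_ord n) | n : 'I_N]%SET| = N.-1 ->
     0 < \sum_(n < N.-1) a (c n) (c n.+1)) ->
  P i0 ->
  exists i, P i /\ forall j, j != i -> P j -> a i j != y j - y i.
Proof.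
move=> loop Pi0; apply: contrapT => no.
have /choice[s Hs] : forall i, exists j, P i -> [/\ j != i, P j & a i j = y j - y i].
  move=> i; case: (pselect (P i)) => [Pi|nPi]; last by exists i.
  apply: contrapT => nj; apply: no; exists i; split => // j ji Pj.
  by apply/eqP => aij; apply: nj; exists j.
pose c0 n := iter n s i0.
have Pc n : P (c0 n) by elim: n => [//|n IH]; case: (Hs _ IH).
have /trajectP[p po Ep] := looping_order s i0; set o := order s i0 in po Ep.
pose L := (o - p)%N; have poL : (p + L)%N = o by rewrite subnKC// ltnW.
pose c n := c0 (p + n)%N.
have cS n : c n.+1 = s (c n) by rewrite /c addnS.
have cL : c 0%N = c L by rewrite /c poL addn0 /c0 Ep.
have cN n : c n.+1 != c n by rewrite cS; case: (Hs _ (Pc (p + n)%N)).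
have L2 : (2 <= L)%N.
  rewrite ltn_neqAle andbC subn_gt0 po/=; apply/eqP => L1.
  by have := cN 0%N; rewrite cL L1 eqxx.
have := loop L.+1 c L2 cL.
have -> : #|[set c (nat_of_ord n) | n : 'I_L.+1]%SET| = L.
  have uL : uniq (traject s (c 0%N) L).
    have := orbit_uniq s i0; rewrite /orbit -/o -poL trajectD cat_uniq => /and3P[_ _].
    by rewrite /c addn0.
  have cT n : c n = iter n s (c 0%N) by rewrite /c /c0 addn0 addnC iterD.
  rewrite -[RHS](size_traject s (c 0%N)) -(card_uniqP uL); apply: eq_card => x.
  apply/imsetP/trajectP => [[n _ ->]|[n nL ->]].
    case: (ltngtP n L) => [nL|nL|->].
    - by exists n => //; exact: cT.
    - by move: (ltn_ord n); rewrite ltnS leqNgt nL.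
    - by exists 0%N; [apply: ltnW|rewrite -cL].
  by exists (Ordinal (leq_trans nL (leqnSn _))) => //; rewrite [RHS]cT.
move=> /(_ erefl)/=; rewrite (eq_bigr (fun n : 'I_L => y (c n.+1) - y (c n))); last first.
  by move=> n _; rewrite cS; case: (Hs _ (Pc (p + n)%N)).
by rewrite -(big_mkord xpredT (fun n => y (c n.+1) - y (c n))) telescope_sumr// -cL subrr ltxx.
Qed.

(** Pure algebra at the penalized maximum. The coefficient of - Phi pays term by term: 2 C^2 hc for
    the Hessian of the weight against sigma, 4 c1 C for its gradient against b, Cf for the gap
    between the values, 4 c1 C Cf for the gradient inside f; the final 1 survives as - Phi. Products
    with N are split by Young's inequality into quantities at most rho. *)
Lemma doubling_estimate (R : realType) (k d : nat) (C Cf c1 hc x S tau kap rho N Phi P y1 y2 : R)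
    (b1 b2 g r D : 'cV[R]_k) (s1 s2 : 'M[R]_(k, d)) (f1 f2 : R -> 'cV[R]_d -> R) :
  0 <= C -> 0 <= Cf -> 0 <= c1 -> 0 <= hc -> 0 <= x -> S = 1 + x ^+ 2 -> 0 <= tau ->
  0 <= kap -> 0 <= rho -> 0 <= N -> tau * S <= Phi ->
  P <= - (2 * C ^+ 2 * hc + 4 * c1 * C + Cf + 4 * c1 * C * Cf + 1) * Phi + 2 * kap * rho ->
  enorm b1 <= C * (1 + x) -> enorm s1 <= C * (1 + x) -> enorm g <= 2 * c1 * tau * x ->
  enorm r <= rho -> N * enorm D ^+ 2 <= rho -> N * enorm (s1 - s2) ^+ 2 <= rho ->
  N * enorm (b1 - b2) ^+ 2 <= rho ->
  (forall y ze, `|f1 y ze - f2 y ze| <= rho) ->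
  (forall y ze y' ze', `|f2 y ze - f2 y' ze'| <= Cf * (`|y - y'| + enorm (ze - ze'))) ->
  `|y1 - y2| <= Phi + rho ->
  forall q1 q2, q1 = g + (2 * kap) *: r + N *: D -> q2 = N *: D ->
  P + (N / 2 * enorm (s1 - s2) ^+ 2 + (kap + (tau * hc + kap)) * enorm s1 ^+ 2)
    + (dotp b1 q1 + f1 y1 (s1^T *m q1)) - (dotp b2 q2 + f2 y2 (s2^T *m q2))
  <= - Phi + 4 * kap * C ^+ 2 * S + rho * (2 * kap + 3 + 4 * C * kap * S + Cf * (2 + 4 * C * kap * S)).
Proof.
move=> C0 Cf0 c10 hc0 x0 SE tau0 kap0 rho0 N0 tS HP Hb Hs Hg Hr HD Hds Hdb Hf Lf Hy q1 q2 q1E q2E.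
have X2 : (1 + x) ^+ 2 <= 2 * S by rewrite SE; have := sqr_ge0 (x - 1); lra.
have X1 : 1 + x <= 2 * S by rewrite SE; have := sqr_ge0 (x - 1); have := sqr_ge0 x; lra.
have XX : (1 + x) * x <= 2 * S by rewrite SE; have := sqr_ge0 (x - 1); have := sqr_ge0 x; lra.
have cx0 : 0 <= C * (1 + x) by rewrite mulr_ge0// addr_ge0.
have S0 : 0 <= S by rewrite SE addr_ge0// sqr_ge0.
have e_s1 : enorm s1 ^+ 2 <= C ^+ 2 * (2 * S).
  apply: (@le_trans _ _ ((C * (1 + x)) ^+ 2)); first by rewrite lerXn2r ?nnegrE ?enorm_ge0.
  by rewrite exprMn ler_wpM2l ?sqr_ge0.
have E1 : (kap + (tau * hc + kap)) * enorm s1 ^+ 2 <= 4 * kap * C ^+ 2 * S + 2 * C ^+ 2 * hc * Phi.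
  apply: (@le_trans _ _ ((kap + (tau * hc + kap)) * (C ^+ 2 * (2 * S)))).
    by rewrite ler_wpM2l// !addr_ge0// mulr_ge0.
  have : 2 * C ^+ 2 * hc * (tau * S) <= 2 * C ^+ 2 * hc * Phi.
    by rewrite ler_wpM2l// !mulr_ge0// sqr_ge0.
  by move: (2 * C ^+ 2 * hc * Phi) => *; lra.
pose Gb := 4 * c1 * C * Phi + 4 * C * kap * S * rho.
have gq (V : R) : 0 <= V -> V <= C * (1 + x) -> V * enorm (g + (2 * kap) *: r) <= Gb.
  move=> V0 VC; apply: (@le_trans _ _ (C * (1 + x) * (2 * c1 * tau * x + 2 * kap * rho))).
    apply: ler_pM => //; first exact: enorm_ge0.
    apply: le_trans (enormD _ _) _; rewrite enormZ ger0_norm ?mulr_ge0//.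
    by rewrite lerD// ler_wpM2l// mulr_ge0.
  have h1 : 2 * c1 * C * tau * ((1 + x) * x) <= 2 * c1 * C * tau * (2 * S).
    by rewrite ler_wpM2l// !mulr_ge0.
  have h2 : 4 * c1 * C * (tau * S) <= 4 * c1 * C * Phi by rewrite ler_wpM2l// !mulr_ge0.
  have h3 : 2 * kap * rho * C * (1 + x) <= 2 * kap * rho * C * (2 * S).
    by rewrite ler_wpM2l// !mulr_ge0.
  by rewrite /Gb; move: h1 h2 h3; lra.
have young (a : R) : N * a ^+ 2 <= rho -> N * (a * enorm D) <= rho.
  move=> Ha; have : 0 <= N * (a - enorm D) ^+ 2 by rewrite mulr_ge0// sqr_ge0.
  by move: HD Ha; lra.
have Eb : dotp b1 q1 - dotp b2 q2 <= Gb + rho.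
  rewrite (_ : _ - _ = dotp b1 (g + (2 * kap) *: r) + N * dotp (b1 - b2) D); last first.
    by rewrite q1E q2E dotpD dotpBl !dotpZ; ring.
  apply: lerD.
    apply: le_trans (ler_norm _) (le_trans (dotp_enorm _ _) _).
    exact: gq (enorm_ge0 _) Hb.
  apply: le_trans (young _ Hdb); rewrite ler_wpM2l//.
  exact: le_trans (ler_norm _) (dotp_enorm _ _).
have Ez : enorm (s1^T *m q1 - s2^T *m q2) <= Gb + rho.
  have -> : s1^T *m q1 - s2^T *m q2 = s1^T *m (g + (2 * kap) *: r) + N *: ((s1 - s2)^T *m D).
    rewrite q1E q2E [s1^T *m (_ + N *: D)]mulmxDr -addrA; congr (_ + _).
    by rewrite linearB/= mulmxBl scalerBr !scalemxAr.
  apply: le_trans (enormD _ _) _; apply: lerD.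
    by apply: le_trans (enormM _ _) _; rewrite enormT; exact: gq (enorm_ge0 _) Hs.
  rewrite enormZ (ger0_norm N0); apply: le_trans (young _ Hds); rewrite ler_wpM2l//.
  by rewrite -(enormT (s1 - s2)); exact: enormM.
have Ef : f1 y1 (s1^T *m q1) - f2 y2 (s2^T *m q2) <= rho + Cf * (Phi + rho + (Gb + rho)).
  have h1 := le_trans (ler_norm _) (Hf y1 (s1^T *m q1)).
  have h2 := le_trans (ler_norm _) (Lf y1 (s1^T *m q1) y2 (s2^T *m q2)).
  have h3 := ler_wpM2l Cf0 (lerD Hy Ez).
  move: h1 h2 h3; move: (f1 _ _) (f2 _ _) (f2 _ _) (Cf * _) (Cf * _) => *; lra.
have Es : N / 2 * enorm (s1 - s2) ^+ 2 <= rho by move: Hds (mulr_ge0 N0 (sqr_ge0 (enorm (s1 - s2)))); lra.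
move: HP E1 Eb Ef Es; rewrite /Gb.
move: (dotp b1 _) (dotp b2 _) (f1 _ _) (f2 _ _) (_ * enorm s1 ^+ 2) (N / 2 * _) => *.
lra.
Qed.

(** * Localization at a maximum point *)

Section Coverings.
Variables (R : realType) (P Q : Type) (dP : P -> P -> R) (dQ : Q -> Q -> R).

Definition pdist (a b : P * Q) := dP a.1 b.1 + dQ a.2 b.2.

Lemma archi_inv (e : R) : 0 < e -> exists N0, forall N, (N0 <= N)%N -> N.+1%:R^-1 < e.
Proof.
move=> e0; have [N0] := ltr_add_invr e0; rewrite add0r => HN0; exists N0 => N NN.
by apply: le_lt_trans HN0; rewrite lef_pV2 ?posrE ?ltr0n// ler_nat.
Qed.

(** The tube lemma: for fixed p, the shrinking radii 1 / (N + 1) turn the search for one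
    neighbourhood of p valid for all q into an assertion for large N on E. *)
Lemma covered_prod (D : P -> Prop) (E : Q -> Prop) :
  covered dP D -> covered dQ E -> covered pdist (fun a => D a.1 /\ E a.2).
Proof.
move=> cD cE A HA.
have [p Dp|N0 HN0] := cD (fun N p => forall q, E q -> A N (p, q)); last first.
  by exists N0 => N [p q] NN [/= Dp Eq]; exact: HN0.
have [q Eq|N0 HN0] := cE (fun N q => forall N' p', (N <= N')%N -> D p' ->
    dP p p' < N.+1%:R^-1 -> A N' (p', q)); last first.
  exists N0.+1%:R^-1, N0; split; first by rewrite invr_gt0 ltr0n.
  by move=> N p' NN Dp' pp' q Eq; exact: (HN0 N0 q).
have [delta [N0 [d0 H]]] := HA (p, q) (conj Dp Eq).
have d20 : 0 < delta / 2 by rewrite divr_gt0.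
have [N1 HN1] := archi_inv d20.
exists (delta / 2), (maxn N0 N1); split => // N q'; rewrite geq_max => /andP[NN0 NN1] Eq' qq'.
move=> N' p' NN' Dp' pp'; apply: H => //; first exact: leq_trans NN'.
by rewrite /pdist/= (splitr delta) ltrD// (lt_trans pp')// HN1.
Qed.

Lemma uscg_comp (D : P -> Prop) (E : Q -> Prop) (phi : P -> Q) f :
  (forall p, D p -> E (phi p)) -> (forall p p', dQ (phi p) (phi p') <= dP p p') ->
  uscg dQ E f -> uscg dP D (fun p => f (phi p)).
Proof.
move=> phiE phid H p Dp e e0; have [d [d0 Hd]] := H _ (phiE p Dp) e e0.
by exists d; split => // p' Dp' pp'; apply: Hd; [exact: phiE|exact: le_lt_trans pp'].
Qed.

Lemma contg_comp (D : P -> Prop) (E : Q -> Prop) (phi : P -> Q) f :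
  (forall p, D p -> E (phi p)) -> (forall p p', dQ (phi p) (phi p') <= dP p p') ->
  contg dQ E f -> contg dP D (fun p => f (phi p)).
Proof.
move=> phiE phid H p Dp e e0; have [d [d0 Hd]] := H _ (phiE p Dp) e e0.
by exists d; split => // p' Dp' pp'; apply: Hd; [exact: phiE|exact: le_lt_trans pp'].
Qed.
End Coverings.

Section Localization.
Variables (R : realType) (k : nat) (T : R).
Local Notation X := (R * 'cV[R]_k)%type.
Implicit Types (w z : X).

Definition cbox z K w := domain k T w /\ `|w.1 - z.1| <= K /\ forall i, `|w.2 i 0 - z.2 i 0| <= K.

Lemma covered_cbox z K : covered (@dist R k) (cbox z K).
Proof.
have one : 0 < (1 : R) <= 1 by rewrite ltr01 lexx.
apply: (@covered_image _ _ _ (fun v v' : 'cV[R]_k.+1 => l1 (v' - v)) _ (box (zlo z 1 K) (zhi T z 1 K)) _ (zoom z 1)).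
- move=> v /(boxP T z K v ltr01)[vK Dv]; split => //; split.
    by rewrite /zoom/= expr1n mul1r [_ + _ - _]addrC addKr.
  by move=> i; rewrite /zoom/= !mxE mul1r [_ + _ - _]addrC addKr.
- move=> w [Dw [w1 w2]]; exists (unzoom 1 (w.1 - z.1, w.2 - z.2)).
  have E := unzoomK z w (ltr01 : 0 < (1 : R)); split => //.
  apply/boxP => //; rewrite E; split => // i.
  rewrite /unzoom mxE; case: unliftP => [j _|_] /=; first by rewrite !mxE divr1.
  by rewrite expr1n divr1.
- move=> v v'; have -> : zoom z 1 v' = zoom (zoom z 1 v) 1 (v' - v) by rewrite -zoomD subrKC.
  by apply: le_trans (dist_zoom _ _ one) _; rewrite mul1r.
- exact: box_cover.
Qed.

Lemma cbox_near z w : domain k T w -> dist z w <= 1 -> cbox z 1 w.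
Proof.
move=> Dw zw; have h0 := normr_ge0 (w.1 - z.1); have h1 := l1_ge0 (w.2 - z.2).
split => //; split; first by move: zw; rewrite /dist; lra.
move=> i; have := coord_le_l1 (w.2 - z.2) i; rewrite !mxE; move: zw; rewrite /dist; lra.
Qed.

Variables (u v Phi : X -> R) (z : X) (kap : R).
Hypotheses (Dz : domain k T z) (u_usc : usc_d (domain k T) u)
  (v_lsc : usc_d (domain k T) (fun w => - v w)) (Phi_cont : contg (@dist R k) (domain k T) Phi)
  (kap0 : 0 < kap) (uv_le : forall w, domain k T w -> u w - v w <= Phi w)
  (uv_z : u z - v z = Phi z).

Definition sqd w w' := enorm (w.2 - w'.2) ^+ 2.
(** The term in kap makes (z, z) the only diagonal pair with nonnegative excess, so that penalized
    maxima must approach z. *)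
Definition excess (a : X * X) :=
  u a.1 - v a.2 - Phi a.1 - kap * ((a.1.1 - z.1) ^+ 2 + sqd a.1 z).

Let D2 (a : X * X) := cbox z 1 a.1 /\ cbox z 1 a.2.
Let dd := @pdist R X X (@dist R k) (@dist R k).

Lemma sqd_ge0 w w' : 0 <= sqd w w'. Proof. exact: sqr_ge0. Qed.

Lemma dd_fst (a a' : X * X) : dist a.1 a'.1 <= dd a a'.
Proof. by rewrite /dd /pdist lerDl dist_ge0. Qed.

Lemma dd_snd (a a' : X * X) : dist a.2 a'.2 <= dd a a'.
Proof. by rewrite /dd /pdist lerDr dist_ge0. Qed.

Let D2_covered : covered dd D2.
Proof. by apply: covered_prod; exact: covered_cbox. Qed.

Let D2_dom1 a : D2 a -> domain k T a.1. Proof. by move=> [[]]. Qed.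
Let D2_dom2 a : D2 a -> domain k T a.2. Proof. by move=> [_ []]. Qed.

Lemma contg_sqd (D : X * X -> Prop) : contg dd D (fun a => sqd a.1 a.2).
Proof.
have : contg dd D (fun a => \sum_i (a.1.2 i 0 - a.2.2 i 0) ^+ 2).
  apply: contg_sum => i; apply: contgX; apply: contgD; last apply: contgN.
    exact: (@contg_comp _ _ _ _ (@dist R k) _ setT fst) (fun _ _ => I) dd_fst (contg_coord i).
  exact: (@contg_comp _ _ _ _ (@dist R k) _ setT snd) (fun _ _ => I) dd_snd (contg_coord i).
congr (contg dd D _); apply/funext => a; rewrite /sqd enormE.
by apply: eq_bigr => i _; rewrite big_ord1 !mxE.
Qed.

Lemma contg_sqt (D : X * X -> Prop) : contg dd D (fun a => (a.1.1 - a.2.1) ^+ 2).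
Proof.
apply: contgX; apply: contgD; last apply: contgN.
  exact: (@contg_comp _ _ _ _ (@dist R k) _ setT fst) (fun _ _ => I) dd_fst (@contg_time _ _ _).
exact: (@contg_comp _ _ _ _ (@dist R k) _ setT snd) (fun _ _ => I) dd_snd (@contg_time _ _ _).
Qed.

Lemma excess_usc : uscg dd D2 excess.
Proof.
have cst_pair : contg dd D2 (fun a => kap * ((a.1.1 - z.1) ^+ 2 + sqd a.1 z)).
  apply: contgM; first exact: contg_cst.
  apply: (@contg_comp _ _ _ dd dd _ setT (fun a : X * X => (a.1, z)) (fun a => (a.1.1 - a.2.1) ^+ 2 + sqd a.1 a.2)) => //.
    by move=> a a'; rewrite /dd /pdist/= dist_refl addr0 lerDl dist_ge0.
  by apply: contgD; [exact: contg_sqt|exact: contg_sqd].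
apply: uscgD; last exact/contg_usc/contgN.
apply: uscgD; last first.
  apply/contg_usc/contgN; exact: (@contg_comp _ _ _ _ (@dist R k) _ (domain k T) fst) D2_dom1 dd_fst Phi_cont.
apply: uscgD.
  exact: (@uscg_comp _ _ _ _ (@dist R k) _ (domain k T) fst) D2_dom1 dd_fst u_usc.
exact: (@uscg_comp _ _ _ _ (@dist R k) _ (domain k T) snd) D2_dom2 dd_snd v_lsc.
Qed.

Lemma sq_eq w w' : (w.1 - w'.1) ^+ 2 + sqd w w' <= 0 -> w = w'.
Proof.
move=> H; have h1 := sqr_ge0 (w.1 - w'.1); have h2 := sqd_ge0 w w'.
have /eqP : (w.1 - w'.1) ^+ 2 = 0 by lra.
rewrite sqrf_eq0 subr_eq0 => /eqP E1.
have /eqP : sqd w w' = 0 by lra.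
rewrite sqrf_eq0 => /eqP e0.
case: w w' E1 e0 {H h1 h2} => [t x] [t' x'] /= -> e0; congr (_, _).
apply/matrixP => i j; apply/eqP; rewrite -subr_eq0 -normr_le0 (ord1 j).
by have := enorm_coord (x - x') i 0; rewrite e0 !mxE.
Qed.

(** Off the diagonal a large N makes the penalized excess negative; at a diagonal pair of negative
    excess it stays negative nearby by semicontinuity; the only other pair is (z, z). There u and -
    v are bounded above by semicontinuity, and each is bounded below because their sum is. *)
Lemma localization rho : 0 < rho -> exists N0, forall N a, (N0 <= N)%N -> D2 a ->
  0 <= excess a - N%:R / 2 * ((a.1.1 - a.2.1) ^+ 2 + sqd a.1 a.2) ->
  [/\ dist z a.1 < rho, dist z a.2 < rho, `|u a.1 - u z| < rho, `|v a.2 - v z| < rho &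
      `|Phi a.1 - Phi z| < rho /\ excess a < rho].
Proof.
move=> rho0; apply: D2_covered => a Da.
set pen := fun a : X * X => (a.1.1 - a.2.1) ^+ 2 + sqd a.1 a.2.
have pen0 b : 0 <= pen b by rewrite addr_ge0 ?sqr_ge0.
have pen_cont : contg dd D2 pen by apply: contgD; [exact: contg_sqt|exact: contg_sqd].
case: (ltrP 0 (pen a)) => [pa|pa].
  have [d1 [d10 H1]] := excess_usc Da ltr01.
  have pa2 : 0 < pen a / 2 by rewrite divr_gt0.
  have [d2 [d20 H2]] := pen_cont a Da _ pa2.
  exists (Num.min d1 d2), (Num.bound `|(excess a + 1) / (pen a / 4)|).
  split; first by rewrite lt_min d10.
  move=> N b NN Db; rewrite lt_min => /andP[/(H1 b Db) h1 /(H2 b Db) h2] h3; exfalso.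
  have : (excess a + 1) / (pen a / 4) < N%:R.
    apply: le_lt_trans (ler_norm _) _; apply: lt_le_trans (archi_boundP (normr_ge0 _)) _.
    by rewrite ler_nat.
  rewrite ltr_pdivrMr ?divr_gt0// => h4.
  move: h2; rewrite ltr_norml => /andP[h2 _].
  have : N%:R / 2 * (pen a / 2) <= N%:R / 2 * pen b by rewrite ler_wpM2l//; lra.
  by move: h1 h3 h4; rewrite -/(pen b); move: (N%:R / 2 * pen b) => *; lra.
have /sq_eq aE := pa.
case: (ltrP (excess a) 0) => [Ea|Ea].
  have e0 : 0 < - excess a by rewrite oppr_gt0.
  have [d1 [d10 H1]] := excess_usc Da e0.
  exists d1, 0%N; split => // N b _ Db /(H1 b Db) h1 h3; exfalso.
  have : 0 <= N%:R / 2 * pen b by rewrite mulr_ge0.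
  by move: h1 h3; rewrite -/(pen b) subrr => *; lra.
have az : a = (z, z).
  have : a.1 = z.
    apply: sq_eq; rewrite -(pmulr_rle0 _ kap0); move: Ea; rewrite /excess -aE.
    by have := uv_le (D2_dom1 Da); lra.
  by move=> az1; rewrite [LHS]surjective_pairing -aE az1.
subst a => {pa aE Ea}.
have r0 : 0 < rho / 4 by rewrite divr_gt0.
have [d1 [d10 H1]] := u_usc Dz r0.
have [d2 [d20 H2]] := v_lsc Dz r0.
have [d3 [d30 H3]] := Phi_cont Dz r0.
exists (Num.min rho (Num.min d1 (Num.min d2 d3))), 0%N.
split; first by rewrite !lt_min rho0 d10 d20.
move=> N b _ Db bz h.
have := le_lt_trans (dd_fst _ _) bz; rewrite !lt_min => /and4P[b1 /(H1 _ (D2_dom1 Db)) h1 _ /(H3 _ (D2_dom1 Db)) h3].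
have := le_lt_trans (dd_snd _ _) bz; rewrite !lt_min => /and4P[b2 _ /(H2 _ (D2_dom2 Db)) h2 _].
have hN : 0 <= N%:R / 2 * pen b by rewrite mulr_ge0.
have hk : 0 <= kap * ((b.1.1 - z.1) ^+ 2 + sqd b.1 z) by rewrite mulr_ge0 ?addr_ge0 ?sqr_ge0// ltW.
move: h; rewrite -/(pen b) /excess; move: h3; rewrite /= in h1 h2 *; rewrite ltr_norml => /andP[h3 h3'] h.
move: hN hk h h1 h2 h3 h3' uv_z; move: (_ * pen b) (kap * _) => c1 c2.
move: (u b.1) (v b.2) (Phi b.1) (u z) (v z) (Phi z) => ? ? ? ? ? ? *.
by split => //; rewrite ?ltr_norml; [| |split]; try (apply/andP; split); lra.
Qed.

(** For pairs with distinct times a large M makes the penalized excess negative; near a pair with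
    equal times, F at (t1, x2) and at (t2, x2) are both close to one value. The threshold depends on
    N, so M is fixed after N. *)
Lemma time_modulus (p q : nat) (F : X -> 'M[R]_(p, q)) (N : R) rho :
  {within domain k T, continuous F} -> 0 <= N -> 0 < rho ->
  exists M0, forall M a, (M0 <= M)%N -> D2 a ->
    0 <= excess a - N / 2 * sqd a.1 a.2 - M%:R / 2 * (a.1.1 - a.2.1) ^+ 2 ->
    N * enorm (F (a.1.1, a.2.2) - F a.2) ^+ 2 <= rho.
Proof.
move=> F_cont N0 rho0; apply: D2_covered => a Da.
have tcont := @contg_sqt D2.
case: (eqVneq (a.1.1) (a.2.1)) => [tE|tN].
  pose e := Num.min 1 (rho / (4 * (N + 1))).
  have N10 : 0 < N + 1 by rewrite ltr_wpDl.
  have e0 : 0 < e by rewrite lt_min ltr01 divr_gt0// mulr_gt0.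
  have [d1 [d10 H1]] := cont_enorm F_cont (D2_dom2 Da) e0.
  exists d1, 0%N; split => // M b _ Db ab _.
  have h1 : enorm (F b.2 - F a.2) < e.
    by apply: H1; [exact: D2_dom2|exact: le_lt_trans (dd_snd _ _) ab].
  have h2 : enorm (F (b.1.1, b.2.2) - F a.2) < e.
    apply: H1; first by have := D2_dom1 Db; rewrite /domain/= => -[].
    apply: le_lt_trans ab; rewrite /dd /pdist /dist/= -tE.
    by have := l1_ge0 (b.1.2 - a.1.2); have := normr_ge0 (b.2.1 - a.1.1); lra.
  have h3 : enorm (F (b.1.1, b.2.2) - F b.2) <= 2 * e.
    rewrite -[_ - F b.2](subrKA (F a.2)); apply: le_trans (enormD _ _) _.
    by rewrite -[enorm (F a.2 - _)]enormN opprB; lra.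
  have e1 : e <= 1 by rewrite /e ge_min lexx.
  have e2 : e * (4 * (N + 1)) <= rho by rewrite -ler_pdivlMr ?mulr_gt0// /e ge_min lexx orbT.
  have h4 : enorm (F (b.1.1, b.2.2) - F b.2) ^+ 2 <= 4 * e.
    have := ler_pM (enorm_ge0 _) (enorm_ge0 _) h3 h3; rewrite -expr2 (_ : 2 * e * (2 * e) = 4 * (e * e)); last by ring.
    have : e * e <= e * 1 by rewrite ler_wpM2l ?(ltW e0).
    by move: (e * e) (enorm _ ^+ 2) => *; lra.
  by have := ler_wpM2l N0 h4; lra.
have pa : 0 < (a.1.1 - a.2.1) ^+ 2 by rewrite exprn_even_gt0//= subr_eq0.
have [d1 [d10 H1]] := excess_usc Da ltr01.
have pa2 : 0 < (a.1.1 - a.2.1) ^+ 2 / 2 by rewrite divr_gt0.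
have [d2 [d20 H2]] := tcont a Da _ pa2.
exists (Num.min d1 d2), (Num.bound `|(excess a + 1) / ((a.1.1 - a.2.1) ^+ 2 / 4)|).
split; first by rewrite lt_min d10.
move=> M b MM Db; rewrite lt_min => /andP[/(H1 b Db) h1 /(H2 b Db) h2] h3; exfalso.
have : (excess a + 1) / ((a.1.1 - a.2.1) ^+ 2 / 4) < M%:R.
  apply: le_lt_trans (ler_norm _) _; apply: lt_le_trans (archi_boundP (normr_ge0 _)) _.
  by rewrite ler_nat.
rewrite ltr_pdivrMr ?divr_gt0// => h4.
move: h2; rewrite ltr_norml => /andP[h2 _].
have h5 : 0 <= N / 2 * sqd b.1 b.2 by rewrite mulr_ge0 ?divr_ge0 ?sqd_ge0.
have : M%:R / 2 * ((a.1.1 - a.2.1) ^+ 2 / 2) <= M%:R / 2 * (b.1.1 - b.2.1) ^+ 2.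
  by rewrite ler_wpM2l//; lra.
by move: h1 h3 h4; move: (M%:R / 2 * (b.1.1 - b.2.1) ^+ 2) => *; lra.
Qed.

Lemma excess_max (N M : R) : exists a, D2 a /\ forall b, D2 b ->
  excess b - N / 2 * sqd b.1 b.2 - M / 2 * (b.1.1 - b.2.1) ^+ 2
  <= excess a - N / 2 * sqd a.1 a.2 - M / 2 * (a.1.1 - a.2.1) ^+ 2.
Proof.
have Dzz : D2 (z, z) by split; apply: cbox_near => //; rewrite dist_refl.
apply: (@uscg_max _ _ dd _ _ (z, z)) => //.
apply: uscgD; last first.
  by apply/contg_usc/contgN; apply: contgM; [exact: contg_cst|exact: contg_sqt].
apply: uscgD; first exact: excess_usc.
by apply/contg_usc/contgN; apply: contgM; [exact: contg_cst|exact: contg_sqd].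
Qed.

End Localization.

(** * The contradiction at a free maximum point *)

Lemma small_constants (R : realType) (C Cf S Phi : R) : 0 <= C -> 0 <= Cf -> 0 < S -> 0 < Phi ->
  exists kap rho, [/\ 0 < kap, 0 < rho & forall S' Phi', 0 <= S' <= S -> Phi - rho <= Phi' ->
    - Phi' + 4 * kap * C ^+ 2 * S' + ((4 * C ^+ 2 + 4) * rho)
      * (2 * kap + 3 + 4 * C * kap * S' + Cf * (2 + 4 * C * kap * S')) < 0].
Proof.
move=> C0 Cf0 S0 Phi0; have C20 := sqr_ge0 C.
have kd0 : 0 < 32 * (C ^+ 2 + 1) * S by apply: mulr_gt0 => //; apply: mulr_gt0 => //; lra.
(* The term 4 kap C^2 S', the term in rho1 and rho itself are each made at most Phi / 8. rho comes
   after kap, which enters the bound K of the last factor. *)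
pose kap := Phi / (32 * (C ^+ 2 + 1) * S).
have kap0 : 0 < kap by exact: divr_gt0.
have kapE : kap * (32 * (C ^+ 2 + 1) * S) = Phi by rewrite divfK// gt_eqF.
have kS0 : 0 <= kap * S by rewrite mulr_ge0// ltW.
have CkS : 0 <= C * (kap * S) by rewrite mulr_ge0.
pose K := 2 * kap + 3 + 4 * (C * (kap * S)) + Cf * (2 + 4 * (C * (kap * S))).
have K3 : 3 <= K.
  have : 0 <= Cf * (2 + 4 * (C * (kap * S))) by rewrite mulr_ge0// addr_ge0// mulr_ge0.
  by rewrite /K; lra.
have K0 : 0 < K by lra.
have c0 : 0 < 4 * C ^+ 2 + 4 by lra.
pose rho := Phi / (8 * K) / (4 * C ^+ 2 + 4).
have rho0 : 0 < rho by do 2!apply: divr_gt0 => //; exact: mulr_gt0.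
have rhoE : (4 * C ^+ 2 + 4) * rho * K = Phi / 8 by rewrite /rho; field; rewrite !gt_eqF.
have rho8 : rho <= Phi / 8.
  have : 1 * rho <= (4 * C ^+ 2 + 4) * rho * K.
    by rewrite mulrAC ler_wpM2r ?(ltW rho0)//; nra.
  by rewrite rhoE mul1r.
exists kap, rho; split => // S' Phi' /andP[S0' SS] Phi_le.
have kS : kap * S' <= kap * S by rewrite ler_wpM2l// ltW.
have CkS' : C * (kap * S') <= C * (kap * S) by rewrite ler_wpM2l.
have KS : 2 * kap + 3 + 4 * C * kap * S' + Cf * (2 + 4 * C * kap * S') <= K.
  have : Cf * (2 + 4 * (C * (kap * S'))) <= Cf * (2 + 4 * (C * (kap * S))) by rewrite ler_wpM2l//; lra.
  by rewrite /K; lra.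
have := ler_wpM2l (ltW (mulr_gt0 c0 rho0)) KS; rewrite rhoE.
have : C ^+ 2 * (kap * S') <= C ^+ 2 * (kap * S) by rewrite ler_wpM2l.
move: (_ * (2 * kap + 3 + _ + _)) => A hC HA.
by clear -kapE kS0 hC HA Phi_le rho8 Phi0; lra.
Qed.

(** F1, F2, F3 stand for values at (t1, x1), (t1, x2), (t2, x2): Lipschitz continuity in space
    handles the first difference, [time_modulus] the second, and (a + b)^2 <= 2 a^2 + 2 b^2 gives 4
    C^2 + 2. *)
Lemma increment_sq (R : realType) (p q : nat) (F1 F2 F3 : 'M[R]_(p, q)) (C D N r : R) :
  0 <= N -> enorm (F1 - F2) <= C * D -> N * D ^+ 2 <= 2 * r ->
  N * enorm (F2 - F3) ^+ 2 <= r -> N * enorm (F1 - F3) ^+ 2 <= (4 * C ^+ 2 + 2) * r.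
Proof.
move=> N0 h1 hD h2; set a1 := enorm (F1 - F2) in h1; set a2 := enorm (F2 - F3) in h2.
have h3 : enorm (F1 - F3) <= a1 + a2 by rewrite -[F1 - F3](subrKA F2); exact: enormD.
have h4 : enorm (F1 - F3) ^+ 2 <= 2 * a1 ^+ 2 + 2 * a2 ^+ 2.
  have := ler_pM (enorm_ge0 _) (enorm_ge0 _) h3 h3; rewrite -expr2.
  by have := sqr_ge0 (a1 - a2); lra.
have h5 : a1 ^+ 2 <= C ^+ 2 * D ^+ 2.
  by have := ler_pM (enorm_ge0 _) (enorm_ge0 _) h1 h1; rewrite -/a1; lra.
have := ler_wpM2l N0 h4; have := ler_wpM2l N0 h5; have := ler_wpM2l (sqr_ge0 C) hD.
by move: h2; lra.
Qed.

Lemma japanese_shift (R : realType) (k : nat) (x y : 'cV[R]_k) :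
  enorm (x - y) <= 1 -> japanese x <= 3 * japanese y.
Proof.
move=> xy; have h1 : enorm x <= enorm y + 1.
  rewrite -[leLHS](congr1 (@enorm R k 1) (subrKC y x)); apply: le_trans (enormD _ _) _.
  by rewrite lerD2l.
have := ler_pM (enorm_ge0 _) (enorm_ge0 _) h1 h1; rewrite /japanese.
by have := sqr_ge0 (enorm y - 1); have := sqr_ge0 (enorm y); lra.
Qed.

(* The penalized maximum turned into the one-sided expansion used in [doubling]. *)
Lemma penalty_expansion (R : realType) (k : nat) (z z1 z2 w1 w2 : R * 'cV[R]_k)
    (gr : 'cV[R]_k) (u1 v1 u2 v2 P1 P2 dm hess kap K1 N M : R) :
  0 <= M -> 0 <= kap -> 0 <= K1 ->
  P2 <= P1 + dm * (w1.1 - z1.1) + dotp gr (w1.2 - z1.2)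
      + (hess + kap) * enorm (w1.2 - z1.2) ^+ 2 + K1 * (w1.1 - z1.1) ^+ 2 ->
  u2 - v2 - P2 - kap * ((w1.1 - z.1) ^+ 2 + sqd w1 z) - N / 2 * sqd w1 w2 - M / 2 * (w1.1 - w2.1) ^+ 2
    <= u1 - v1 - P1 - kap * ((z1.1 - z.1) ^+ 2 + sqd z1 z) - N / 2 * sqd z1 z2 - M / 2 * (z1.1 - z2.1) ^+ 2 ->
  u2 + - v2 <= u1 + - v1 + (dm + 2 * kap * (z1.1 - z.1) + M * (z1.1 - z2.1)) * (w1.1 - z1.1)
      + (- (M * (z1.1 - z2.1))) * (w2.1 - z2.1)
      + dotp (gr + (2 * kap) *: (z1.2 - z.2) + N *: (z1.2 - z2.2)) (w1.2 - z1.2)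
      + dotp (- (N *: (z1.2 - z2.2))) (w2.2 - z2.2)
      + N / 2 * enorm ((w1.2 - z1.2) - (w2.2 - z2.2)) ^+ 2
      + (kap + (hess + kap)) * enorm (w1.2 - z1.2) ^+ 2 + 0 * enorm (w2.2 - z2.2) ^+ 2
      + (K1 + kap + M) * ((w1.1 - z1.1) ^+ 2 + (w2.1 - z2.1) ^+ 2).
Proof.
case: z z1 z2 w1 w2 => [t x] [t1 x1] [t2 x2] [s1 y1] [s2 y2]; rewrite /sqd /=.
move=> M0 kap0 K10; set xi := y1 - x1; set ze := y2 - x2.
have -> : y1 - y2 = (x1 - x2) + (xi - ze).
  by rewrite /xi /ze; apply/matrixP => ? ?; rewrite !mxE; ring.
have -> : y1 - x = (x1 - x) + xi by rewrite /xi; apply/matrixP => ? ?; rewrite !mxE; ring.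
move: (x1 - x2) (x1 - x) => D r; clearbody xi ze.
rewrite (enormD_sqr D (xi - ze)) (enormD_sqr r xi) !dotpDl dotpNl !dotpZl dotpB.
have -> : s1 - s2 = (t1 - t2) + ((s1 - t1) - (s2 - t2)) by ring.
have -> : s1 - t = (t1 - t) + (s1 - t1) by ring.
move: (s1 - t1) (s2 - t2) (t1 - t2) (t1 - t) => dt ds th tz.
have M1 : 0 <= M * (dt + ds) ^+ 2 by rewrite mulr_ge0// sqr_ge0.
have K1d : 0 <= (K1 + kap) * ds ^+ 2 by rewrite mulr_ge0 ?sqr_ge0// addr_ge0.
move: (dotp _ _) (dotp _ _) (dotp _ _) (dotp _ _) M1 K1d.
move: (enorm _ ^+ 2) (enorm _ ^+ 2) (enorm _ ^+ 2) (enorm _ ^+ 2) (enorm _ ^+ 2).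
clear => *; lra.
Qed.

(** The decay rate required by [doubling_estimate], with c1 = n + 1 and hc = [hess_cst R n]. *)
Definition rate_cst (R : realType) (C Cf : R) (n : nat) : R :=
  2 * C ^+ 2 * hess_cst R n + 4 * n.+1%:R * C + Cf + 4 * n.+1%:R * C * Cf + 1.

(** The constants are fixed in the order kap, rho1, r, N, M. [doubling] at the penalized maximum
    bounds by 0 from below an expression that [doubling_estimate] and [small_constants] make
    negative. *)
Lemma no_free_maximum (R : realType) (T : R) (k d m : nat)
  (b : R * 'cV[R]_k -> 'cV[R]_k) (sigma : R * 'cV[R]_k -> 'M[R]_(k, d))
  (f : 'I_m -> R * 'cV[R]_k -> R -> 'cV[R]_d -> R)
  (g : 'I_m -> 'I_m -> R * 'cV[R]_k -> R) (h : 'I_m -> 'cV[R]_k -> R)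
  (u v : 'I_m -> R * 'cV[R]_k -> R) (C Cf : R)
  (T0 : 0 < T)
  (b_cont : {within domain k T, continuous b})
  (sigma_cont : {within domain k T, continuous sigma})
  (C0 : 0 <= C)
  (growth : forall w, domain k T w -> enorm (b w) + enorm (sigma w) <= C * (1 + enorm w.2))
  (lipschitz : forall (t : R) x x', 0 <= t <= T ->
     enorm (b (t, x) - b (t, x')) + enorm (sigma (t, x) - sigma (t, x')) <= C * enorm (x - x'))
  (f_cont : forall i tx, domain k T tx -> forall eps : R, 0 < eps ->
     \forall tx' \near within (domain k T) (nbhs tx),
       forall y ze, `|f i tx' y ze - f i tx y ze| <= eps)
  (Cf0 : 0 <= Cf)
  (f_lip : forall i tx y ze y' ze', domain k T tx ->
     `|f i tx y ze - f i tx y' ze'| <= Cf * (`|y - y'| + enorm (ze - ze')))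
  (g_cont : forall i j : 'I_m, i != j -> {within domain k T, continuous (g i j)})
  (u_sub : viscosity_subsolution T b sigma f g h u)
  (v_super : viscosity_supersolution T b sigma f g h v)
  (n l : nat) (theta m0 : R) i (z : R * 'cV[R]_k) :
  0 <= theta -> 0 < m0 -> rate_cst C Cf n <= l%:R / (2 * T) ->
  domain k T z -> z.1 < T -> free g u i z ->
  (forall w, domain k T w -> u i w - v i w <= weight n l T theta m0 w) ->
  u i z - v i z = weight n l T theta m0 z -> False.
Proof.
move=> theta0 m00 Hl Dz zT fr uv_le uv_z.
set Phi := weight n l T theta m0 in uv_le uv_z.
have domT (w : R * 'cV[R]_k) : domain k T w -> 0 <= w.1 <= T by rewrite /domain/= in_itv => -[].
have f_lip' i' : exists C : R, 0 <= C /\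
       forall tx y ze y' ze', domain k T tx ->
         `|f i' tx y ze - f i' tx y' ze'| <= C * (`|y - y'| + enorm (ze - ze')).
  by exists Cf; split => //; exact: f_lip.
have u_usc j := usc_onP (u_sub.1 j).
have v_lsc := lsc_onP (v_super.1 i).
have psi0 (w : R * 'cV[R]_k) j : 0 <= japanese w.2 ^+ j by rewrite exprn_ge0// (le_trans ler01 (japanese_ge1 _)).
have A0 (w : R * 'cV[R]_k) : 0 < m0 + theta * japanese w.2 ^+ n.+1 by rewrite ltr_wpDr// mulr_ge0.
have Phi_gt0 (w : R * 'cV[R]_k) : domain k T w -> 0 < Phi w.
  by move=> Dw; apply: mulr_gt0 => //; apply: (discount_gt0 _ T0); exact: domT.
have [kap [rho1 [kap0 rho10 small]]] := small_constants C0 Cf0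
  (mulr_gt0 (ltr0n R 3) (lt_le_trans ltr01 (japanese_ge1 z.2))) (Phi_gt0 z Dz).
(* One bound for all small quantities: (4 C^2 + 2) rho1 from [increment_sq], and small multiples of
   rho1 elsewhere. *)
pose rho := (4 * C ^+ 2 + 4) * rho1.
have rho_le : (4 * C ^+ 2 + 2) * rho1 <= rho by rewrite ler_wpM2r ?(ltW rho10)// lerD2l ler_nat.
have rho1_le : 4 * rho1 <= rho.
  by rewrite ler_wpM2r ?(ltW rho10)// lerDr mulr_ge0// sqr_ge0.
have rhoE : rho = (4 * C ^+ 2 + 4) * rho1 by [].
have rho0 : 0 <= rho by apply: le_trans rho1_le; rewrite mulr_ge0// ltW.
clearbody rho.
have [r1 [r10 Hfree]] := free_near g_cont u_usc Dz fr.
have /within_distP[r2 [r20 Hf]] := f_cont i _ Dz _ rho10.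
pose r := Num.min (Num.min rho1 8^-1) (Num.min (Num.min r1 r2) (T - z.1)).
have r0 : 0 < r by rewrite !lt_min rho10 r10 r20 subr_gt0 zT invr_gt0 ltr0n.
have : [/\ r <= rho1, r <= 8^-1, r <= r1, r <= r2 & r <= T - z.1].
  by rewrite /r; split; rewrite !ge_min lexx ?orbT.
case=> r_rho r_8 r_1 r_2 r_T; clearbody r.
have Phi_cont : contg (@dist R k) (domain k T) Phi by exact: contg_weight.
have [N HN] := localization Dz (u_usc i) v_lsc Phi_cont kap0 uv_le uv_z r0.
have [M1 HM1] := time_modulus z kap (u_usc i) v_lsc Phi_cont sigma_cont (ler0n R N) rho10.
have [M2 HM2] := time_modulus z kap (u_usc i) v_lsc Phi_cont b_cont (ler0n R N) rho10.
pose M := maxn N (maxn M1 M2).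
have MN : (N <= M)%N by rewrite leq_maxl.
have M1M : (M1 <= M)%N by rewrite /M !leq_max leqnn orbT.
have M2M : (M2 <= M)%N by rewrite /M !leq_max leqnn !orbT.
clearbody M.
have [[[t1 x1] [t2 x2]] [[/= c1 c2] Hmax]] :=
  excess_max kap Dz (u_usc i) v_lsc Phi_cont N%:R M%:R.
set z1 := (t1, x1) in c1 Hmax; set z2 := (t2, x2) in c2 Hmax.
have D1 : domain k T z1 by case: c1. have D2 : domain k T z2 by case: c2.
have sqdzz : sqd z z = 0.
  by rewrite /sqd enormE big1// => j _; rewrite big_ord1 !mxE subrr expr0n.
have H0 : 0 <= excess (u i) (v i) Phi z kap (z1, z2) - N%:R / 2 * sqd z1 z2 - M%:R / 2 * (t1 - t2) ^+ 2.
  have zz : cbox T z 1 z by apply: cbox_near => //; rewrite dist_refl.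
  apply: le_trans (Hmax (z, z) (conj zz zz)); rewrite /excess/= sqdzz subrr expr0n/= addr0 !mulr0 !subr0.
  by rewrite uv_z subrr.
have NM : N%:R / 2 * (t1 - t2) ^+ 2 <= M%:R / 2 * (t1 - t2) ^+ 2.
  by rewrite ler_wpM2r ?sqr_ge0// ler_wpM2r// ler_nat.
have [|d1 d2 uu vv [PP ee]] := HN N (z1, z2) (leqnn N) (conj c1 c2).
  rewrite /=; move: H0 NM; move: (excess _ _ _ _ _ _) (sqd _ _) ((t1 - t2) ^+ 2) (N%:R / 2) (M%:R / 2).
  by clear => *; lra.
have Ns1 : N%:R * enorm (sigma (t1, x2) - sigma z2) ^+ 2 <= rho1 := HM1 M (z1, z2) M1M (conj c1 c2) H0.
have Ns2 : N%:R * enorm (b (t1, x2) - b z2) ^+ 2 <= rho1 := HM2 M (z1, z2) M2M (conj c1 c2) H0.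
rewrite /= in d1 d2 uu vv PP.
have Nd : N%:R * enorm (x1 - x2) ^+ 2 <= 2 * rho1.
  have : 0 <= M%:R / 2 * (t1 - t2) ^+ 2 by rewrite mulr_ge0 ?sqr_ge0.
  move: H0 ee; rewrite /sqd/=; move: (excess _ _ _ _ _ _) (M%:R / 2 * _) (enorm _ ^+ 2); clear -r_rho => *; lra.
have lip_sigma : enorm (sigma z1 - sigma (t1, x2)) <= C * enorm (x1 - x2).
  by apply: le_trans (lipschitz t1 x1 x2 (domT z1 D1)); rewrite lerDr enorm_ge0.
have lip_b : enorm (b z1 - b (t1, x2)) <= C * enorm (x1 - x2).
  by apply: le_trans (lipschitz t1 x1 x2 (domT z1 D1)); rewrite lerDl enorm_ge0.
have N0 : 0 <= N%:R :> R by [].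
have N_sigma := le_trans (increment_sq N0 lip_sigma Nd Ns1) rho_le.
have N_b := le_trans (increment_sq N0 lip_b Nd Ns2) rho_le.
have fdiff y ze : `|f i z1 y ze - f i z2 y ze| <= rho.
  have e1 := Hf z1 D1 (lt_le_trans d1 r_2) y ze.
  have e2 := Hf z2 D2 (lt_le_trans d2 r_2) y ze.
  rewrite -[_ - _](subrKA (f i z y ze)); apply: le_trans (ler_normD _ _) _.
  by rewrite [`|f i z y ze - _|]distrC; clear -e1 e2 rho1_le rho10; lra.
have l1d : l1 (x1 - z.2) <= dist z z1 by rewrite /dist lerDr.
have xr : enorm (x1 - z.2) <= dist z z1 := le_trans (enorm_l1 _) l1d.
have tr : `|t1 - z.1| <= dist z z1 by rewrite /dist lerDl l1_ge0.
have S_le : japanese x1 <= 3 * japanese z.2.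
  by apply: japanese_shift; clear -xr d1 r_8; lra.
have t1T : t1 < T by apply: (@domain_lt _ _ _ z z1 r) => //; clear -r_T; lra.
have t2T : t2 < T by apply: (@domain_lt _ _ _ z z2 r) => //; clear -r_T; lra.
have fr1 : free g u i z1 by apply: Hfree => //; [exact: lt_le_trans r_1|exact: lt_le_trans uu r_1].
pose grad := weight_grad n l T theta z1.
pose D := x1 - x2.
(* Gradients, in the two space variables, of the test function touching u i w1 - v i w2 from above
   at (z1, z2). *)
pose q1 := grad + (2 * kap) *: (x1 - z.2) + N%:R *: D; pose q2 := - (N%:R *: D).
have L1 := local_sub_subsolution b_cont sigma_cont f_cont f_lip' g_cont q1 u_sub D1 t1T fr1.
have L2 := local_sub_supersolution b_cont sigma_cont f_cont f_lip' i q2 v_super D2 t2T.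
have [K1 [K10 HK1]] := weight_taylor n l T0 theta0 (ltW m00) D1 kap0.
pose dm := discount' l T t1 * (m0 + theta * japanese x1 ^+ n.+1).
pose hess := weight_hess n l T theta z1.
pose p1 := dm + 2 * kap * (t1 - z.1) + M%:R * (t1 - t2); pose p2 := - (M%:R * (t1 - t2)).
have hess0 : 0 <= hess.
  rewrite /hess /weight_hess !mulr_ge0// ?(ltW (discount_gt0 _ T0 (domT _ D1)))//.
  by rewrite addr_ge0// mulr_ge0// exprn_ge0.
(* The radius 1/8 keeps w1 and w2 within 1/4 of z, hence in [cbox T z 1], and w1 within the range of
   [weight_taylor]. *)
have touch w1 w2 : domain k T w1 -> domain k T w2 -> dist z1 w1 < 8^-1 -> dist z2 w2 < 8^-1 ->
    u i w1 + - v i w2 <= u i z1 + - v i z2 + p1 * (w1.1 - z1.1) + p2 * (w2.1 - z2.1)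
      + dotp q1 (w1.2 - z1.2) + dotp q2 (w2.2 - z2.2)
      + N%:R / 2 * enorm ((w1.2 - z1.2) - (w2.2 - z2.2)) ^+ 2
      + (kap + (hess + kap)) * enorm (w1.2 - z1.2) ^+ 2 + 0 * enorm (w2.2 - z2.2) ^+ 2
      + (K1 + kap + M%:R) * ((w1.1 - z1.1) ^+ 2 + (w2.1 - z2.1) ^+ 2).
  move=> Dw1 Dw2 zw1 zw2.
  have b1 : cbox T z 1 w1.
    by apply: cbox_near => //; have := dist_triangle z z1 w1; clear -d1 zw1 r_8; lra.
  have b2 : cbox T z 1 w2.
    by apply: cbox_near => //; have := dist_triangle z z2 w2; clear -d2 zw2 r_8; lra.
  apply: (penalty_expansion (ler0n R M) (ltW kap0) K10 _ (Hmax (w1, w2) (conj b1 b2))).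
  by apply: HK1 => //; clear -zw1; lra.
have e8 : 0 < (8^-1 : R) by rewrite invr_gt0.
have al0 : 0 <= N%:R / 2 :> R by rewrite divr_ge0.
have b10 : 0 <= kap + (hess + kap) by rewrite !addr_ge0// ltW.
have K00 : 0 <= K1 + kap + M%:R by rewrite !addr_ge0// ltW.
have main := doubling D1 D2 L1 L2 al0 b10 (lexx 0) K00 e8 touch.
rewrite /hamiltonian opprK /q2 opprK mul0r addr0 in main.
pose tau := discount l T t1 * theta * japanese x1 ^+ n.
have om0 := discount_gt0 l T0 (domT z1 D1).
have tau0 : 0 <= tau := mulr_ge0 (mulr_ge0 (ltW om0) theta0) (psi0 z1 n).
have hc0 : 0 <= hess_cst R n by rewrite addr_ge0// mulr_ge0// exprn_ge0.
have hessE : hess = tau * hess_cst R n by rewrite /hess /weight_hess /tau /=; ring.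
have tauS : tau * japanese x1 <= Phi z1.
  have : 0 <= discount l T t1 * m0 by rewrite mulr_ge0// ltW.
  by rewrite /Phi /weight /tau /= exprSr; move: (discount l T t1) (japanese x1 ^+ n) (japanese x1); clear => *; lra.
(* The terms M (t1 - t2) cancel in p1 + p2, so the size of M does no harm. *)
have hp : p1 + p2 <= - rate_cst C Cf n * Phi z1 + 2 * kap * rho.
  have h1 : dm <= - rate_cst C Cf n * Phi z1.
    have A1 := ltW (A0 z1); have P1 := ltW (Phi_gt0 z1 D1).
    apply: le_trans (ler_wpM2r A1 (discount'_le l T0 (domT z1 D1))) _.
    by rewrite -mulrA ler_wpM2r// lerN2.
  have h2 : t1 - z.1 <= rho.
    apply: le_trans (ler_norm _) (le_trans tr _); clear -d1 r_rho rho1_le rho10; lra.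
  have := ler_wpM2l (ltW kap0) h2; rewrite /p1 /p2; move: (M%:R * _) h1 => c.
  by clear => *; lra.
have hb : enorm (b z1) <= C * (1 + enorm x1).
  by apply: le_trans (growth z1 D1); rewrite lerDl enorm_ge0.
have hs : enorm (sigma z1) <= C * (1 + enorm x1).
  by apply: le_trans (growth z1 D1); rewrite lerDr enorm_ge0.
have hg : enorm grad <= 2 * n.+1%:R * tau * enorm x1.
  rewrite /grad /weight_grad enormZ ger0_norm; first by rewrite /tau /=; clear; lra.
  by have := mulr_ge0 (ler0n R n.+1) tau0; rewrite /tau /=; clear; lra.
have hr : enorm (x1 - z.2) <= rho.
  by apply: le_trans xr _; clear -d1 r_rho rho1_le rho10; lra.
have hD : N%:R * enorm D ^+ 2 <= rho.
  by apply: le_trans Nd _; clear -rho1_le rho10; lra.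
have hy : `|u i z1 - v i z2| <= Phi z1 + rho.
  move: H0; rewrite /excess /= => H0; have P1 := Phi_gt0 z1 D1.
  have hk : 0 <= kap * ((t1 - z.1) ^+ 2 + sqd z1 z) by rewrite mulr_ge0 ?addr_ge0 ?sqr_ge0// ltW.
  have hN : 0 <= N%:R / 2 * sqd z1 z2 by rewrite mulr_ge0// sqr_ge0.
  have hM : 0 <= M%:R / 2 * (t1 - t2) ^+ 2 by rewrite mulr_ge0// sqr_ge0.
  move: H0 hk hN hM uu vv PP uv_z P1; rewrite !ltr_norml ler_norml.
  move: (kap * _) (_ * sqd _ _) (_ * (t1 - t2) ^+ 2) (u i z1) (v i z2) (Phi z1) (u i z) (v i z) (Phi z).
  clear -r_rho rho1_le => c1 c2 c3 c4 c5 c6 c7 c8 c9 h1 h2 h3 h4 /andP[h5 h6] /andP[h7 h8] /andP[h9 h10] h11 h12.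
  by apply/andP; split; lra.
have S0 : 0 <= japanese x1 by rewrite (le_trans ler01 (japanese_ge1 _)).
have PP' : Phi z - rho1 <= Phi z1.
  by move: PP; rewrite ltr_norml; clear -r_rho => /andP[? _]; lra.
have S2 : 0 <= japanese x1 <= 3 * japanese z.2 by rewrite S0 S_le.
have := small _ _ S2 PP'; rewrite -rhoE ltNge => /negP; apply.
apply: le_trans main _; rewrite hessE.
apply: le_trans (doubling_estimate C0 Cf0 (ler0n R n.+1) hc0 (enorm_ge0 x1) (erefl (japanese x1)) tau0
  (ltW kap0) rho0 N0 tauS hp hb hs hg hr hD N_sigma N_b fdiff
  (fun y ze y' ze' => f_lip i z2 y ze y' ze' D2) hy (erefl q1) (erefl _)).
rewrite -/q1 opprD /D; move: (dotp _ _) (dotp _ _) (f _ _ _ _) (f _ _ _ _) (p1 + p2).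
move: (_ / 2 * _) (_ * enorm (sigma z1) ^+ 2).
by clear => *; lra.
Qed.

(** * Existence of the maximum point, and conclusion *)

Lemma growth_japanese (R : realType) (k m : nat) (T : R) (phi : 'I_m -> R * 'cV[R]_k -> R) :
  (forall i, poly_growth_on T (phi i)) -> exists B n0, 0 <= B /\
    forall n i w, (n0 <= n)%N -> domain k T w -> `|phi i w| <= B * japanese w.2 ^+ n.
Proof.
move=> H; have {}H i : exists Cn : R * nat, 0 <= Cn.1 /\ forall n w, (Cn.2 <= n)%N ->
    domain k T w -> `|phi i w| <= Cn.1 * japanese w.2 ^+ n.
  have [C [ga [C0 [ga0 HC]]]] := H i; exists (2 * C, Num.bound ga); split.
    by rewrite /= mulr_ge0.
  move=> n [t x] /= nga [/= tT _]; have S1 := japanese_ge1 x.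
  rewrite in_itv/= in tT; apply: le_trans (HC t x tT) _.
  rewrite mulrAC [leRHS]mulrC ler_wpM2l//.
  have Sn : 1 <= japanese x ^+ n by rewrite exprn_ege1.
  have : enorm x `^ ga <= japanese x ^+ n.
    apply: (@le_trans _ _ (japanese x `^ ga)).
      apply: ge0_ler_powR => //; rewrite ?nnegrE ?enorm_ge0//.
        by rewrite (le_trans ler01).
      by rewrite /japanese; have := sqr_ge0 (enorm x - 1); have := sqr_ge0 (enorm x); lra.
    rewrite -powR_mulrn ?(le_trans ler01)//; apply: ler_powR => //.
    by apply: le_trans (ltW (archi_boundP ga0)) _; rewrite ler_nat.
  by lra.
have /choice[Cn HCn] := H.
have n_le i : ((Cn i).2 <= \max_i (Cn i).2)%N by exact: leq_bigmax.
exists (\sum_i (Cn i).1), (\max_i (Cn i).2); split.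
  by apply: sumr_ge0 => i _; case: (HCn i).
move=> n i w nn Dw; have [_ Hi] := HCn i.
apply: le_trans (Hi n w (leq_trans (n_le i) nn) Dw) _.
rewrite ler_wpM2r ?exprn_ge0 ?(le_trans ler01 (japanese_ge1 _))//.
by rewrite (bigD1 i)//= lerDl sumr_ge0// => j _; case: (HCn j).
Qed.

(** The power n + 1 of [japanese] beats the growth of order n, so G is nonpositive outside a large
    cube, while theta is small enough for G to be positive at z0. The maximum over the cube and the
    finitely many indices is then global, and its value is m0. *)
Lemma weighted_maximum (R : realType) (k m : nat) (T : R) (u v : 'I_m -> R * 'cV[R]_k -> R)
    (n l : nat) (B : R) i0 z0 : 0 < T -> 0 <= B ->
  (forall i, usc_d (domain k T) (u i)) -> (forall i, usc_d (domain k T) (fun w => - v i w)) ->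
  (forall i w, domain k T w -> u i w - v i w <= B * japanese w.2 ^+ n) ->
  domain k T z0 -> v i0 z0 < u i0 z0 ->
  exists theta m0 i z, [/\ 0 < theta, 0 < m0, domain k T z, u i z - v i z = weight n l T theta m0 z &
    forall j w, domain k T w -> u j w - v j w <= weight n l T theta m0 w].
Proof.
move=> T0 B0 u_usc v_usc uvB Dz0 uv0.
have domT (w : R * 'cV[R]_k) : domain k T w -> 0 <= w.1 <= T by rewrite /domain/= in_itv => -[].
have om0 (w : R * 'cV[R]_k) : domain k T w -> 0 < discount l T w.1.
  by move=> Dw; apply: (discount_gt0 l T0); exact: domT.
have S1 (w : R * 'cV[R]_k) := japanese_ge1 w.2.
have Sn j (w : R * 'cV[R]_k) : 0 < japanese w.2 ^+ j.
  by rewrite exprn_gt0//; exact: lt_le_trans ltr01 (S1 w).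
pose q i w := (discount l T w.1)^-1 * (u i w - v i w).
have q0 : 0 < q i0 z0 by rewrite mulr_gt0 ?invr_gt0 ?om0// subr_gt0.
pose theta := q i0 z0 / (2 * japanese z0.2 ^+ n.+1).
have theta0 : 0 < theta by rewrite divr_gt0// mulr_gt0// Sn.
pose G i w := q i w - theta * japanese w.2 ^+ n.+1.
have G0 : 0 < G i0 z0.
  have -> : G i0 z0 = q i0 z0 / 2 by rewrite /G /theta; field; rewrite gt_eqF.
  by rewrite divr_gt0.
(* Once [japanese] exceeds K0, theta S^(n + 1) dominates 2^l B S^n, where 2^l bounds the inverse of
   [discount] on [0, T]. *)
pose K0 := 2 ^+ l * B / theta; have K00 : 0 <= K0.
  by rewrite divr_ge0 ?(ltW theta0)// mulr_ge0// exprn_ge0.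
pose K := T + K0 + enorm z0.2.
have KK0 : K0 <= K by rewrite /K addrAC lerDr addr_ge0 ?enorm_ge0// ltW.
pose D := cbox T (0 : R, 0 : 'cV[R]_k) K.
have DP w : domain k T w -> (forall i, `|w.2 i 0| <= K) -> D w.
  move=> Dw wK; split => //; split; last by move=> i; rewrite mxE subr0.
  have /andP[w0 wT] := domT w Dw; rewrite subr0 ger0_norm//; apply: le_trans wT _.
  by rewrite /K -addrA lerDl addr_ge0// enorm_ge0.
have Dz : D z0.
  apply: DP => // i; apply: le_trans (enorm_coord _ _ _) _.
  by rewrite /K lerDr addr_ge0// ltW.
have outside i w : domain k T w -> ~ D w -> G i w <= 0.
  move=> Dw nD; have [a wa] : exists a, K < `|w.2 a 0|.
    apply: contrapT => na; apply: nD; apply: DP => // a; rewrite leNgt; apply/negP => Ka.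
    by apply: na; exists a.
  have KS : K0 <= japanese w.2.
    have h1 := le_trans (ltW wa) (enorm_coord w.2 a 0); rewrite /japanese.
    by have := sqr_ge0 (enorm w.2 - 1); have := sqr_ge0 (enorm w.2); move: KK0 h1; clear => *; lra.
  rewrite subr_le0; apply: (@le_trans _ _ (2 ^+ l * (B * japanese w.2 ^+ n))).
    apply: (@le_trans _ _ ((discount l T w.1)^-1 * (B * japanese w.2 ^+ n))).
      by rewrite ler_wpM2l ?uvB// invr_ge0 ltW// om0.
    rewrite ler_wpM2r ?mulr_ge0 ?(ltW (Sn _ _))//.
    have := discount_ge l T0 (domT w Dw); rewrite exprVn => h.
    have c0 : 0 < (2 ^+ l : R) by rewrite exprn_gt0.
    have d0 := om0 w Dw; rewrite -[leRHS]invrK.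
    by rewrite lef_pV2 ?posrE ?invr_gt0.
  rewrite exprS !mulrA ler_wpM2r ?(ltW (Sn _ _))// -ler_pdivrMl// mulrC.
  exact: KS.
have /choice[z Hz] : forall i, exists z, D z /\ forall w, D w -> G i w <= G i z.
  move=> i; apply: (@uscg_max R _ (@dist R k) D (G i) z0 (@covered_cbox R k T _ K) Dz).
  have sub p : D p -> domain k T p by case.
  apply: uscgD; last first.
    apply/contg_usc/contgN/contgM; [exact: contg_cst|apply: contgX; exact: contg_japanese].
  apply: uscgM; last first.
  - apply: uscgD => p Dp e e0.
      have [d [d0 H]] := u_usc i p (sub p Dp) e e0; exists d; split => // p' Dp'; exact: H (sub _ Dp').
    have [d [d0 H]] := v_usc i p (sub p Dp) e e0; exists d; split => // p' Dp'; exact: H (sub _ Dp').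
  - by move=> p Dp; rewrite invr_gt0 om0//; exact: sub.
  - apply: contgV; first exact: contg_discount.
    by move=> p Dp; rewrite om0//; exact: sub.
case: (@Order.TotalTheory.arg_maxP _ _ _ i0 xpredT (fun i => G i (z i)) isT) => i _ Hi.
have Di : domain k T (z i) by case: (Hz i) => -[].
have GM j w : domain k T w -> G j w <= G i (z i).
  move=> Dw; case: (pselect (D w)) => [DDw|/(outside j w Dw) h].
    by apply: le_trans (Hi j isT); apply: (Hz j).2.
  apply: le_trans h (ltW (lt_le_trans G0 (le_trans _ (Hi i0 isT)))).
  exact: (Hz i0).2.
exists theta, (G i (z i)), i, (z i); split => //.
- by apply: lt_le_trans G0 _; exact: GM.
- by rewrite /weight /G subrK mulrA divff ?mul1r// gt_eqF// om0.
move=> j w Dw; rewrite /weight -ler_pdivrMl ?om0// -lerBlDr; exact: GM.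
Qed.

Theorem proposition4p1 (R : realType) (T : R) (k d m : nat)
    (b : R * 'cV[R]_k -> 'cV[R]_k) (sigma : R * 'cV[R]_k -> 'M[R]_(k, d))
    (f : 'I_m -> R * 'cV[R]_k -> R -> 'cV[R]_d -> R)
    (g : 'I_m -> 'I_m -> R * 'cV[R]_k -> R)
    (h : 'I_m -> 'cV[R]_k -> R)
    (u v : 'I_m -> R * 'cV[R]_k -> R)
    (T_gt0 : 0 < T) (k_gt0 : (0 < k)%N) (d_gt0 : (0 < d)%N) (m_gt0 : (0 < m)%N)
    (b_cont : {within domain k T, continuous b})
    (sigma_cont : {within domain k T, continuous sigma})
    (b_sigma : exists C : R, 0 <= C /\
       (forall (t : R) x, 0 <= t <= T ->
          enorm (b (t, x)) + enorm (sigma (t, x)) <= C * (1 + enorm x)) /\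
       (forall (t : R) x x', 0 <= t <= T ->
          enorm (b (t, x) - b (t, x')) + enorm (sigma (t, x) - sigma (t, x'))
            <= C * enorm (x - x')))
    (f_cont : forall i tx, domain k T tx -> forall eps : R, 0 < eps ->
       \forall tx' \near within (domain k T) (nbhs tx),
         forall y z, `|f i tx' y z - f i tx y z| <= eps)
    (f_lip : forall i, exists C : R, 0 <= C /\
       forall tx y z y' z', domain k T tx ->
         `|f i tx y z - f i tx y' z'| <= C * (`|y - y'| + enorm (z - z')))
    (g_cont : forall i j : 'I_m, i != j -> {within domain k T, continuous (g i j)})
    (g_ge0 : forall (i j : 'I_m) tx, i != j -> domain k T tx -> 0 <= g i j tx)
    (g_growth : forall i j : 'I_m, i != j -> poly_growth_on T (g i j))
    (* (i_1, ..., i_N) is (c 0, ..., c (N - 1)) *)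
    (g_no_free_loop : forall tx (N : nat) (c : nat -> 'I_m), domain k T tx ->
       (3 <= N)%N -> c 0%N = c N.-1 -> #|[set c (nat_of_ord n) | n : 'I_N]%SET| = N.-1 ->
       0 < \sum_(n < N.-1) g (c n) (c n.+1) tx)
    (h_cont : forall i, continuous (h i))
    (h_growth : forall i, poly_growth (h i))
    (h_obstacle : forall i x,
       (obstacle (fun j => h j x) (fun j l => g j l (T, x)) i <= (h i x)%:E)%E)
    (u_sub : viscosity_subsolution T b sigma f g h u)
    (v_super : viscosity_supersolution T b sigma f g h v)
    (u_growth : forall i, poly_growth_on T (u i))
    (v_growth : forall i, poly_growth_on T (v i)) :
  forall (i : 'I_m) (t : R) x, 0 <= t <= T -> u i (t, x) <= v i (t, x).
Proof.
have u_usc i := usc_onP (u_sub.1 i); have v_lsc i := lsc_onP (v_super.1 i).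
move=> i0 t0 x0 t0T; rewrite leNgt; apply/negP => uv0.
have Dz0 : domain k T (t0, x0) by split => //=; rewrite in_itv.
have [C [C0 [growth lipschitz]]] := b_sigma.
have [Cf [Cf0 Lf]] : exists Cf, 0 <= Cf /\ forall i tx y ze y' ze', domain k T tx ->
    `|f i tx y ze - f i tx y' ze'| <= Cf * (`|y - y'| + enorm (ze - ze')).
  have /choice[c Hc] := f_lip; exists (\sum_i c i); split.
    by apply: sumr_ge0 => i _; case: (Hc i).
  move=> i tx y ze y' ze' Dtx; apply: le_trans ((Hc i).2 tx y ze y' ze' Dtx) _.
  rewrite ler_wpM2r ?addr_ge0 ?enorm_ge0//.
  by rewrite (bigD1 i)//= lerDl sumr_ge0// => j _; case: (Hc j).
have [Bu [nu [Bu0 Hu]]] := growth_japanese u_growth.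
have [Bv [nv [Bv0 Hv]]] := growth_japanese v_growth.
pose n := maxn nu nv.
have uvB i w : domain k T w -> u i w - v i w <= (Bu + Bv) * japanese w.2 ^+ n.
  move=> Dw; have := Hu n i w (leq_maxl _ _) Dw; have := Hv n i w (leq_maxr _ _) Dw.
  by rewrite !ler_norml mulrDl => /andP[h1 _] /andP[_ h2]; lra.
pose l := Num.bound (`|rate_cst C Cf n| * (2 * T)).
have Hl : rate_cst C Cf n <= l%:R / (2 * T).
  rewrite ler_pdivlMr ?mulr_gt0//; apply: le_trans (_ : _ <= `|rate_cst C Cf n| * (2 * T)) _.
    by rewrite ler_wpM2r ?mulr_ge0 ?(ltW T_gt0)// ler_norm.
  by apply: ltW; apply: archi_boundP; rewrite mulr_ge0 ?mulr_ge0 ?(ltW T_gt0).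
have [theta [m0 [i1 [z [theta0 m00 Dz Ez Hz]]]]] :=
  weighted_maximum l T_gt0 (addr_ge0 Bu0 Bv0) u_usc v_lsc uvB Dz0 uv0.
(* At time T the terminal conditions give u <= h <= v, whereas u - v equals the positive weight at
   z. *)
have zT : z.1 < T.
  have zT : 0 <= z.1 <= T by case: Dz; rewrite /= in_itv.
  rewrite lt_neqAle (andP zT).2 andbT; apply/eqP => z1T.
  have : 0 < u i1 z - v i1 z.
    rewrite Ez mulr_gt0 ?(discount_gt0 _ T_gt0)// ltr_wpDr// mulr_ge0 ?(ltW theta0)//.
    by rewrite exprn_ge0// (le_trans ler01 (japanese_ge1 _)).
  have [_ [_ /(_ i1 z.2)]] := u_sub; have [_ [_ /(_ i1 z.2)]] := v_super.
  by rewrite -z1T -surjective_pairing; lra.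
have [i [Ei nloop]] := @no_free_loop R m (fun i j => g i j z) (fun i => u i z)
  (fun i => u i z - v i z = weight n l T theta m0 z) i1
  (fun N c N3 cN cc => g_no_free_loop z N c Dz N3 cN cc) Ez.
apply: (@no_free_maximum R T k d m b sigma f g h u v C Cf T_gt0 b_cont sigma_cont C0 _ lipschitz
  f_cont Cf0 Lf g_cont u_sub v_super n l theta m0 i z (ltW theta0) m00 Hl Dz zT _ (Hz i) Ei).
  by move=> [t x] [/= tT _]; apply: growth; rewrite in_itv/= in tT.
(* If u_j - g_ij >= u_i at z, then v_j - g_ij <= v_i yields u_j - v_j >= u_i - v_i. By maximality
   both are equalities: j is maximizing and g_ij = u_j - u_i, which [nloop] excludes. *)
move=> j ji; rewrite ltNge; apply/negP => uij.
have vij := supersolution_obstacle g_cont v_super Dz zT ji.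
have := Hz j z Dz; have Ej : u j z - v j z = weight n l T theta m0 z.
  by apply/eqP; rewrite eq_le Hz//=; lra.
by move=> _; have /eqP := nloop j ji Ej; apply; lra.
Qed.
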